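(* Let $\mathfrak g$ be a simple hermitian Lie algebra and $G$ a connected Lie group with Lie algebra $\mathfrak g$. If $C\subseteq K^{se}(0)$ is a compact subset, then $$\{pcp^{-1}: p\in\exp(\mathfrak p),\ c\in C\}\subseteq G^{se}(0)$$ is a closed subset of $G$.
   Context: A subalgebra $\mathfrak h$ of a real Lie algebra $\mathfrak g$ is compactly embedded if the closure of the group generated by $e^{\mathrm{ad}\,\mathfrak h}$ in $\mathrm{Aut}(\mathfrak g)$ is compact. A simple real Lie algebra $\mathfrak g$ is hermitian if its maximal compactly embedded subalgebras have non-zero (then one-dimensional) center. Fix a maximal compactly embedded subalgebra $\mathfrak k$, $K=\exp\mathfrak k$ the integral subgroup, $\mathfrak p$ the $\mathfrak k$-invariant complement of $\mathfrak k$ (Cartan decomposition $\mathfrak g=\mathfrak k\oplus\mathfrak p$), and $\mathfrak t\subseteq\mathfrak k$ maximal abelian. Let $\Delta_p$ be the set of non-compact roots (roots of $(\mathfrak g_{\mathbb C},\mathfrak t_{\mathbb C})$ with root space in $\mathfrak p_{\mathbb C}$). Choose $z\in\mathfrak z(\mathfrak k)$ with $\mathrm{Spec}(\mathrm{ad}\,z)=\{0,\pm i\}$ and put $\Delta_p^+=\{\alpha\in\Delta_p:i\alpha(z)=1\}$. Define $\mathfrak t^{se}(0)=\{x\in\mathfrak t:0<i\alpha(x)<2\pi\ \forall\alpha\in\Delta_p^+\}$, $\mathfrak g^{se}(0)=\mathrm{Ad}(G)\mathfrak t^{se}(0)$, $G^{se}(0)=\exp(\mathfrak g^{se}(0))$,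 and $K^{se}(0)=\exp(\mathrm{Ad}(K)\mathfrak t^{se}(0))=K\cap G^{se}(0)$. *)

(* Defs.v *)
From HB Require Import structures.
From mathcomp Require Import all_boot all_order all_algebra.
From mathcomp Require Import complex.
From mathcomp Require Import all_classical all_reals all_analysis.

Set Implicit Arguments.
Unset Strict Implicit.
Unset Printing Implicit Defensive.

Import Order.TTheory GRing.Theory Num.Theory.
Import numFieldNormedType.Exports.

Local Open Scope classical_set_scope.
Local Open Scope ring_scope.

(* The subgroup generated by S, for group operations given explicitly; it is
   used both for invertible matrices and for elements of a Lie group. *)
Definition generated_subgroup (T : Type) (one : T) (mul : T -> T -> T)
    (inv : T -> T) (S : set T) : set T :=
  \bigcap_(H in [set H : set T | [/\ S `<=` H, H one,
       forall a b, H a -> H b -> H (mul a b) & forall a, H a -> H (inv a)]]) H.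

Section LieAlgebras.
Context {R : realType} {n : nat}.

(* A real Lie algebra of dimension n, in coordinates. *)
Record lieAlgebra := LieAlgebra {
  bracket :> 'rV[R]_n -> 'rV[R]_n -> 'rV[R]_n;
  bracket_linear_l : forall y, linear (bracket^~ y);
  bracket_linear_r : forall x, linear (bracket x);
  bracket_alt : forall x, bracket x x = 0;
  bracket_jacobi : forall x y z,
    bracket x (bracket y z) + bracket y (bracket z x)
      + bracket z (bracket x y) = 0 }.

Implicit Types (g : lieAlgebra) (h k p t : {vspace 'rV[R]_n}).

(* Endomorphisms are matrices acting on row vectors on the right:
   y *m ad_mx g x = [x, y]. *)
Definition ad_mx g (x : 'rV[R]_n) : 'M[R]_n := lin1_mx (g x).

Definition expmx (A : 'M[R]_n) : 'M[R]_n :=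
  lim (series (fun j : nat => (j`!%:R)^-1 *: A ^+ j) @ \oo).

Definition aut_lie g : set 'M[R]_n :=
  [set A | A \in unitmx /\ forall x y, g x y *m A = g (x *m A) (y *m A)].

Definition subalgebra g h : Prop :=
  forall x y, x \in h -> y \in h -> g x y \in h.

Definition lie_ideal g h : Prop := forall x y, y \in h -> g x y \in h.

Definition simple_lie g : Prop :=
  (exists x y, g x y != 0) /\
  (forall h, lie_ideal g h -> h = 0%VS \/ h = fullv).

(* The intersection with aut_lie g makes this the closure in Aut(g), not the
   closure in End(g). *)
Definition compactly_embedded g h : Prop :=
  compact (closure (generated_subgroup 1%:M mulmx invmx
                      [set expmx (ad_mx g x) | x in [set` h]])
           `&` aut_lie g).

Definition compactly_embedded_subalgebra g h : Prop :=
  subalgebra g h /\ compactly_embedded g h.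

Definition maximal_compactly_embedded g k : Prop :=
  compactly_embedded_subalgebra g k /\
  (forall h, compactly_embedded_subalgebra g h -> (k <= h)%VS -> h = k).

Definition in_center g k (z : 'rV[R]_n) : Prop :=
  z \in k /\ forall x, x \in k -> g z x = 0.

Definition hermitian_lie g : Prop :=
  simple_lie g /\
  (forall k, maximal_compactly_embedded g k ->
     exists2 z, in_center g k z & z != 0).

Definition killing g (x y : 'rV[R]_n) : R := \tr (ad_mx g x *m ad_mx g y).

Definition cartan_decomposition g k p : Prop :=
  [/\ (k + p = fullv)%VS /\ (k :&: p = 0)%VS,
      forall x y, x \in k -> y \in k -> g x y \in k,
      forall x y, x \in k -> y \in p -> g x y \in p,
      forall x y, x \in p -> y \in p -> g x y \in k &
      (forall x, x \in k -> x != 0 -> killing g x x < 0) /\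
      (forall x, x \in p -> x != 0 -> 0 < killing g x x)].

Definition abelian_subspace g t : Prop :=
  forall x y, x \in t -> y \in t -> g x y = 0.

Definition maximal_abelian_in g k t : Prop :=
  [/\ (t <= k)%VS, abelian_subspace g t &
      forall h, (h <= k)%VS -> abelian_subspace g h -> (t <= h)%VS -> h = t].

(* Complexification. *)
Definition toC (x : 'rV[R]_n) : 'rV[R[i]]_n := map_mx (real_complex R) x.
Definition ReC (v : 'rV[R[i]]_n) : 'rV[R]_n := map_mx (@complex.Re R) v.
Definition ImC (v : 'rV[R[i]]_n) : 'rV[R]_n := map_mx (@complex.Im R) v.

Definition complexified h : set 'rV[R[i]]_n :=
  [set v | ReC v \in h /\ ImC v \in h].

Definition bracketC g (v w : 'rV[R[i]]_n) : 'rV[R[i]]_n :=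
  toC (g (ReC v) (ReC w) - g (ImC v) (ImC w))
  + 'i%C *: toC (g (ReC v) (ImC w) + g (ImC v) (ReC w)).

(* A functional on t_C is given by a linear extension to g_C; everything below
   depends only on its restriction to t_C. *)
Definition root_space g t (alpha : {linear 'rV[R[i]]_n -> (R[i])^o}) :
    set 'rV[R[i]]_n :=
  [set v | forall u, complexified t u -> bracketC g u v = alpha u *: v].

Definition is_root g t (alpha : {linear 'rV[R[i]]_n -> (R[i])^o}) : Prop :=
  (exists2 u, complexified t u & alpha u != 0) /\
  (exists2 v, root_space g t alpha v & v != 0).

Definition noncompact_root g p t
    (alpha : {linear 'rV[R[i]]_n -> (R[i])^o}) : Prop :=
  is_root g t alpha /\ root_space g t alpha `<=` complexified p.

Definition spec_ad g (x : 'rV[R]_n) : set R[i] :=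
  [set l | eigenvalue (map_mx (real_complex R) (ad_mx g x)) l].

Definition positive_noncompact_root g p t (z : 'rV[R]_n)
    (alpha : {linear 'rV[R[i]]_n -> (R[i])^o}) : Prop :=
  noncompact_root g p t alpha /\ 'i%C * alpha (toC z) = 1.

(* In the order of R[i], 0 < w < a%:C forces w to be real. *)
Definition t_se g p t (z : 'rV[R]_n) : set 'rV[R]_n :=
  [set x | x \in t /\
     forall alpha, positive_noncompact_root g p t z alpha ->
       0 < 'i%C * alpha (toC x) < real_complex R (2 * pi)].

End LieAlgebras.
Arguments lieAlgebra : clear implicits.

Section Smooth.
Context {R : realType} {V W : normedModType R}.

(* f is of class C^k on the open set U. *)
Fixpoint Ck (k : nat) (U : set V) (f : V -> W) : Prop :=
  match k with
  | 0 => forall x, U x -> {for x, continuous f}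
  | k'.+1 => (forall x, U x -> differentiable f x) /\
             (forall v, Ck k' U (fun x => 'd f x v))
  end.

Definition smooth_on (U : set V) (f : V -> W) : Prop := forall k, Ck k U f.

End Smooth.

(* The values of chart_map outside chart_dom, and of chart_inv outside the image
   of chart_dom, are irrelevant. *)
Record chart (R : realType) (n : nat) (M : topologicalType) := Chart {
  chart_dom : set M;
  chart_map :> M -> 'rV[R]_n;
  chart_inv : 'rV[R]_n -> M;
  chart_dom_open : open chart_dom;
  chart_img_open : open (chart_map @` chart_dom);
  chart_map_continuous :
    forall x, chart_dom x -> {for x, continuous chart_map};
  chart_inv_continuous :
    forall v, (chart_map @` chart_dom) v -> {for v, continuous chart_inv};
  chart_mapK : forall x, chart_dom x -> chart_inv (chart_map x) = x }.

Definition chart_img (R : realType) (n : nat) (M : topologicalType)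
  (c : chart R n M) : set 'rV[R]_n := c @` chart_dom c.

(* A real Lie group of dimension n: a group on a smooth n-manifold whose
   operations are smooth, i.e. continuous and smooth in charts.  one_chart is a
   distinguished chart at 1, through which T_1(G) is identified with R^n. *)
HB.mixin Record isLieGroup (R : realType) (n : nat) G
    of Topological G & Group G := {
  lie_hausdorff : hausdorff_space G;
  atlas : set (chart R n G);
  atlas_cover : forall x : G, exists2 c, atlas c & chart_dom c x;
  atlas_smooth : forall c d, atlas c -> atlas d ->
    smooth_on (c @` (chart_dom c `&` chart_dom d)) (d \o chart_inv c);
  lie_mul_continuous : continuous (fun x : G * G => (x.1 * x.2)%g);
  lie_mul_smooth : forall c d e, atlas c -> atlas d -> atlas e ->
    smooth_on
      [set v : 'rV[R]_n * 'rV[R]_n | [/\ chart_img c v.1, chart_img d v.2 &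
         chart_dom e (chart_inv c v.1 * chart_inv d v.2)%g]]
      (fun v : 'rV[R]_n * 'rV[R]_n =>
         e (chart_inv c v.1 * chart_inv d v.2)%g);
  lie_inv_continuous : continuous (fun x : G => (x^-1)%g);
  lie_inv_smooth : forall c d, atlas c -> atlas d ->
    smooth_on [set v | chart_img c v /\ chart_dom d (chart_inv c v)^-1%g]
      (fun v => d (chart_inv c v)^-1%g);
  one_chart : chart R n G;
  one_chart_atlas : atlas one_chart;
  one_chart_dom : chart_dom one_chart 1%g }.

#[short(type="lieGroupType")]
HB.structure Definition LieGroup (R : realType) (n : nat) :=
  { G of isLieGroup R n G & Topological G & Group G }.

Section LieGroups.
Context {R : realType} {n : nat} (G : lieGroupType R n).

Local Notation phi := (@one_chart R n G).

(* Tangent map at 1 of conjugation by a. *)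
Definition Ad (a : G) (x : 'rV[R]_n) : 'rV[R]_n :=
  'd (fun v => phi (a * chart_inv phi v * a^-1)%g) (phi 1%g) x.

(* ad is the tangent map at 1 of Ad. *)
Definition lie_bracket (x y : 'rV[R]_n) : 'rV[R]_n :=
  'd (fun v => Ad (chart_inv phi v) y) (phi 1%g) x.

Definition has_lie_algebra (g : lieAlgebra R n) : Prop :=
  forall x y, lie_bracket x y = g x y.

Definition one_parameter_subgroup (x : 'rV[R]_n) (gam : R -> G) : Prop :=
  [/\ continuous gam, forall s u, gam (s + u) = (gam s * gam u)%g &
      is_derive (0 : R) (1 : R) (phi \o gam) x].

Definition lie_exp (x : 'rV[R]_n) : G :=
  xget 1%g [set gam 1 | gam in one_parameter_subgroup x].

Definition integral_subgroup (k : {vspace 'rV[R]_n}) : set G :=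
  generated_subgroup 1%g (fun a b => (a * b)%g) (fun a => (a^-1)%g)
    (lie_exp @` [set` k]).

Definition Ad_orbits (H : set G) (S : set 'rV[R]_n) : set 'rV[R]_n :=
  [set Ad a x | a in H & x in S].

Definition g_se (g : lieAlgebra R n) (p t : {vspace 'rV[R]_n})
  (z : 'rV[R]_n) : set 'rV[R]_n := Ad_orbits setT (t_se g p t z).

Definition G_se (g : lieAlgebra R n) (p t : {vspace 'rV[R]_n})
  (z : 'rV[R]_n) : set G := lie_exp @` g_se g p t z.

Definition K_se (g : lieAlgebra R n) (k p t : {vspace 'rV[R]_n})
  (z : 'rV[R]_n) : set G :=
  lie_exp @` Ad_orbits (integral_subgroup k) (t_se g p t z).

Definition exp_conjugates (p : {vspace 'rV[R]_n}) (C : set G) : set G :=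
  [set (a * c * a^-1)%g | a in lie_exp @` [set` p] & c in C].

End LieGroups.
Arguments G_se {R n} G g p t z.
Arguments K_se {R n} G g k p t z.

(* Main.v *)
Require Import Defs.
From HB Require Import structures.
From mathcomp Require Import all_boot all_order all_algebra.
From mathcomp Require Import complex.
From mathcomp Require Import all_classical all_reals all_analysis.
From mathcomp Require Import ring lra.
Import Order.TTheory GRing.Theory Num.Theory.
Import numFieldNormedType.Exports.
Set Implicit Arguments.
Unset Strict Implicit.
Unset Printing Implicit Defensive.
Local Open Scope classical_set_scope.
Local Open Scope ring_scope.

(* Ad(G) acts on g with the inner product -kappa(theta x, y) attached to the
   Cartan decomposition: Ad(exp x) is positive for x in p and Ad(c) is an
   isometry for c in K.  Put Phi(b) = tr(Ad(b) Ad(b)^* ).  Comparing e^(s ad x)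
   with e^(s ad y), y = Ad(c)^-1 x, a second-derivative estimate for
   tr(e^(s ad x) e^(-s ad y)) gives, for b = exp(x) c exp(-x),
     4 kappa(x - y, x - y) <= Phi(b) + Phi(b^-1).
   If c lies in K^se(0), it is conjugate to exp(h) with h in t and
   0 < i alpha(h) < 2 pi for every positive non-compact root alpha, so Ad(c) fixes
   no non-zero vector of p.  By compactness
   kappa(x - y, x - y) >= m |x|^2 uniformly in c in C, so near any point of G the
   conjugates exp(x) c exp(-x) come from x in a bounded set: the set is locally the
   continuous image of a compact set.

   Existence and continuity of the exponential map and differentiability of Ad are
   derived from the smoothness of the multiplication, with
   exp x = lim (q (x / m))^m for q the inverse of the chart at 1. *)

(** * Second-order estimates for the group law in a chart *)

(** The set exp(p) is not compact, so closedness is a properness statement about [x]. Only [x] has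
    to be bounded, since [C] is already compact in [G] itself; hence it does no harm that [Phi] sees
    only [Ad], whose kernel, the centre of [G], may be infinite.

    The obstacle to quadratic growth is that X = ad x and Y = ad y need not commute, so e^(2X)
    e^(-2Y) has no closed form. The symmetrised function tr(e^(sX) e^(-sY)) + tr(e^(-sX) e^(sY)) has
    zero derivative at s = 0 and second derivative at least 2 tr((X - Y)^2) for every s. It is
    evaluated at s = 2 because Ad(exp x) is its own adjoint, so [Phi] contains its square.

    The element [z] enters through the roots: by simplicity ad z is injective on p, so its
    eigenvalues there are i and -i, and every joint eigenvector of t in the complexified p is, up to
    conjugation, a root vector for a positive non-compact root.

    The function [lie_exp] is a choice among endpoints of one-parameter subgroups, with a default
    value. Nothing is known about it until such subgroups are shown to exist and to be unique;
    estimates on powers near 1 replace the theory of differential equations. *)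

Section MeanValue.
Context {R : realType}.

Lemma rV_norm_leP m (x : 'rV[R]_m) (M : R) : 0 <= M ->
  (`|x| <= M) <-> (forall i, `|x 0 i| <= M).
Proof.
move=> M0; rewrite [X in X <= _]/Num.Def.normr /= mx_normrE; split.
  by move=> /bigmax_leP[_ H] i; exact: (H (0, i)).
by move=> H; apply/bigmax_leP; split => // -[i j] _ /=; rewrite ord1.
Qed.

Lemma le_coord_norm m (x : 'rV[R]_m) i : `|x 0 i| <= `|x|.
Proof. exact: (rV_norm_leP x (normr_ge0 x)).1. Qed.

Lemma is_derive_line (V W : normedModType R) (f : V -> W) (a h : V) (s : R) :
  differentiable f (a + s *: h) ->
  is_derive s 1 (fun u : R => f (a + u *: h)) ('d f (a + s *: h) h).
Proof.
move=> df.
have dl : is_diff s (fun u : R => a + u *: h) (fun u => u *: h).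
  have := is_diffD (is_diff_cst a s) (@is_diff_scalel _ _ s h).
  by rewrite add0r; apply.
have dc : differentiable (f \o (fun u : R => a + u *: h)) s.
  by apply: differentiable_comp.
apply: DeriveDef; first exact/derivable1_diffP.
by rewrite deriveE // diff_comp //= diff_val scale1r.
Qed.

(** The scalar mean value theorem is applied to each coordinate. The intermediate point depends on
    the coordinate, which is harmless because the norm is a maximum over coordinates. *)
Lemma mean_value_rV (V : normedModType R) m (f : V -> 'rV[R]_m) (a b : V) (M : R) :
  (forall s : R, 0 <= s <= 1 -> differentiable f (a + s *: (b - a))) ->
  (forall s : R, 0 <= s <= 1 -> `|'d f (a + s *: (b - a)) (b - a)| <= M) ->
  `|f b - f a| <= M.
Proof.
move=> df dM.
have M0 : 0 <= M by apply: le_trans (dM 0 _); rewrite ?lexx ?ler01.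
apply/rV_norm_leP => // i.
pose g (s : R) : R := f (a + s *: (b - a)) 0 i.
have dg (s : R) : 0 <= s <= 1 ->
    is_derive s 1 g ('d f (a + s *: (b - a)) (b - a) 0 i).
  move=> s01; have ds := is_derive_line (df s s01).
  apply: DeriveDef.
    by have /derivable_mxP := @ex_derive _ _ _ _ _ _ _ ds; apply.
  by have := @derive_val _ _ _ _ _ _ _ ds; rewrite derive_mx // => <-; rewrite mxE.
have [||c c01] := @MVT_segment R g (fun s => 'd f (a + s *: (b - a)) (b - a) 0 i) 0 1 ler01.
- by move=> x; rewrite in_itv /= => /andP[x0 x1]; apply: dg; rewrite !ltW.
- apply: derivable_within_continuous => x; rewrite in_itv /= => x01.
  exact: (@ex_derive _ _ _ _ _ _ _ (dg x x01)).
rewrite /g scale1r scale0r addr0 subr0 mulr1 [a + _]addrC subrK !mxE => ->.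
apply: le_trans (dM c _); last by move: c01; rewrite in_itv.
exact: le_coord_norm.
Qed.

End MeanValue.

Section MixedDifference.
Context {R : realType} {n m : nat}.
Local Notation V := 'rV[R]_n.
Local Notation W := 'rV[R]_m.

Lemma linear_inl_sum (U : lmodType R) (g : {linear (V * V)%type -> U}) (h : V) :
  g (h, 0) = \sum_i h 0 i *: g (delta_mx 0 i, 0).
Proof.
have E : (h, 0) = \sum_i h 0 i *: ((delta_mx 0 i, 0) : V * V).
  rewrite [LHS]surjective_pairing [RHS]surjective_pairing.
  rewrite !(raddf_sum fst) !(raddf_sum snd) /=; congr pair.
    exact: row_sum_delta.
  by rewrite big1 // => i _; rewrite /= scaler0.
by rewrite E linear_sum; apply: eq_bigr => i _; rewrite linearZ.
Qed.

Lemma linear_inr_sum (U : lmodType R) (g : {linear (V * V)%type -> U}) (h : V) :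
  g (0, h) = \sum_i h 0 i *: g (0, delta_mx 0 i).
Proof.
have E : (0, h) = \sum_i h 0 i *: ((0, delta_mx 0 i) : V * V).
  rewrite [LHS]surjective_pairing [RHS]surjective_pairing.
  rewrite !(raddf_sum fst) !(raddf_sum snd) /=; congr pair.
    by rewrite big1 // => i _; rewrite /= scaler0.
  exact: row_sum_delta.
by rewrite E linear_sum; apply: eq_bigr => i _; rewrite linearZ.
Qed.

Lemma norm_sum_coord_le (h : V) (w : 'I_n -> W) (M : R) :
  (forall i, `|w i| <= M) -> `|\sum_i h 0 i *: w i| <= n%:R * M * `|h|.
Proof.
move=> wM; apply: le_trans (ler_norm_sum _ _ _) _.
apply: (@le_trans _ _ (\sum_(i < n) `|h| * M)).
  apply: ler_sum => i _; rewrite normrZ.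
  by apply: ler_pM => //; apply: le_coord_norm.
rewrite sumr_const card_ord -[_ *+ n]mulr_natl; by rewrite [`|h| * M]mulrC mulrA.
Qed.

(** The mean value theorem is used twice: on [x |-> f (x, v) - f (x, v')], whose derivative is a
    difference of first partials, then on these partials in the second variable. Each use expands an
    increment over [n] coordinates, hence the two factors [n] beside the bound [M] on the mixed
    second partials. For the product in a chart this measures how far multiplication is from
    addition. *)
Lemma mixed_difference_le (f : V * V -> W) (U : set (V * V)) (a b : V) :
  nbhs (a, b) U -> Ck 2 U f ->
  exists r C : R, [/\ 0 < r, 0 <= C &
    forall u u' v v', `|u - a| <= r -> `|u' - a| <= r ->
      `|v - b| <= r -> `|v' - b| <= r ->
    `|f (u, v) - f (u', v) - (f (u, v') - f (u', v'))| <=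
       C * `|u - u'| * `|v - v'|].
Proof.
move=> nU [fU f'U].
pose e1 (i : 'I_n) : V * V := (delta_mx 0 i, 0).
pose e2 (i : 'I_n) : V * V := (0, delta_mx 0 i).
pose D i j x := 'd (fun y => 'd f y (e1 i)) x (e2 j).
have Dbound : exists2 M : R, 0 <= M &
    \forall x \near (a, b), forall i j, `|D i j x| <= M.
  (* The [+ 1] is the slack used up by the continuity of each [D i j] at [(a, b)]. *)
  exists (\big[Num.max/0]_(ij : 'I_n * 'I_n) (`|D ij.1 ij.2 (a, b)| + 1)).
    by rewrite bigmax_idl le_max lexx.
  set M := \big[_/_]_ij _.
  apply: (@filter_forall _ _ (fun i x => forall j, `|D i j x| <= M) (nbhs (a, b)) _) => i.
  apply: (@filter_forall _ _ (fun j x => `|D i j x| <= M) (nbhs (a, b)) _) => j.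
  have Dc : {for (a, b), continuous (D i j)}.
    have [_ /(_ (e2 j)) H] := f'U (e1 i).
    by apply: H; exact: nbhs_singleton nU.
  have /cvgrPdist_lt/(_ 1 ltr01) := Dc.
  apply: filterS => x; rewrite distrC => Hx.
  apply: le_trans (le_bigmax _ _ (i, j)) => /=.
  rewrite -[D i j x](subrK (D i j (a, b))).
  by rewrite addrC; apply: le_trans (ler_normD _ _) _; rewrite lerD2l ltW.
case: Dbound => M M0 nD.
have [/= e e0 He] := (nbhs_ballP _ _).1 (filterI nU nD).
pose r := e / 2; have r0 : 0 < r by rewrite divr_gt0.
have Hr u v : `|u - a| <= r -> `|v - b| <= r ->
    U (u, v) /\ forall i j, `|D i j (u, v)| <= M.
  move=> ua vb; apply: He; have re : r < e by rewrite /r; lra.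
  by split; rewrite /= -ball_normE /= distrC; apply: le_lt_trans re.
exists r, (n%:R * (n%:R * M)); split => //; first by rewrite !mulr_ge0.
have conv (c x y : V) s : 0 <= s <= 1 -> `|x - c| <= r -> `|y - c| <= r ->
    `|x + s *: (y - x) - c| <= r.
  move=> /andP[s0 s1] xr yr.
  have -> : x + s *: (y - x) - c = (1 - s) *: (x - c) + s *: (y - c).
    by apply/rowP => i; rewrite !mxE; ring.
  apply: le_trans (ler_normD _ _) _; rewrite !normrZ !ger0_norm ?subr_ge0 //.
  have : (1 - s) * `|x - c| <= (1 - s) * r by rewrite ler_wpM2l ?subr_ge0.
  have : s * `|y - c| <= s * r by rewrite ler_wpM2l.
  lra.
have step i u v v' : `|u - a| <= r -> `|v - b| <= r -> `|v' - b| <= r ->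
    `|'d f (u, v) (e1 i) - 'd f (u, v') (e1 i)| <= n%:R * M * `|v - v'|.
  move=> ua vb vb'.
  have line (s : R) : (u, v') + s *: ((u, v) - (u, v')) = (u, v' + s *: (v - v')).
    congr pair => /=; first by rewrite subrr scaler0 addr0.
  apply: (@mean_value_rV _ _ _ (fun y => 'd f y (e1 i)) (u, v') (u, v)) => s s01.
    rewrite line; have [H _] := f'U (e1 i); apply: H.
    by apply: (Hr _ _ _ _).1 => //; apply: conv.
  rewrite line.
  have -> : (u, v) - (u, v') = (0, v - v') :> V * V.
    by congr pair; rewrite /= ?subrr.
  rewrite linear_inr_sum; apply: norm_sum_coord_le => j.
  by apply: (Hr _ _ _ _).2 => //; apply: conv.
move=> u u' v v' ua ua' vb vb'.
pose F (x : V) := f (x, v) - f (x, v').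
have dF x : `|x - a| <= r -> is_diff x F
    (fun h => 'd f (x, v) (h, 0) - 'd f (x, v') (h, 0)).
  move=> xa.
  have d1 w : `|w - b| <= r ->
      is_diff x (fun x : V => f (x, w)) (fun h => 'd f (x, w) (h, 0)).
    move=> wb.
    have dp : is_diff x (fun x : V => (x, w)) (fun h => (h, 0)).
      exact: (is_diff_pair (is_diff_id x) (is_diff_cst w x)).
    have df : is_diff (x, w) f ('d f (x, w)).
      by apply: differentiableP; apply: fU; apply: (Hr _ _ _ _).1.
    exact: (is_diff_comp dp df).
  exact: (is_diffB (d1 v vb) (d1 v' vb')).
have -> : f (u, v) - f (u', v) - (f (u, v') - f (u', v')) = F u - F u'.
  by rewrite /F !opprB addrACA [in RHS]addrACA; congr (_ + _); rewrite addrC.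
have -> : n%:R * (n%:R * M) * `|u - u'| * `|v - v'| =
    n%:R * (n%:R * M * `|v - v'|) * `|u - u'| by ring.
apply: mean_value_rV => s s01.
  by apply: (@ex_diff _ _ _ _ _ _ _ (dF _ _)); apply: conv.
rewrite (@diff_val _ _ _ _ _ _ _ (dF _ (conv _ _ _ _ s01 ua' ua))).
set x := u' + _; have xa : `|x - a| <= r by apply: conv.
have E w := linear_inl_sum ('d f (x, w)) (u - u').
have EE := congr2 (fun p q : W => p - q) (E v) (E v').
rewrite /= -sumrB in EE.
apply: (@eq_ind_r _ _ (fun w : W => `|w| <= _) _ _ EE).
rewrite (eq_bigr (fun i => (u - u') 0 i *:
  ('d f (x, v) (delta_mx 0 i, 0) - 'd f (x, v') (delta_mx 0 i, 0)))).
  by apply: norm_sum_coord_le => i; apply: step.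
by move=> i _; rewrite scalerBr.
Qed.

End MixedDifference.

(** * Coordinates at the identity, centred at 0 *)

Section LocalCoordinates.
Context {R : realType} {n : nat} (G : lieGroupType R n).
Local Notation V := 'rV[R]_n.
Local Notation phi := (@one_chart R n G).
Local Notation e := (phi 1%g).

Definition lie_loc (v : V) : G := chart_inv phi (e + v).
Definition lie_coord (a : G) : V := phi a - e.
Local Notation q := lie_loc.
Local Notation lg := lie_coord.

Lemma chart_img_one : chart_img phi e.
Proof. by exists 1%g => //; exact: one_chart_dom. Qed.

Lemma nbhs_chart_img : nbhs e (chart_img phi).
Proof. by apply: open_nbhs_nbhs; split; [exact: chart_img_open|exact: chart_img_one]. Qed.

Lemma nbhs_chart_dom : nbhs (1%g : G) (chart_dom phi).
Proof. by apply: open_nbhs_nbhs; split; [exact: chart_dom_open|exact: one_chart_dom]. Qed.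

Lemma chart_invK (M : topologicalType) (c : chart R n M) (w : V) :
  chart_img c w -> chart_dom c (chart_inv c w) /\ c (chart_inv c w) = w.
Proof. by move=> [x cx <-]; rewrite chart_mapK. Qed.

Lemma lie_loc0 : q 0 = 1%g.
Proof. by rewrite /q addr0 chart_mapK //; exact: one_chart_dom. Qed.

Lemma lie_coord1 : lg 1%g = 0.
Proof. by rewrite /lg subrr. Qed.

Lemma lie_coordK a : chart_dom phi a -> q (lg a) = a.
Proof. by move=> da; rewrite /q /lg addrC subrK chart_mapK. Qed.

Lemma lie_loc_continuous v : chart_img phi (e + v) -> {for v, continuous q}.
Proof.
move=> iv; apply: (@continuous_comp _ _ _ (fun v => e + v) (chart_inv phi)).
  by apply: continuousD; [exact: cst_continuous|].
exact: chart_inv_continuous.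
Qed.

Lemma lie_coord_continuous a : chart_dom phi a -> {for a, continuous lg}.
Proof.
move=> da; apply: continuousB; last exact: cst_continuous.
exact: chart_map_continuous.
Qed.

(** The last two fields say that translating by an element of coordinate [v] distorts differences of
    coordinates by a relative error of at most [C * |v|]. The bound [C * r <= 1 / 2] keeps this
    relative error at most one half throughout the ball, which is what closes the inductions on
    powers. *)
Record local_radius (r C : R) : Prop := LocalRadius {
  lr_gt0 : 0 < r;
  lr_C : 0 <= C;
  lr_Cr : C * r <= 1 / 2;
  lr_img : forall v, `|v| <= r -> chart_img phi (e + v);
  lr_dom : forall u v, `|u| <= r -> `|v| <= r -> chart_dom phi (q u * q v)%g;
  lr_l : forall u u' v, `|u| <= r -> `|u'| <= r -> `|v| <= r ->
    `|lg (q u * q v)%g - lg (q u' * q v)%g - (u - u')| <= C * `|u - u'| * `|v|;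
  lr_r : forall u v v', `|u| <= r -> `|v| <= r -> `|v'| <= r ->
    `|lg (q u * q v)%g - lg (q u * q v')%g - (v - v')| <= C * `|u| * `|v - v'| }.

Definition mul_dom : set (V * V) :=
  [set v : V * V | [/\ chart_img phi v.1, chart_img phi v.2 &
         chart_dom phi (chart_inv phi v.1 * chart_inv phi v.2)%g]].

Definition chart_mul (v : V * V) : V :=
  phi (chart_inv phi v.1 * chart_inv phi v.2)%g.

Lemma nbhs_mul_dom : nbhs (e, e) mul_dom.
Proof.
have inv1 : chart_inv phi e = 1%g by apply: chart_mapK; exact: one_chart_dom.
have H1 : \forall v \near (e, e), chart_img phi v.1.
  by apply: cvg_fst; exact: nbhs_chart_img.
have H2 : \forall v \near (e, e), chart_img phi v.2.
  by apply: cvg_snd; exact: nbhs_chart_img.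
have H3 : \forall v \near (e, e),
    chart_dom phi (chart_inv phi v.1 * chart_inv phi v.2)%g.
  have c : (chart_inv phi v.1, chart_inv phi v.2) @[v --> (e, e)] -->
      ((chart_inv phi e, chart_inv phi e) : G * G).
    have ic : {for e, continuous (chart_inv phi)}.
      by apply: chart_inv_continuous; exact: chart_img_one.
    apply: cvg_pair.
      by apply: (cvg_comp fst (chart_inv phi) cvg_fst ic).
    by apply: (cvg_comp snd (chart_inv phi) cvg_snd ic).
  have := cvg_comp _ _ c (@lie_mul_continuous _ _ G _).
  apply; rewrite /= inv1 mulg1; exact: nbhs_chart_dom.
by near=> v; split; near: v.
Unshelve. all: by end_near. Qed.

Lemma chart_mul_smooth : smooth_on mul_dom chart_mul.
Proof. by apply: lie_mul_smooth; exact: one_chart_atlas. Qed.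

(** Placing one of the base points of [mixed_difference_le] at the identity turns two of the four
    products into the coordinates themselves. *)
Lemma exists_local_radius : exists r C, local_radius r C.
Proof.
have [r1 [C [r10 C0 H]]] := mixed_difference_le nbhs_mul_dom (chart_mul_smooth 2).
have [/= r2 r20 Hr2] := (nbhs_ballP _ _).1 nbhs_mul_dom.
(* Halving [r2] passes from an open ball to non-strict bounds; the last term gives [C * r <= 1 / 2],
   with [C + 1] in place of [C] since [C] may vanish. *)
pose r := Num.min (r2 / 2) (Num.min r1 (1 / (2 * (C + 1)))).
have rr1 : r <= r1 by rewrite /r !ge_min lexx orbT.
have rr2 : r < r2.
  by apply: (@le_lt_trans _ _ (r2 / 2)); [rewrite /r ge_min lexx|lra].
have r0 : 0 < r.
  by rewrite !lt_min r10 !divr_gt0 // mulr_gt0 // ltr_wpDl.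
have Cr : C * r <= 1 / 2.
  apply: (@le_trans _ _ (C * (1 / (2 * (C + 1))))).
    by rewrite ler_wpM2l // /r !ge_min lexx !orbT.
  have -> : C * (1 / (2 * (C + 1))) = C / (C + 1) / 2 by field; lra.
  by rewrite ler_pM2r ?invr_gt0 // ler_pdivrMr; lra.
have small v : `|v| <= r -> `|e + v - e| <= r by rewrite addrAC subrr add0r.
have dom u v : `|u| <= r -> `|v| <= r -> mul_dom (e + u, e + v).
  move=> ur vr; apply: Hr2; split; rewrite /= -ball_normE /= opprD addNKr normrN.
    exact: le_lt_trans rr2.
  exact: le_lt_trans rr2.
have eK (x y : V) : e + x - (e + y) = x - y by rewrite opprD addrACA subrr add0r.
have z : `|0 : V| <= r by rewrite normr0 ltW.
have m0r v : `|v| <= r -> chart_mul (e, e + v) = e + v.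
  move=> vr; have [_ i2 _] := dom 0 v z vr.
  rewrite /chart_mul /= chart_mapK; last exact: one_chart_dom.
  by rewrite mul1g (chart_invK i2).2.
have m0l v : `|v| <= r -> chart_mul (e + v, e) = e + v.
  move=> vr; have [_ i2 _] := dom 0 v z vr.
  rewrite /chart_mul /= (chart_mapK (one_chart_dom)).
  by rewrite mulg1 (chart_invK i2).2.
exists r, C; split => //.
- by move=> v vr; have [] := dom v v vr vr.
- by move=> u v ur vr; have [] := dom u v ur vr.
- move=> u u' v ur ur' vr.
  have := H (e + u) (e + u') (e + v) e.
  rewrite subrr normr0 => /(_ (le_trans (small _ ur) rr1)).
  move=> /(_ (le_trans (small _ ur') rr1) (le_trans (small _ vr) rr1) (ltW r10)).
  rewrite !m0l // /chart_mul /= -/(q u) -/(q u') -/(q v) /lg.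
  have -> (x y : V) : x - e - (y - e) = x - y by rewrite opprB addrA subrK.
  by rewrite eK [e + v - _]addrAC subrr add0r.
- move=> u v v' ur vr vr'.
  have := H (e + u) e (e + v) (e + v') (le_trans (small _ ur) rr1).
  rewrite subrr normr0 => /(_ (ltW r10)).
  move=> /(_ (le_trans (small _ vr) rr1) (le_trans (small _ vr') rr1)).
  rewrite !m0r // /chart_mul /= -/(q u) -/(q v') -/(q v) /lg.
  have -> (x y x' y' : V) : x - e - (y - e) - (x' - y') = x - (e + x') - (y - (e + y')).
    by apply/rowP => i; rewrite !mxE; ring.
  rewrite eK.
  by rewrite [e + u - _]addrAC subrr add0r.
Qed.

End LocalCoordinates.

(** * Limits from explicit rates, and derivatives at 0 without quotients *)

Section Rates.
Context {R : realType}.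

Lemma cvg_div_succ (c : R) : c / m.+1%:R @[m --> \oo] --> (0 : R).
Proof.
rewrite (_ : (fun m : nat => c / m.+1%:R) = (fun m => c * harmonic m)) //.
by rewrite -[X in _ --> X](mulr0 c); apply: cvgMr; exact: cvg_harmonic.
Qed.

Lemma cvg_of_rate (V : normedModType R) (u : nat -> V) (l : V) (c : R) :
  (forall m, `|u m - l| <= c / m.+1%:R) -> u m @[m --> \oo] --> l.
Proof.
move=> H; apply/cvgrPdist_le => eps eps0.
have c0 := cvg_div_succ c.
move/cvgrPdist_le : c0 => /(_ _ eps0); apply: filterS => m.
rewrite sub0r normrN => Hm; rewrite distrC; apply: le_trans (H m) _.
exact: le_trans (ler_norm _) Hm.
Qed.

Lemma cvg_of_cauchy_rate n (u : nat -> 'rV[R]_n) (c : R) :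
  (forall m k, `|u m - u k| <= c / m.+1%:R + c / k.+1%:R) ->
  cvg (u m @[m --> \oo]).
Proof.
move=> H; apply/cauchy_cvgP; apply: cauchy_exP => eps eps0.
have c0 := cvg_div_succ c.
have e2 : 0 < eps / 2 by rewrite divr_gt0.
move/cvgrPdist_lt : c0 => /(_ _ e2) [N _ HN].
exists (u N); exists N => // m Nm; rewrite /= -ball_normE /=.
have /= h1 := HN N (leqnn N); have /= h2 := HN m Nm.
rewrite sub0r normrN in h1; rewrite sub0r normrN in h2.
have {}h1 := le_lt_trans (ler_norm _) h1; have {}h2 := le_lt_trans (ler_norm _) h2.
by apply: le_lt_trans (H _ _) _; rewrite [eps]splitr; apply: ltrD.
Qed.

Lemma is_derive0P (V : normedModType R) (f : R -> V) (l : V) :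
  is_derive (0 : R) 1 f l <->
  (forall eps : R, 0 < eps -> \forall h \near (0 : R), `|f h - f 0 - h *: l| <= eps * `|h|).
Proof.
split.
  move=> df eps eps0.
  have [dd <-] := df.
  move/cvgrPdist_le : dd => /(_ _ eps0) [/= d d0 Hd].
  exists d => //= h; rewrite /= sub0r normrN => hd.
  have [->|h0] := eqVneq h 0; first by rewrite subrr scale0r subr0 !normr0 mulr0.
  have := Hd h; rewrite /= sub0r normrN => /(_ hd h0).
  rewrite addr0 [h%:A]mulr1 -/(derive f 0 1).
  have -> : f h - f 0 - h *: 'D_1 f 0 =
      - (h *: ('D_1 f 0 - h^-1 *: (f h - f 0))).
    by rewrite scalerBr scalerA divff // scale1r opprB.
  by rewrite normrN normrZ mulrC => H; rewrite ler_wpM2r.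
move=> H.
have L : h^-1 *: (f (h *: 1 + 0) - f 0) @[h --> 0^'] --> l.
  apply/cvgrPdist_le => eps eps0.
  have [/= d d0 Hd] := H _ eps0.
  exists d => //= h hd h0; rewrite addr0 [h%:A]mulr1.
  have -> : l - h^-1 *: (f h - f 0) = - (h^-1 *: (f h - f 0 - h *: l)).
    by rewrite [in RHS]scalerBr scalerA mulVf // scale1r opprB.
  rewrite normrN normrZ normfV ler_pdivrMl ?normr_gt0 //.
  by rewrite mulrC; apply: Hd.
apply: DeriveDef; first by apply/cvg_ex; exists l.
exact: cvg_lim L.
Qed.

Lemma near0_mul (c eps : R) : 0 <= c -> 0 < eps -> \forall h \near (0 : R), c * `|h| <= eps.
Proof.
move=> c0 eps0.
have e1 : 0 < eps / (c + 1) by rewrite divr_gt0 // ltr_wpDl.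
exists (eps / (c + 1)) => //= h; rewrite /= sub0r normrN => hh.
apply: (@le_trans _ _ ((c + 1) * `|h|)); first by rewrite ler_wpM2r //; lra.
by rewrite mulrC -ler_pdivlMr ?ltr_wpDl // ltW.
Qed.

Lemma cvgn_pullback (P : set R) (c : R) : (\forall h \near (0 : R), P h) ->
  \forall m \near \oo, P (c / m.+1%:R).
Proof.
move=> nP.
have c0 := cvg_div_succ c.
exact: c0 nP.
Qed.

End Rates.

(** * The exponential map *)

Section LocalExponential.
Context {R : realType} {n : nat} (G : lieGroupType R n).
Local Notation V := 'rV[R]_n.
Local Notation phi := (@one_chart R n G).
Local Notation e := (phi 1%g).
Local Notation q := (@lie_loc R n G).
Local Notation lg := (@lie_coord R n G).

Lemma lie_expg_continuous k : continuous (fun a : G => (a ^+ k)%g).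
Proof.
elim: k => [|k IH] a; first by apply: (@cst_continuous _ _ 1%g).
rewrite (_ : (fun a : G => (a ^+ k.+1)%g) = (fun a => a * a ^+ k)%g); last first.
  by apply/funext => b; rewrite expgS.
have : (b, (b ^+ k)%g) @[b --> a] --> (a, (a ^+ k)%g).
  by apply: cvg_pair; [exact: cvg_id|exact: IH].
by move=> H; exact: (cvg_comp _ _ H (@lie_mul_continuous _ _ G _)).
Qed.

Definition loc_pow k v : V := lg (q v ^+ k)%g.
Definition exp_seq (x : V) m : V := loc_pow m (m%:R^-1 *: x).
(** Meaningful for [x] of norm at most [r / 4], where the sequence converges; elsewhere [lim] may
    return a default value, and [lexp] reaches large [x] by taking powers. The shift to [m.+1]
    avoids the inverse of 0. *)
Definition loc_exp (x : V) : V := lim (exp_seq x m.+1 @[m --> \oo]).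

Section Radius.
Variables (r C : R).
Hypothesis L : local_radius G r C.

Implicit Types v w x y : V.

Lemma lr_K v : `|v| <= r -> lg (q v) = v.
Proof.
by move=> /(lr_img L) /chart_invK[_ H]; rewrite /lie_coord H addrAC subrr add0r.
Qed.

Lemma lr_q_continuous v : `|v| <= r -> {for v, continuous q}.
Proof. by move=> /(lr_img L); apply: lie_loc_continuous. Qed.

(** The three claims feed one another in the induction. With [a = k * |v|], one more factor costs an
    error of at most [C * (2 * a) * |v|], which fits into [C * (a + |v|)^2 - C * a^2]. As
    [C * r <= 1 / 2], this quadratic error is at most half of the linear term, so the power stays in
    the ball of radius [r] and the next step is allowed. *)
Lemma loc_pow_bound k v : k%:R * `|v| <= r / 2 ->
  [/\ chart_dom phi (q v ^+ k)%g,
      `|loc_pow k v - k%:R *: v| <= C * (k%:R * `|v|) ^+ 2 &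
      `|loc_pow k v| <= 2 * (k%:R * `|v|)].
Proof.
have r0 := lr_gt0 L. have C0 := lr_C L.
have Cr := lr_Cr L.
elim: k => [|k IH] kv.
  rewrite /loc_pow expg0 lie_coord1 !(scale0r, mul0r) subrr normr0 expr0n /= !mulr0.
  by split => //; exact: one_chart_dom.
have v0 := normr_ge0 v.
have k0 : 0 <= k%:R :> R by [].
have kS : k.+1%:R = k%:R + 1 :> R by rewrite -natr1.
set a := k%:R * `|v|; have a0 : 0 <= a by rewrite mulr_ge0.
have aS : k.+1%:R * `|v| = a + `|v| by rewrite kS mulrDl mul1r.
rewrite aS in kv *.
have [|dk nk bk] := IH; first by rewrite -/a; lra.
set w := loc_pow k v in nk bk *.
have wr : `|w| <= r by apply: le_trans bk _; rewrite -/a; lra.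
have vr : `|v| <= r by lra.
have qw : q w = (q v ^+ k)%g by rewrite lie_coordK.
have E : (q v ^+ k.+1 = q w * q v)%g by rewrite qw expgSr.
have z : `|0 : V| <= r by rewrite normr0 ltW.
have B : `|lg (q w * q v)%g - v - w| <= C * `|w| * `|v|.
  have := lr_l L wr z vr; rewrite lie_loc0 mul1g lr_K //.
  by rewrite !subr0.
have B2 : `|loc_pow k.+1 v - k.+1%:R *: v| <= C * (a + `|v|) ^+ 2.
  have -> : loc_pow k.+1 v - k.+1%:R *: v =
      (lg (q w * q v)%g - v - w) + (w - k%:R *: v).
    rewrite /loc_pow E kS scalerDl scale1r.
    by rewrite addrA subrK opprD [- (_ *: _) - v]addrC addrA.
  apply: le_trans (ler_normD _ _) _; rewrite -/a in nk bk.
  have H1 : C * `|w| * `|v| <= C * (2 * a * `|v|).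
    by rewrite -mulrA ler_wpM2l // ler_wpM2r.
  have H2 : 0 <= C * `|v| ^+ 2 by rewrite mulr_ge0 // exprn_ge0.
  have -> : C * (a + `|v|) ^+ 2 = C * (2 * a * `|v|) + C * a ^+ 2 + C * `|v| ^+ 2 by ring.
  lra.
split => //; first by rewrite E; exact: (lr_dom L).
have -> : loc_pow k.+1 v = (loc_pow k.+1 v - k.+1%:R *: v) + k.+1%:R *: v by rewrite subrK.
apply: le_trans (ler_normD _ _) _; rewrite normrZ ger0_norm // aS.
have H1 : C * (a + `|v|) ^+ 2 <= C * ((a + `|v|) * r).
  rewrite ler_wpM2l // expr2 ler_wpM2l //; lra.
have H2 : (a + `|v|) * (C * r) <= (a + `|v|) * (1 / 2) by rewrite ler_wpM2l //; lra.
have H3 : C * ((a + `|v|) * r) = (a + `|v|) * (C * r) by ring.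
lra.
Qed.

(** With [D = |v - v'|], each step adds at most [D] from the new factor, [D / 2] from its distortion
    and [6 * D / 4] from the distortion of the distance already accumulated, in total [3 * D],
    within the allowed [6 * D]. The smallness hypotheses refer to a fixed [K] so that they persist
    through the induction on [k]. *)
Lemma loc_pow_lip K v v' k : (k <= K)%N ->
  K%:R * `|v| <= r / 2 -> K%:R * `|v'| <= r / 2 ->
  `|loc_pow k v - loc_pow k v'| <= 6 * k%:R * `|v - v'|.
Proof.
have r0 := lr_gt0 L. have C0 := lr_C L.
have Cr := lr_Cr L.
move=> kK Kv Kv'; elim: k kK => [|k IH] kK.
  by rewrite /loc_pow !expg0 subrr normr0 mulr0 mul0r.
have {}IH := IH (ltnW kK).
have kKR : k.+1%:R <= K%:R :> R by rewrite ler_nat.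
have k0 : 0 <= k%:R :> R by [].
have kS : k.+1%:R = k%:R + 1 :> R by rewrite -natr1.
have v0 := normr_ge0 v; have v0' := normr_ge0 v'.
have small (x : V) : K%:R * `|x| <= r / 2 -> k%:R * `|x| <= r / 2 /\ `|x| <= r / 2.
  move=> Hx; split; apply: le_trans Hx.
    by rewrite ler_wpM2r //; lra.
  rewrite -[X in X <= _]mul1r ler_wpM2r //; lra.
have [kv vr] := small _ Kv; have [kv' vr'] := small _ Kv'.
have [d1 _ b1] := loc_pow_bound kv.
have [d2 _ b2] := loc_pow_bound kv'.
set w := loc_pow k v in IH b1; set w' := loc_pow k v' in IH b2.
have E x : chart_dom phi (q x ^+ k)%g -> (q x ^+ k.+1 = q (loc_pow k x) * q x)%g.
  by move=> dx; rewrite expgSr lie_coordK.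
rewrite {1 2}/loc_pow !E // -/w -/w'.
have wr : `|w| <= r by lra.
have wr' : `|w'| <= r by lra.
have vr2 : `|v| <= r by lra.
have vr2' : `|v'| <= r by lra.
have B1 := lr_l L wr wr' vr2.
have B2 := lr_r L wr' vr2 vr2'.
set D := `|v - v'| in IH B2 *; have D0 : 0 <= D := normr_ge0 _.
set d := `|w - w'| in IH B1 *; have d0 : 0 <= d := normr_ge0 _.
have T : `|lg (q w * q v)%g - lg (q w' * q v')%g| <=
    C * d * `|v| + d + (C * `|w'| * D + D).
  have -> : lg (q w * q v)%g - lg (q w' * q v')%g =
     (lg (q w * q v)%g - lg (q w' * q v)%g - (w - w')) + (w - w') +
     ((lg (q w' * q v)%g - lg (q w' * q v')%g - (v - v')) + (v - v')).
    by rewrite !subrK addrA subrK.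
  apply: le_trans (ler_normD _ _) _; apply: lerD.
    by apply: le_trans (ler_normD _ _) _; rewrite lerD2r.
  by apply: le_trans (ler_normD _ _) _; rewrite lerD2r.
apply: le_trans T _.
have H1 : C * `|w'| * D <= (1 / 2) * D.
  by rewrite ler_wpM2r //; apply: le_trans Cr; rewrite ler_wpM2l.
have H2 : C * d * `|v| <= C * (6 * k%:R * D) * `|v|.
  by rewrite ler_wpM2r // ler_wpM2l.
have H3 : C * (6 * k%:R * D) * `|v| <= 6 * D * (1 / 4).
  have -> : C * (6 * k%:R * D) * `|v| = 6 * D * (C * (k%:R * `|v|)) by ring.
  rewrite ler_wpM2l ?mulr_ge0 //.
  apply: (@le_trans _ _ (C * (r / 2))); first by rewrite ler_wpM2l.
  lra.
have -> : 6 * k.+1%:R * D = 6 * k%:R * D + 6 * D by rewrite kS; ring.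
lra.
Qed.

(** Cutting each step [x / m] into [k] pieces changes its coordinate by at most [C * (|x| / m)^2],
    and the [m]-th power multiplies this by at most [6 * m]. The subdivided step may have norm up to
    [2 * |x| / m]; this is why [|x|] is bounded by [r / 4] while [loc_pow_lip] allows [r / 2]. *)
Lemma exp_seq_refine m k x : (0 < m)%N -> (0 < k)%N -> `|x| <= r / 4 ->
  `|exp_seq x (m * k) - exp_seq x m| <= 6 * C * `|x| ^+ 2 / m%:R.
Proof.
have r0 := lr_gt0 L. have C0 := lr_C L.
move=> m0 k0 xr.
have mR : 0 < m%:R :> R by rewrite ltr0n.
have kR : 0 < k%:R :> R by rewrite ltr0n.
pose y := (m * k)%N%:R^-1 *: x.
have ky : k%:R *: y = m%:R^-1 *: x.
  rewrite /y scalerA natrM invfM mulrCA divff ?mulr1 //; exact: lt0r_neq0.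
have nky : k%:R * `|y| = `|x| / m%:R.
  have := congr1 (fun w : V => `|w|) ky; move: (y) => y'.
  by rewrite /= 2!normrZ normfV !normr_nat => ->; rewrite mulrC.
have x0 := normr_ge0 x.
have xm : `|x| / m%:R <= `|x|.
  by rewrite ler_pdivrMr // ler_peMr // ler1n.
have [|dy ny by_] := @loc_pow_bound k y; first by rewrite nky; lra.
have E : exp_seq x (m * k) = loc_pow m (loc_pow k y).
  by rewrite /exp_seq -/y {2}/loc_pow {1}/loc_pow lie_coordK // [(m * k)%N]mulnC expgnA.
rewrite E /exp_seq; apply: le_trans (loc_pow_lip (leqnn m) _ _) _.
- apply: (@le_trans _ _ (m%:R * (2 * (k%:R * `|y|)))); first by rewrite ler_wpM2l.
  rewrite nky.
  have -> : m%:R * (2 * (`|x| / m%:R)) = 2 * `|x| by field; exact: lt0r_neq0.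
  lra.
- rewrite normrZ normfV ger0_norm ?ltW // mulrA divff ?lt0r_neq0 // mul1r; lra.
rewrite -ky; apply: le_trans (_ : 6 * m%:R * (C * (k%:R * `|y|) ^+ 2) <= _).
  by rewrite ler_wpM2l // mulr_ge0.
rewrite nky le_eqVlt; apply/orP; left; apply/eqP; field; exact: lt0r_neq0.
Qed.

(** Both terms are compared with the common refinement [m * k]. *)
Lemma exp_seq_cauchy m k x : (0 < m)%N -> (0 < k)%N -> `|x| <= r / 4 ->
  `|exp_seq x m - exp_seq x k| <= 6 * C * `|x| ^+ 2 / m%:R + 6 * C * `|x| ^+ 2 / k%:R.
Proof.
move=> m0 k0 xr.
have H1 := exp_seq_refine m0 k0 xr; have := exp_seq_refine k0 m0 xr.
rewrite mulnC => H2; rewrite distrC in H1.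
have -> : exp_seq x m - exp_seq x k =
  (exp_seq x m - exp_seq x (m * k)) + (exp_seq x (m * k) - exp_seq x k).
  by rewrite addrA subrK.
by apply: le_trans (ler_normD _ _) _; apply: lerD.
Qed.

Lemma loc_exp_cvg x : `|x| <= r / 4 -> exp_seq x m.+1 @[m --> \oo] --> loc_exp x.
Proof.
move=> xr; apply: (@cvg_of_cauchy_rate _ n _ (6 * C * `|x| ^+ 2)) => m k.
exact: exp_seq_cauchy.
Qed.

Lemma loc_exp_rate m x : (0 < m)%N -> `|x| <= r / 4 ->
  `|exp_seq x m - loc_exp x| <= 6 * C * `|x| ^+ 2 / m%:R.
Proof.
have r0 := lr_gt0 L. have C0 := lr_C L.
move=> m0 xr; apply/ler_addgt0Pr => eps eps0.
have e2 : 0 < eps / 2 by rewrite divr_gt0.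
have /cvgrPdist_le/(_ _ e2) H := loc_exp_cvg xr.
have /cvgrPdist_le/(_ _ e2) H2 := @cvg_div_succ R (6 * C * `|x| ^+ 2).
have [k [h1 h2]] := filter_ex (filterI H H2).
rewrite sub0r normrN in h2; have {}h2 := le_trans (ler_norm _) h2.
have h3 := @exp_seq_cauchy m k.+1 x m0 isT xr.
have -> : exp_seq x m - loc_exp x =
  (exp_seq x m - exp_seq x k.+1) + (exp_seq x k.+1 - loc_exp x).
  by rewrite addrA subrK.
apply: le_trans (ler_normD _ _) _; rewrite distrC in h1.
move: (_ / k.+1%:R) (_ / m%:R) h2 h3 => a b h2 h3; lra.
Qed.

Lemma exp_seq1 x : `|x| <= r / 4 -> exp_seq x 1 = x.
Proof.
have r0 := lr_gt0 L. have C0 := lr_C L.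
by move=> xr; rewrite /exp_seq invr1 scale1r /loc_pow expg1 lr_K //; lra.
Qed.

Lemma loc_exp_near x : `|x| <= r / 4 -> `|loc_exp x - x| <= 6 * C * `|x| ^+ 2.
Proof.
move=> xr; have := @loc_exp_rate 1 x isT xr.
by rewrite exp_seq1 // divr1 distrC.
Qed.

Lemma loc_exp_lip x y : `|x| <= r / 4 -> `|y| <= r / 4 ->
  `|loc_exp x - loc_exp y| <= 6 * `|x - y|.
Proof.
have r0 := lr_gt0 L. have C0 := lr_C L.
move=> xr yr; apply/ler_addgt0Pr => eps eps0.
have e2 : 0 < eps / 2 by rewrite divr_gt0.
have /cvgrPdist_le/(_ _ e2) H := loc_exp_cvg xr.
have /cvgrPdist_le/(_ _ e2) H2 := loc_exp_cvg yr.
have [k [h1 h2]] := filter_ex (filterI H H2).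
have nk (z : V) : k.+1%:R * `|k.+1%:R^-1 *: z| = `|z|.
  by rewrite normrZ normfV normr_nat mulrA divff ?mul1r.
have h3 : `|exp_seq x k.+1 - exp_seq y k.+1| <= 6 * `|x - y|.
  apply: le_trans (loc_pow_lip (leqnn _) _ _) _; rewrite ?nk; try lra.
  by rewrite -scalerBr -mulrA nk.
have -> : loc_exp x - loc_exp y =
  (loc_exp x - exp_seq x k.+1) + (exp_seq x k.+1 - exp_seq y k.+1) +
  (exp_seq y k.+1 - loc_exp y).
  by apply/rowP => i; rewrite !mxE; ring.
rewrite distrC in h2.
apply: le_trans (ler_normD _ _) _.
have := ler_normD (loc_exp x - exp_seq x k.+1) (exp_seq x k.+1 - exp_seq y k.+1).
lra.
Qed.

Lemma norm_loc_exp x : `|x| <= r / 4 -> `|loc_exp x| <= r.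
Proof.
have r0 := lr_gt0 L. have C0 := lr_C L.
move=> xr; have := loc_exp_near xr; rewrite -{2}(subrK x (loc_exp x)).
move: (loc_exp x - x) => w wb; apply: le_trans (ler_normD _ _) _.
have Cr := lr_Cr L.
have : 6 * C * `|x| ^+ 2 <= 6 * (C * r) * (r / 16).
  have -> : 6 * (C * r) * (r / 16) = 6 * C * (r / 4) ^+ 2 by field.
  rewrite ler_wpM2l ?mulr_ge0 // lerXn2r ?nnegrE //.
  exact: le_trans xr.
have : 6 * (C * r) * (r / 16) <= 6 * (1 / 2) * (r / 16).
  by rewrite ler_wpM2r ?divr_ge0 ?(ltW r0) // ler_wpM2l.
lra.
Qed.

Lemma loc_exp0 : loc_exp 0 = 0.
Proof.
have r0 := lr_gt0 L.
have := @loc_exp_near 0; rewrite normr0 => /(_ _).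
rewrite expr0n mulr0 subr0 normr_le0 => H; apply/eqP; apply: H.
by rewrite divr_ge0 // ltW.
Qed.

Lemma loc_exp_continuous x : `|x| < r / 4 -> {for x, continuous loc_exp}.
Proof.
have r0 := lr_gt0 L.
move=> xr; suff : loc_exp y @[y --> x] --> loc_exp x by [].
apply/(@cvgrPdist_le _ _ _ (nbhs x) (nbhs_filter x)) => eps eps0; near=> y.
have yr : `|y| < r / 4.
  near: y; apply: (@cvgr_norm_lt _ _ _ (nbhs x) _ id x) => //.
apply: le_trans (loc_exp_lip (ltW xr) (ltW yr)) _.
rewrite -ler_pdivlMl //; near: y.
have e6 : 0 < 6^-1 * eps by rewrite mulr_gt0.
by apply: (@cvgr_dist_le _ _ _ (nbhs x) _ id x).
Unshelve. all: by end_near. Qed.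

Lemma expg_loc_exp_cvg (k : nat) x : `|x| <= r / 4 ->
  (q (exp_seq x m.+1) ^+ k)%g @[m --> \oo] --> (q (loc_exp x) ^+ k)%g.
Proof.
move=> xr; have H := loc_exp_cvg xr.
have H1 := cvg_comp _ _ H (lr_q_continuous (norm_loc_exp xr)).
exact: (cvg_comp _ _ H1 (@lie_expg_continuous k _)).
Qed.

Lemma lie_cvg_unique (u v : nat -> G) (a b : G) :
  (\forall m \near \oo, u m = v m) ->
  u m @[m --> \oo] --> a -> v m @[m --> \oo] --> b -> a = b.
Proof.
move=> uv ua vb; have ub : u m @[m --> \oo] --> b.
  by apply: cvg_trans vb; apply: near_eq_cvg; apply: filterS uv => m ->.
exact: (@cvg_unique _ (@lie_hausdorff _ _ G) (u m @[m --> \oo]) _ _ _ ua ub).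
Qed.

Lemma lie_loc_exp_seq m x : (0 < m)%N -> `|x| <= r / 4 ->
  q (exp_seq x m) = (q (m%:R^-1 *: x) ^+ m)%g.
Proof.
have r0 := lr_gt0 L. have C0 := lr_C L.
move=> m0 xr; rewrite /exp_seq /loc_pow lie_coordK //.
have [|//] := @loc_pow_bound m (m%:R^-1 *: x).
rewrite normrZ normfV normr_nat mulrA divff ?mul1r ?pnatr_eq0 -?lt0n //; lra.
Qed.

(** Along the indices [k * m], the approximation for [k *: x] is exactly the [k]-th power of the
    [m]-th approximation for [x]; limits are unique since [G] is Hausdorff. *)
Lemma lie_loc_exp_expg k x : k%:R * `|x| <= r / 4 ->
  q (loc_exp (k%:R *: x)) = (q (loc_exp x) ^+ k)%g.
Proof.
have C0 := lr_C L.
case: k => [|k] kx.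
  by rewrite scale0r loc_exp0 lie_loc0 expg0.
have kxr : `|k.+1%:R *: x| <= r / 4 by rewrite normrZ normr_nat.
have xr : `|x| <= r / 4.
  apply: le_trans kx; rewrite ler_peMl // ler1n //.
apply: (@lie_cvg_unique (fun m => q (exp_seq (k.+1%:R *: x) (k.+1 * m.+1)))
   (fun m => (q (exp_seq x m.+1) ^+ k.+1)%g)).
- near=> m; rewrite !lie_loc_exp_seq //.
  rewrite -expgnA [(m.+1 * k.+1)%N]mulnC; congr (q _ ^+ _)%g.
  rewrite scalerA natrM; congr (_ *: _); field.
  by rewrite !(addrC 1) !natr1 !pnatr_eq0.
- have : exp_seq (k.+1%:R *: x) (k.+1 * m.+1) @[m --> \oo] --> loc_exp (k.+1%:R *: x).
    apply: (@cvg_of_rate _ _ _ _ (6 * C * `|k.+1%:R *: x| ^+ 2)) => m.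
    apply: le_trans (loc_exp_rate _ kxr) _ => //.
    rewrite ler_wpM2l ?mulr_ge0 ?exprn_ge0 // lef_pV2 ?posrE ?ltr0n //.
    by rewrite ler_nat leq_pmull.
  move=> H; exact: (cvg_comp _ _ H (lr_q_continuous (norm_loc_exp kxr))).
- exact: expg_loc_exp_cvg.
Unshelve. all: by end_near. Qed.

(** This is [lr_l] applied to the product of [q v] with its inverse, whose coordinate is 0; the
    smallness of [C * r] then bounds the coordinate of the inverse. *)
Lemma lie_inv_coord v : `|v| <= r -> `|lg (q v)^-1%g| <= r -> chart_dom phi (q v)^-1%g ->
  `|lg (q v)^-1%g + v| <= 2 * C * `|v| ^+ 2 /\ `|lg (q v)^-1%g| <= 2 * `|v|.
Proof.
have r0 := lr_gt0 L. have C0 := lr_C L.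
move=> vr; set w := lg _ => wr dv.
have qw : q w = (q v)^-1%g by rewrite lie_coordK.
have z : `|0 : V| <= r by rewrite normr0 ltW.
have := lr_l L vr z wr.
rewrite qw mulgV lie_coord1 lie_loc0 mul1g -/w sub0r subr0 -opprD normrN => H.
have Cr := lr_Cr L.
have v0 := normr_ge0 v; have w0 := normr_ge0 w.
have H1 : C * `|v| * `|w| <= (1 / 2) * `|w|.
  by rewrite ler_wpM2r //; apply: le_trans Cr; rewrite ler_wpM2l.
have H2 : `|w| <= `|w + v| + `|v|.
  have -> : `|w| = `|(w + v) - v| by rewrite addrK.
  exact: ler_normB.
have wb : `|w| <= 2 * `|v| by lra.
split => //; apply: le_trans H _.
have -> : 2 * C * `|v| ^+ 2 = C * `|v| * (2 * `|v|) by ring.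
by rewrite ler_wpM2l // mulr_ge0.
Qed.

Lemma near_lie_inv : \forall v \near (0 : V),
  `|lg (q v)^-1%g| <= r /\ chart_dom phi (q v)^-1%g.
Proof.
have r0 := lr_gt0 L.
have qc : {for (0 : V), continuous q} by apply: lr_q_continuous; rewrite normr0 ltW.
have ic : (q v)^-1%g @[v --> (0 : V)] --> (1%g : G).
  have := cvg_comp _ _ qc (@lie_inv_continuous _ _ G _).
  by rewrite lie_loc0 invg1.
have lc : lg (q v)^-1%g @[v --> (0 : V)] --> (0 : V).
  have := cvg_comp _ _ ic (lie_coord_continuous (one_chart_dom)).
  by rewrite lie_coord1.
near=> v; split.
  near: v; have /cvgrPdist_le/(_ _ r0) := lc.
  by apply: filterS => v; rewrite sub0r normrN.
by near: v; apply: ic; exact: nbhs_chart_dom.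
Unshelve. all: by end_near. Qed.

(** The inverse of the step [q (x / m)] has coordinate [- x / m] up to [2 * C * |x / m|^2]. Taking
    [m]-th powers multiplies the error by [6 * m], which leaves [12 * C * |x|^2 / m] and vanishes in
    the limit. *)
Lemma lie_loc_expN x : `|x| <= r / 8 -> q (loc_exp (- x)) = (q (loc_exp x))^-1%g.
Proof.
have r0 := lr_gt0 L. have C0 := lr_C L.
move=> xr8; have xr : `|x| <= r / 4 by have := normr_ge0 x; lra.
have nxr : `|- x| <= r / 4 by rewrite normrN.
pose w m := lg (q (m.+1%:R^-1 *: x))^-1%g.
have nm m (z : V) : m.+1%:R * `|m.+1%:R^-1 *: z| = `|z|.
  by rewrite normrZ normfV normr_nat mulrA divff ?mul1r.
have sm m (z : V) : `|m.+1%:R^-1 *: z| = `|z| / m.+1%:R.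
  by rewrite normrZ normfV normr_nat mulrC.
have sx m : `|m.+1%:R^-1 *: x| <= `|x|.
  by rewrite sm ler_pdivrMr // ler_peMr // ler1n.
have N : \forall m \near \oo, `|w m| <= r /\ chart_dom phi (q (m.+1%:R^-1 *: x))^-1%g.
  have c0 : m.+1%:R^-1 *: x @[m --> \oo] --> (0 : V).
    apply: (@cvg_of_rate _ _ _ _ `|x|) => m.
    by rewrite subr0 sm.
  exact: c0 near_lie_inv.
have rate : \forall m \near \oo,
   `|exp_seq (- x) m.+1 - lg (q (exp_seq x m.+1))^-1%g| <= 12 * C * `|x| ^+ 2 / m.+1%:R.
  near=> m.
  have [wr dw] : `|w m| <= r /\ chart_dom phi (q (m.+1%:R^-1 *: x))^-1%g by near: m.
  have [|i1 i2] := lie_inv_coord _ wr dw; first by apply: le_trans (sx m) _; lra.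
  rewrite lie_loc_exp_seq // -expVgn.
  rewrite -/(w m) in i1 i2.
  have -> : lg ((q (m.+1%:R^-1 *: x))^-1 ^+ m.+1)%g = loc_pow m.+1 (w m).
    by rewrite /loc_pow /w lie_coordK.
  apply: le_trans (loc_pow_lip (leqnn _) _ _) _.
  - by rewrite nm normrN; lra.
  - apply: (@le_trans _ _ (m.+1%:R * (2 * `|m.+1%:R^-1 *: x|))); first by rewrite ler_wpM2l.
    by rewrite mulrCA nm; lra.
  rewrite scalerN -opprD normrN addrC.
  apply: (@le_trans _ _ (6 * m.+1%:R * (2 * C * `|m.+1%:R^-1 *: x| ^+ 2))).
    by rewrite ler_wpM2l // mulr_ge0.
  by rewrite sm le_eqVlt; apply/orP; left; apply/eqP; field.
pose z m := lg (q (exp_seq x m.+1))^-1%g.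
have zc : z m @[m --> \oo] --> loc_exp (- x).
  have e0 := loc_exp_cvg nxr.
  have d0 : (exp_seq (- x) m.+1 - z m) @[m --> \oo] --> (0 : V).
    apply/cvgrPdist_le => eps eps0.
    have /cvgrPdist_le/(_ _ eps0) H := @cvg_div_succ R (12 * C * `|x| ^+ 2).
    near=> m; rewrite sub0r normrN.
    apply: (@le_trans _ _ (12 * C * `|x| ^+ 2 / m.+1%:R)); first by near: m.
    have Hm : `|0 - 12 * C * `|x| ^+ 2 / m.+1%:R| <= eps by near: m.
    by rewrite sub0r normrN in Hm; exact: le_trans (ler_norm _) Hm.
  have e1 : (exp_seq (- x) m.+1 - (exp_seq (- x) m.+1 - z m)) @[m --> \oo] -->
    loc_exp (- x) by rewrite -[X in _ --> X]subr0; exact: cvgB.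
  by apply: cvg_trans e1; apply: near_eq_cvg; near=> m; rewrite subKr.
apply: (@lie_cvg_unique (fun m => q (z m)) (fun m => (q (exp_seq x m.+1))^-1%g)).
- near=> m.
  have [wr dw] : `|w m| <= r /\ chart_dom phi (q (m.+1%:R^-1 *: x))^-1%g by near: m.
  have [|i1 i2] := lie_inv_coord _ wr dw; first by apply: le_trans (sx m) _; lra.
  rewrite /z lie_coordK // lie_loc_exp_seq // -expVgn -(lie_coordK dw).
  have [|//] := @loc_pow_bound m.+1 (w m).
  apply: (@le_trans _ _ (m.+1%:R * (2 * `|m.+1%:R^-1 *: x|))); first by rewrite ler_wpM2l.
  by rewrite mulrCA nm; lra.
- exact: (cvg_comp _ _ zc (lr_q_continuous (norm_loc_exp nxr))).
- have H := @expg_loc_exp_cvg 1 _ xr; rewrite expg1 in H.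
  have {}H : q (exp_seq x m.+1) @[m --> \oo] --> q (loc_exp x) by [].
  exact: (cvg_comp _ _ H (@lie_inv_continuous _ _ G _)).
Unshelve. all: by end_near. Qed.

(** [N] is the least positive integer with [|x| / N < r / 8]; [lexp_eq] shows that every admissible
    [N] gives the same value, so that one [N] can serve a whole neighbourhood. *)
Definition lexp x : G :=
  let N := (Num.truncn (8 * `|x| / r)).+1 in (q (loc_exp (N%:R^-1 *: x)) ^+ N)%g.

(** Two admissible subdivisions are both compared with their product. *)
Lemma lexp_eq N x : (0 < N)%N -> `|x| <= N%:R * (r / 8) ->
  lexp x = (q (loc_exp (N%:R^-1 *: x)) ^+ N)%g.
Proof.
have r0 := lr_gt0 L. have C0 := lr_C L.
move=> N0 xN.
have H M1 M2 : (0 < M1)%N -> (0 < M2)%N -> `|x| <= M1%:R * (r / 8) ->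
    (q (loc_exp (M1%:R^-1 *: x)) ^+ M1)%g =
    (q (loc_exp ((M1 * M2)%N%:R^-1 *: x)) ^+ (M1 * M2))%g.
  move=> M10 M20 xM.
  have m1 : M1%:R != 0 :> R by rewrite pnatr_eq0 -lt0n.
  have m2 : M2%:R != 0 :> R by rewrite pnatr_eq0 -lt0n.
  pose y := (M1 * M2)%N%:R^-1 *: x.
  have Ey : M1%:R^-1 *: x = M2%:R *: y.
    by rewrite scalerA natrM; congr (_ *: _); field; apply/andP.
  have ky : M2%:R * `|y| <= r / 4.
    have -> : M2%:R * `|y| = `|M1%:R^-1 *: x| by rewrite Ey [RHS]normrZ normr_nat.
    rewrite normrZ normfV normr_nat mulrC ler_pdivrMr ?ltr0n // mulrC.
    have : 0 <= M1%:R * (r / 8) by apply: le_trans xM.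
    lra.
  by rewrite Ey (lie_loc_exp_expg ky) -expgnA (mulnC M2 M1).
have HM := @truncnS_gt R (8 * `|x| / r); rewrite ltr_pdivrMr // in HM.
rewrite /lexp; cbv zeta; move: (Num.truncn (8 * `|x| / r)) HM => M HM.
have xM : `|x| <= M.+1%:R * (r / 8) by move: (M.+1%:R) HM => M' HM; lra.
apply: etrans (H M.+1 N isT N0 xM) _; rewrite (mulnC M.+1 N).
exact: esym (H N M.+1 N0 isT xN).
Qed.

Lemma lexp0 : lexp 0 = 1%g.
Proof.
have r0 := lr_gt0 L. have C0 := lr_C L.
rewrite (@lexp_eq 1) // ?scaler0 ?loc_exp0 ?lie_loc0 ?expg1 // normr0.
by rewrite mulr_ge0 // divr_ge0 // ltW.
Qed.

Lemma exists_bound (M : R) : exists2 N, (0 < N)%N & M <= N%:R * (r / 8).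
Proof.
have r0 := lr_gt0 L. have C0 := lr_C L.
have H := @truncnS_gt R (8 * M / r); rewrite ltr_pdivrMr // in H.
exists (Num.truncn (8 * M / r)).+1 => //.
move: ((Num.truncn (8 * M / r)).+1%:R) H => N H; lra.
Qed.

Lemma lexp_expg k x : lexp (k%:R *: x) = (lexp x ^+ k)%g.
Proof.
case: k => [|k]; first by rewrite scale0r lexp0 expg0.
have [N N0 xN] := exists_bound `|x|.
rewrite (lexp_eq N0 xN) (@lexp_eq (N * k.+1)) ?muln_gt0 ?N0 //.
  have -> : (N * k.+1)%N%:R^-1 *: (k.+1%:R *: x) = N%:R^-1 *: x.
    rewrite scalerA natrM; congr (_ *: _); field.
    by rewrite addrC natr1 !pnatr_eq0 -!lt0n N0.
  by rewrite expgnA.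
by rewrite normrZ normr_nat natrM mulrC mulrAC ler_wpM2r.
Qed.

Lemma lexpN x : lexp (- x) = (lexp x)^-1%g.
Proof.
have [N N0 xN] := exists_bound `|x|.
rewrite (lexp_eq N0 xN) (@lexp_eq N) ?normrN // scalerN lie_loc_expN ?expVgn //.
rewrite normrZ normfV normr_nat mulrC ler_pdivrMr ?ltr0n // mulrC //.
Qed.

Lemma lexp_continuous : continuous lexp.
Proof.
have r0 := lr_gt0 L. have C0 := lr_C L.
suff main x : lexp y @[y --> x] --> lexp x by exact: main.
have [N N0 xN] := exists_bound (`|x| + 1).
have NR : 0 < N%:R :> R by rewrite ltr0n.
have E : \forall y \near x, (q (loc_exp (N%:R^-1 *: y)) ^+ N)%g = lexp y.
  near=> y; rewrite -lexp_eq //; apply: le_trans xN.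
  near: y; apply: (@cvgr_norm_le _ _ _ (nbhs x) _ id x) => //.
  by rewrite ltrDl.
have xr : `|N%:R^-1 *: x| < r / 4.
  rewrite normrZ normfV normr_nat mulrC ltr_pdivrMr // mulrC.
  have : 0 < N%:R * (r / 8) by rewrite mulr_gt0 // divr_gt0.
  lra.
have H : (q (loc_exp (N%:R^-1 *: y)) ^+ N)%g @[y --> x] --> lexp x.
  have Ex : (q (loc_exp (N%:R^-1 *: x)) ^+ N)%g = lexp x := nbhs_singleton E.
  rewrite -Ex.
  have h1 : N%:R^-1 *: y @[y --> x] --> N%:R^-1 *: x by exact: scaler_continuous.
  have h2 := cvg_comp _ _ h1 (loc_exp_continuous xr).
  have h3 := cvg_comp _ _ h2 (lr_q_continuous (norm_loc_exp (ltW xr))).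
  exact: (cvg_comp _ _ h3 (@lie_expg_continuous N _)).
exact: (cvg_trans (@near_eq_cvg _ _ (nbhs x) _ _ _ E) H).
Unshelve. all: by end_near. Qed.

(** For [s] and [t] with a common denominator both sides are powers of one element. The rational
    numbers [u s m] and [u t m], obtained by truncation at denominator [m.+1], reduce the general
    case to this one by continuity. *)
Lemma lexpD_ge0 x (s t : R) : 0 <= s -> 0 <= t ->
  lexp ((s + t) *: x) = (lexp (s *: x) * lexp (t *: x))%g.
Proof.
have r0 := lr_gt0 L. have C0 := lr_C L.
move=> s0 t0.
pose u (a : R) m : R := (Num.truncn (a * m.+1%:R))%:R / m.+1%:R.
have uc a : 0 <= a -> u a m @[m --> \oo] --> a.
  move=> a0; apply: (@cvg_of_rate _ _ _ _ 1) => m.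
  have m0 : 0 < m.+1%:R :> R by rewrite ltr0n.
  have -> : u a m - a = - ((a * m.+1%:R - (Num.truncn (a * m.+1%:R))%:R) / m.+1%:R).
    by rewrite /u; field; rewrite addrC natr1 pnatr_eq0.
  rewrite normrN normrM normfV normr_nat ler_pM2r ?invr_gt0 //.
  have a1 : 0 <= a * m.+1%:R by rewrite mulr_ge0.
  have /andP[h1 h2] := truncn_itv a1.
  rewrite ger0_norm ?subr_ge0 // -natr1 in h2 *; lra.
have lc (f : nat -> R) (l : R) : f m @[m --> \oo] --> l ->
    lexp (f m *: x) @[m --> \oo] --> lexp (l *: x).
  move=> fl; have h1 : f m *: x @[m --> \oo] --> l *: x by apply: cvgZl.
  exact: (cvg_comp _ _ h1 (@lexp_continuous _)).
apply: (@lie_cvg_unique (fun m => lexp ((u s m + u t m) *: x))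
  (fun m => lexp (u s m *: x) * lexp (u t m *: x))%g).
- near=> m.
  rewrite /u -mulrDl -natrD -!scalerA !lexp_expg.
  by rewrite expgnDr.
- by apply: lc; apply: cvgD; exact: uc.
- have H : (lexp (u s m *: x), lexp (u t m *: x)) @[m --> \oo] -->
    (lexp (s *: x), lexp (t *: x)).
    by apply: cvg_pair; apply: lc; exact: uc.
  exact: (cvg_comp _ _ H (@lie_mul_continuous _ _ G _)).
Unshelve. all: by end_near. Qed.

Lemma lexpD x (s t : R) :
  lexp ((s + t) *: x) = (lexp (s *: x) * lexp (t *: x))%g.
Proof.
wlog s0 : x s t / 0 <= s => [H|].
  have [s0|s0] := leP 0 s; first exact: H.
  have := H (- x) (- s) (- t); rewrite -opprD !scalerN !scaleNr !opprK; apply.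
  by rewrite oppr_ge0 ltW.
have [t0|t0] := leP 0 t; first exact: lexpD_ge0.
have nt : 0 <= - t by rewrite oppr_ge0 ltW.
have Et : lexp (t *: x) = (lexp (- t *: x))^-1%g by rewrite scaleNr lexpN invgK.
have [st|st] := leP 0 (s + t).
  have := lexpD_ge0 x st nt; rewrite addrK => ->.
  by rewrite Et mulgK.
have nst : 0 <= - (s + t) by rewrite oppr_ge0 ltW.
have := lexpD_ge0 x nst s0; rewrite opprD addrAC addNr add0r => E.
have Z (A B S : G) : A = (B * S)%g -> (S * A^-1)%g = B^-1%g.
  by move=> ->; rewrite invgM mulgA mulgV mul1g.
by rewrite Et (Z _ _ _ E) -lexpN -scaleNr -opprD opprK.
Qed.

Lemma lexp_one_parameter x : one_parameter_subgroup x (fun s => lexp (s *: x)).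
Proof.
have r0 := lr_gt0 L. have C0 := lr_C L.
split.
- move=> s; have h1 : u *: x @[u --> s] --> s *: x by apply: cvgZl; exact: cvg_id.
  exact: (cvg_comp _ _ h1 (@lexp_continuous _)).
- exact: lexpD.
apply/is_derive0P => eps eps0; near=> h.
have hr : `|h *: x| <= r / 8.
  near: h.
  have h1 : u *: x @[u --> (0 : R)] --> (0 : V).
    by rewrite -[X in _ --> X](scale0r x); apply: cvgZl; exact: cvg_id.
  have r8 : 0 < r / 8 by rewrite divr_gt0.
  move/cvgrPdist_le : h1 => /(_ _ r8); apply: filterS => u.
  by rewrite sub0r normrN.
have hr4 : `|h *: x| <= r / 4 by lra.
rewrite /= scale0r lexp0 (@lexp_eq 1) ?mul1r // invr1 scale1r expg1.
have [_ Hl] := chart_invK (lr_img L (norm_loc_exp hr4)).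
rewrite -/(q _) in Hl; rewrite Hl [e + _ - e]addrAC subrr add0r.
apply: le_trans (loc_exp_near hr4) _.
rewrite normrZ exprMn expr2 -[X in _ * X]mulrA mulrC -mulrA mulrC.
rewrite ler_wpM2r //.
rewrite -mulrA mulrC; near: h.
by apply: near0_mul; rewrite // !mulr_ge0 // exprn_ge0.
Unshelve. all: by end_near. Qed.

(** Uniqueness without differential equations: [gam (1 / M)] is the [N]-th power of
    [gam (1 / (M * N))], whose coordinate is [y / N + o(1 / N)]. The Lipschitz bound on [N]-th
    powers makes the total error [o(1)] against [exp_seq y N]. *)
Lemma one_parameter_lexp x gam : one_parameter_subgroup x gam -> gam 1 = lexp x.
Proof.
have r0 := lr_gt0 L. have C0 := lr_C L.
move=> [gc gD gd].
have [M M0 xM] := exists_bound `|x|.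
have MR : 0 < M%:R :> R by rewrite ltr0n.
have g0 : gam 0 = 1%g.
  by apply: (@mulgI _ (gam 0)); rewrite -gD addr0 mulg1.
have gX (s : R) k : gam (k%:R * s) = (gam s ^+ k)%g.
  elim: k => [|k IH]; first by rewrite mul0r g0 expg0.
  by rewrite -natr1 mulrDl mul1r gD IH expgSr.
pose y := M%:R^-1 *: x.
have yr8 : `|y| <= r / 8.
  by rewrite normrZ normfV normr_nat mulrC ler_pdivrMr // mulrC.
have yr4 : `|y| <= r / 4 by lra.
suff E : gam M%:R^-1 = q (loc_exp y).
  rewrite (lexp_eq M0 xM) -/y -E -gX divff //; exact: lt0r_neq0.
pose v N := lg (gam (M%:R^-1 / N.+1%:R)).
have gN N : (gam (M%:R^-1 / N.+1%:R)%R ^+ N.+1)%g = gam M%:R^-1.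
  rewrite -gX; congr gam; field.
  by rewrite lt0r_neq0 // addrC natr1 pnatr_eq0.
have nd : \forall N \near \oo, chart_dom phi (gam (M%:R^-1 / N.+1%:R)).
  apply: (cvgn_pullback (P := fun s => chart_dom phi (gam s))).
  by apply: gc; rewrite g0; exact: nbhs_chart_dom.
have nv eps : 0 < eps -> \forall N \near \oo, N.+1%:R * `|v N - N.+1%:R^-1 *: y| <= eps.
  move=> eps0; have := (is_derive0P _ _).1 gd _ eps0 => /cvgn_pullback-/(_ M%:R^-1).
  apply: filterS => N /=; rewrite g0 -/(lg _) -/(v N).
  have -> : (M%:R^-1 / N.+1%:R) *: x = N.+1%:R^-1 *: y by rewrite scalerA mulrC.
  move=> H; apply: le_trans (_ : N.+1%:R * (eps * `|M%:R^-1 / N.+1%:R|) <= _).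
    by rewrite ler_wpM2l.
  rewrite ger0_norm; last by rewrite divr_ge0 // invr_ge0.
  have -> : N.+1%:R * (eps * (M%:R^-1 / N.+1%:R)) = eps / M%:R.
    by field; rewrite lt0r_neq0 // addrC natr1 pnatr_eq0.
  by rewrite ler_pdivrMr // ler_peMr ?ler1n // ltW.
have ny N : N.+1%:R * `|N.+1%:R^-1 *: y| = `|y|.
  by rewrite normrZ normfV normr_nat mulrA divff ?mul1r.
have nb : \forall N \near \oo, N.+1%:R * `|v N| <= r / 2.
  have r4 : 0 < r / 4 by rewrite divr_gt0.
  have := nv _ r4; apply: filterS => N H.
  have -> : v N = (v N - N.+1%:R^-1 *: y) + N.+1%:R^-1 *: y by rewrite subrK.
  apply: le_trans (_ : N.+1%:R * (`|v N - N.+1%:R^-1 *: y| + `|N.+1%:R^-1 *: y|) <= _).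
    by rewrite ler_wpM2l // ler_normD.
  rewrite mulrDr ny; lra.
have dg : chart_dom phi (gam M%:R^-1).
  have [N [d1 b1]] := filter_ex (filterI nd nb).
  by have [] := loc_pow_bound b1; rewrite lie_coordK // gN.
suff -> : loc_exp y = lg (gam M%:R^-1) by rewrite lie_coordK.
apply/eqP; rewrite eq_sym -subr_eq0 -normr_le0; apply/ler_addgt0Pr => eps eps0.
(* The Lipschitz constant 6 of the powers turns [eps / 12] into [eps / 2]. *)
have e12 : 0 < eps / 12 by rewrite divr_gt0.
have e2 : 0 < eps / 2 by rewrite divr_gt0.
have /cvgrPdist_le/(_ _ e2) Hy := loc_exp_cvg yr4.
have [N [[d1 b1] [h1 h2]]] := filter_ex (filterI (filterI nd nb) (filterI (nv _ e12) Hy)).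
have h3 : `|lg (gam M%:R^-1) - exp_seq y N.+1| <= 6 * N.+1%:R * `|v N - N.+1%:R^-1 *: y|.
  rewrite -(gN N) -{1}(lie_coordK d1) -/(v N).
  apply: (loc_pow_lip (leqnn _)) => //; rewrite ny; lra.
have -> : lg (gam M%:R^-1) - loc_exp y = (lg (gam M%:R^-1) - exp_seq y N.+1) +
  (exp_seq y N.+1 - loc_exp y) by rewrite addrA subrK.
rewrite distrC in h2; rewrite -mulrA in h3.
apply: le_trans (ler_normD _ _) _; lra.
Qed.

(** Existence and uniqueness of the one-parameter subgroup together determine the value picked by
    [xget], so its default 1 is never returned for lack of a candidate. *)
Lemma lie_exp_lexp x : @lie_exp R n G x = lexp x.
Proof.
rewrite /lie_exp; apply: xget_unique.
  by exists (fun s => lexp (s *: x)); [exact: lexp_one_parameter|rewrite scale1r].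
by move=> _ [gam H <-]; exact: one_parameter_lexp.
Qed.

End Radius.

Lemma lie_exp_continuous : continuous (@lie_exp R n G).
Proof.
have [r [C L]] := exists_local_radius G.
by rewrite (funext (lie_exp_lexp L)); exact: lexp_continuous L.
Qed.

Lemma lie_exp_one_parameter x : one_parameter_subgroup x (fun s => @lie_exp R n G (s *: x)).
Proof.
have [r [C L]] := exists_local_radius G.
have -> : (fun s : R => @lie_exp R n G (s *: x)) = _ := funext (fun s => lie_exp_lexp L (s *: x)).
exact: lexp_one_parameter L x.
Qed.

Lemma one_parameter_lie_exp x (gam : R -> G) :
  one_parameter_subgroup x gam -> gam 1 = @lie_exp R n G x.
Proof.
have [r [C L]] := exists_local_radius G.
by rewrite (lie_exp_lexp L); exact: one_parameter_lexp L x gam.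
Qed.

End LocalExponential.

(** * Differentials through epsilon estimates *)

Section Differentials.
Context {R : realType} {V W : normedModType R}.
Implicit Types (f g : V -> W) (x : V).

Lemma cvg_shift0 x : h + x @[h --> (0 : V)] --> x.
Proof.
rewrite -[X in _ --> X]add0r; apply: cvgD; [exact: cvg_id|exact: cvg_cst].
Qed.

Lemma is_diff_eps f x df : is_diff x f df -> forall eps : R, 0 < eps ->
  \forall h \near (0 : V), `|f (h + x) - f x - df h| <= eps * `|h|.
Proof.
move=> [d <-] eps eps0; have /eqaddoP/(_ _ eps0) := diff_locally d.
by apply: filterS => h; rewrite /= opprD addrA.
Qed.

Lemma eps_is_diff f x (df : {linear V -> W}) : continuous df ->
  (forall eps : R, 0 < eps ->
    \forall h \near (0 : V), `|f (h + x) - f x - df h| <= eps * `|h|) ->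
  is_diff x f df.
Proof.
move=> dc H.
have E : f \o shift x = cst (f x) + df +o_ 0 id.
  apply/eqaddoP => eps eps0; have := H _ eps0.
  by apply: filterS => h; rewrite /= opprD addrA.
have dE := diff_unique dc E.
apply: DiffDef => //; apply/diff_locallyP; rewrite dE; split => //.
Qed.

(** Meant for [Ad], which is not given by a formula in the chart but is within a quadratic error of
    a function known to be differentiable. *)
Lemma is_diff_perturb f g x dg (c : R) : is_diff x g dg -> f x = g x ->
  (\forall w \near x, `|f w - g w| <= c * `|w - x| ^+ 2) -> is_diff x f dg.
Proof.
move=> dgx fgx H; have dd : differentiable g x by [].
have <- : 'd g x = dg :> (V -> W) := @diff_val _ _ _ _ _ _ _ dgx.
apply: eps_is_diff; first exact: diff_continuous.
move=> eps eps0.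
have e2 : 0 < eps / 2 by rewrite divr_gt0.
have H1 := is_diff_eps (differentiableP dd) e2.
have H2 : \forall h \near (0 : V), `|f (h + x) - g (h + x)| <= c * `|h| ^+ 2.
  have hx := @cvg_shift0 x.
  have Hs : \forall h \near (0 : V),
    `|f (h + x) - g (h + x)| <= c * `|h + x - x| ^+ 2 := hx _ H.
  by apply: filterS Hs => h; rewrite addrK.
have H3 : \forall h \near (0 : V), `|c| * `|h| <= eps / 2.
  have [/= r r0 Hr] := near0_mul (normr_ge0 c) e2.
  apply/nbhs_ballP; exists r => //= h; rewrite -ball_normE /= sub0r normrN => hr.
  have := Hr `|h|; rewrite /= normr_id; apply.
  by rewrite /= sub0r normrN normr_id.
apply: filterS3 H1 H2 H3 => h h1 h2 h3.
have -> : f (h + x) - f x - 'd g x h =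
   (g (h + x) - g x - 'd g x h) + (f (h + x) - g (h + x)).
  rewrite fgx [in RHS]addrC; rewrite [RHS]addrA [X in _ = X + _]addrA subrK.
  by [].
apply: le_trans (ler_normD _ _) _; apply: le_trans (lerD h1 h2) _.
have h4 : c * `|h| ^+ 2 <= eps / 2 * `|h|.
  apply: (@le_trans _ _ (`|c| * `|h| * `|h|)); last by rewrite ler_wpM2r.
  by rewrite -mulrA -expr2 ler_wpM2r ?exprn_ge0 // ler_norm.
by rewrite [X in _ <= X * _]splitr mulrDl lerD2l.
Qed.

Lemma near_eq_is_diff f g x dg : (\forall w \near x, f w = g w) ->
  is_diff x g dg -> is_diff x f dg.
Proof.
move=> fg dgx; apply: (@is_diff_perturb f g x dg 0) => //.
  exact: nbhs_singleton fg.
by apply: filterS fg => w ->; rewrite subrr normr0 mul0r.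
Qed.

Lemma near_eq_diff f g x : (\forall w \near x, f w = g w) ->
  differentiable g x -> 'd f x = 'd g x :> (V -> W) /\ differentiable f x.
Proof.
move=> fg /differentiableP dgx; have df := near_eq_is_diff fg dgx.
by split; [exact: (@diff_val _ _ _ _ _ _ _ df)|].
Qed.

End Differentials.

(** * The adjoint action *)

Section Translations.
Context {R : realType} {n : nat} (G : lieGroupType R n).
Local Notation V := 'rV[R]_n.
Local Notation phi := (@one_chart R n G).
Local Notation e := (phi 1%g).

Lemma chart_inv_continuous_at (c : chart R n G) b : chart_dom c b ->
  {for c b, continuous (chart_inv c)}.
Proof. by move=> cb; apply: chart_inv_continuous; exists b. Qed.

(** The element [a] need not lie in the charts at hand: an atlas chart [f] around it is chosen, and
    the smooth product is restricted to the slice where the first coordinate is [f a]. *)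
Lemma ltrans_differentiable (c d : chart R n G) (a b : G) :
  atlas c -> atlas d -> chart_dom c b -> chart_dom d (a * b)%g ->
  differentiable (fun v => d (a * chart_inv c v)%g) (c b).
Proof.
move=> ac ad cb dab; have [f af fa] := @atlas_cover _ _ G a.
have [H _] := @lie_mul_smooth _ _ G f c d af ac ad 1.
have Hd := H (f a, c b); rewrite /= in Hd.
have -> : (fun v => d (a * chart_inv c v)%g) =
   (fun v : V * V => d (chart_inv f v.1 * chart_inv c v.2)%g) \o (fun v => (f a, v)).
  by apply/funext => v /=; rewrite chart_mapK.
apply: differentiable_comp.
  by apply: differentiable_pair => //.
apply: Hd; split; [by exists a|by exists b|].
by rewrite !chart_mapK.
Qed.

Lemma rtrans_differentiable (c d : chart R n G) (a b : G) :
  atlas c -> atlas d -> chart_dom c b -> chart_dom d (b * a)%g ->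
  differentiable (fun v => d (chart_inv c v * a)%g) (c b).
Proof.
move=> ac ad cb dab; have [f af fa] := @atlas_cover _ _ G a.
have [H _] := @lie_mul_smooth _ _ G c f d ac af ad 1.
have Hd := H (c b, f a); rewrite /= in Hd.
have -> : (fun v => d (chart_inv c v * a)%g) =
   (fun v : V * V => d (chart_inv c v.1 * chart_inv f v.2)%g) \o (fun v => (v, f a)).
  by apply/funext => v /=; rewrite chart_mapK.
apply: differentiable_comp.
  by apply: differentiable_pair => //.
apply: Hd; split; [by exists b|by exists a|].
by rewrite !chart_mapK.
Qed.

Lemma lie_mull_continuous (a : G) : continuous (fun b : G => (a * b)%g).
Proof.
move=> b.
have H : (a, c) @[c --> b] --> (a, b) by apply: cvg_pair; [exact: cvg_cst|exact: cvg_id].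
exact: (cvg_comp _ _ H (@lie_mul_continuous _ _ G _)).
Qed.

Lemma lie_mulr_continuous (a : G) : continuous (fun b : G => (b * a)%g).
Proof.
move=> b.
have H : (c, a) @[c --> b] --> (b, a) by apply: cvg_pair; [exact: cvg_id|exact: cvg_cst].
exact: (cvg_comp _ _ H (@lie_mul_continuous _ _ G _)).
Qed.

Definition conj_coord (a : G) (v : V) : V := phi (a * chart_inv phi v * a^-1)%g.

Lemma conj_coord1 a : conj_coord a e = e.
Proof. by rewrite /conj_coord chart_mapK ?mulg1 ?mulgV //; exact: one_chart_dom. Qed.

Lemma near_conj_dom a :
  \forall v \near e, chart_dom phi (a * chart_inv phi v * a^-1)%g.
Proof.
have h1 := @chart_inv_continuous_at phi 1%g (@one_chart_dom _ _ G).
have h2 := cvg_comp _ _ h1 (@lie_mull_continuous a _).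
have h3 := cvg_comp _ _ h2 (@lie_mulr_continuous a^-1%g _).
apply: h3; rewrite /= chart_mapK; last exact: one_chart_dom.
rewrite mulg1 mulgV; exact: nbhs_chart_dom.
Qed.

(** The intermediate product [a * b] is near [a], possibly outside the chart at 1, so conjugation is
    factored into a left and a right translation through a chart [f] around [a]. *)
Lemma conj_coord_differentiable a : differentiable (conj_coord a) e.
Proof.
have [f af fa] := @atlas_cover _ _ G a.
have d1 : differentiable (fun v => f (a * chart_inv phi v)%g) e.
  apply: ltrans_differentiable => //; [exact: one_chart_atlas|exact: one_chart_dom|].
  by rewrite mulg1.
have E1 : f (a * chart_inv phi e)%g = f a.
  by rewrite chart_mapK ?mulg1 //; exact: one_chart_dom.
have d2 : differentiable (fun w => phi (chart_inv f w * a^-1)%g) (f (a * chart_inv phi e)%g).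
  rewrite E1; apply: rtrans_differentiable => //; first exact: one_chart_atlas.
  by rewrite mulgV; exact: one_chart_dom.
have dc := differentiable_comp d1 d2.
have N : \forall v \near e, conj_coord a v =
   ((fun w => phi (chart_inv f w * a^-1)%g) \o (fun v => f (a * chart_inv phi v)%g)) v.
  have h1 := @chart_inv_continuous_at phi 1%g (@one_chart_dom _ _ G).
  have h2 := cvg_comp _ _ h1 (@lie_mull_continuous a _).
  have nf : nbhs (a * chart_inv phi e)%g (chart_dom f).
    apply: open_nbhs_nbhs; split; first exact: chart_dom_open.
    by rewrite chart_mapK ?mulg1 //; exact: one_chart_dom.
  have h3 : \forall v \near e, chart_dom f (a * chart_inv phi v)%g := h2 _ nf.
  apply: filterS h3 => v fv /=.
  by rewrite chart_mapK.
by have [] := near_eq_diff N dc.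
Qed.

Lemma conj_coord_comp a b :
  \forall v \near e, conj_coord (a * b)%g v = conj_coord a (conj_coord b v).
Proof.
have := near_conj_dom b; apply: filterS => v bv.
by rewrite /conj_coord chart_mapK // invgM !mulgA.
Qed.

Lemma Ad_M (a b : G) (x : V) : Ad (a * b)%g x = Ad a (Ad b x).
Proof.
have db := conj_coord_differentiable b.
have da : differentiable (conj_coord a) (conj_coord b e).
  by rewrite conj_coord1; exact: conj_coord_differentiable.
have [E _] := near_eq_diff (conj_coord_comp a b) (differentiable_comp db da).
have H := diff_comp db da; rewrite conj_coord1 in H.
exact: etrans (congr1 (fun f : V -> V => f x) E) (congr1 (fun f : V -> V => f x) H).
Qed.

Lemma Ad_1 x : Ad (1%g : G) x = x.
Proof.
have N : \forall v \near e, conj_coord (1%g : G) v = id v.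
  have := @nbhs_chart_img _ _ G; apply: filterS => v iv.
  by rewrite /conj_coord mul1g invg1 mulg1 (chart_invK iv).2.
have [E _] := near_eq_diff N (@ex_diff _ _ _ _ _ _ _ (is_diff_id e)).
by rewrite /Ad -/(conj_coord 1%g) E (@diff_val _ _ _ _ _ _ _ (is_diff_id e)).
Qed.

(* Matrices act on row vectors, so AdM reverses products. *)
Definition AdM (a : G) : 'M[R]_n := lin1_mx ('d (conj_coord a) e).

Lemma mul_AdM a x : x *m AdM a = Ad a x.
Proof. by rewrite /AdM mul_rV_lin1. Qed.

Lemma row_mx_ext (A B : 'M[R]_n) : (forall x : V, x *m A = x *m B) -> A = B.
Proof. by move=> H; apply/row_matrixP => i; rewrite !rowE. Qed.

Lemma AdM_M a b : AdM (a * b)%g = AdM b *m AdM a.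
Proof.
by apply: row_mx_ext => x; rewrite mul_AdM mulmxA mul_AdM mul_AdM; exact: Ad_M.
Qed.

Lemma AdM_1 : AdM 1%g = 1%:M.
Proof. by apply: row_mx_ext => x; rewrite mul_AdM mulmx1 Ad_1. Qed.

Lemma AdM_V a : AdM a *m AdM a^-1%g = 1%:M.
Proof. by rewrite -AdM_M mulVg AdM_1. Qed.

Lemma AdM_Vl a : AdM a^-1%g *m AdM a = 1%:M.
Proof. by rewrite -AdM_M mulgV AdM_1. Qed.

Lemma one_parameter0 x (gam : R -> G) : one_parameter_subgroup x gam -> gam 0 = 1%g.
Proof.
by move=> [_ gD _]; apply: (@mulgI _ (gam 0)); rewrite -gD addr0 mulg1.
Qed.

Lemma near_gam_dom x (gam : R -> G) : one_parameter_subgroup x gam ->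
  \forall s \near (0 : R), chart_dom phi (gam s).
Proof.
move=> H; have [gc _ _] := H; apply: gc; rewrite (one_parameter0 H).
exact: nbhs_chart_dom.
Qed.

Lemma one_parameter_comp x (gam : R -> G) m (f : V -> 'rV[R]_m) df :
  one_parameter_subgroup x gam -> is_diff e f df ->
  is_derive (0 : R) 1 (fun s => f (phi (gam s))) (df x).
Proof.
move=> H fd; have [_ _ gd] := H.
have dg : differentiable (phi \o gam) 0 by apply/derivable1_diffP.
have fd' : differentiable f ((phi \o gam) 0) by rewrite /= (one_parameter0 H).
have dc : differentiable (f \o (phi \o gam)) 0 by exact: differentiable_comp.
apply: DeriveDef; first exact/derivable1_diffP.
rewrite (_ : (fun s => f (phi (gam s))) = f \o (phi \o gam)) // deriveE //.
rewrite diff_comp //= (one_parameter0 H) (@diff_val _ _ _ _ _ _ _ fd).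
by rewrite -deriveE // derive_val.
Qed.

Lemma one_parameter_conj a x (gam : R -> G) : one_parameter_subgroup x gam ->
  one_parameter_subgroup (Ad a x) (fun s => a * gam s * a^-1)%g.
Proof.
move=> H; have [gc gD gd] := H; split.
- move=> s; have h1 := cvg_comp _ _ (gc s) (@lie_mull_continuous a _).
  exact: (cvg_comp _ _ h1 (@lie_mulr_continuous a^-1%g _)).
- by move=> s u; rewrite gD !mulgA mulgVK.
have cd := differentiableP (conj_coord_differentiable a).
apply: near_eq_is_derive (one_parameter_comp H cd).
have := near_gam_dom H; apply: filterS => s ds.
by rewrite /conj_coord /= chart_mapK.
Qed.

Lemma lie_exp_Ad a x : lie_exp G (Ad a x) = (a * lie_exp G x * a^-1)%g.
Proof.
have H := one_parameter_conj a (lie_exp_one_parameter G x).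
by rewrite -(one_parameter_lie_exp H) scale1r.
Qed.

End Translations.

#[local] Opaque diff.

Lemma cvg_sum_seq (R : realType) (V : normedModType R) (I T : Type)
    (F : set_system T) (FF : Filter F) (s : seq I) (f : I -> T -> V) (l : I -> V) :
  (forall i, f i x @[x --> F] --> l i) ->
  \sum_(i <- s) f i x @[x --> F] --> \sum_(i <- s) l i.
Proof.
move=> H; elim: s => [|i s IH].
  by rewrite big_nil; under eq_cvg do rewrite big_nil; exact: cvg_cst.
by rewrite big_cons; under eq_cvg do rewrite big_cons; exact: cvgD.
Qed.

(** * Continuity and derivative of the adjoint action *)

Section AdjointDerivative.
Context {R : realType} {n : nat} (G : lieGroupType R n).
Local Notation V := 'rV[R]_n.
Local Notation phi := (@one_chart R n G).
Local Notation e := (phi 1%g).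
Local Notation q := (@lie_loc R n G).
Local Notation lg := (@lie_coord R n G).
Implicit Types (a b : G) (x y : V).

Lemma near0_homogeneous_le (W1 W2 : normedModType R) (f : W1 -> W2) (K : R) :
  (forall (t : R) (y : W1), f (t *: y) = t *: f y) ->
  (\forall h \near (0 : W1), `|f h| <= K * `|h|) -> forall y : W1, `|f y| <= K * `|y|.
Proof.
move=> fZ H y.
have [/= r r0 Hr] := (nbhs_ballP _ _).1 H.
pose t : R := r / (2 * (`|y| + 1)).
have y1 : 0 < `|y| + 1 by rewrite ltr_wpDl.
have t0 : 0 < t by rewrite divr_gt0 // mulr_gt0.
have : `|f (t *: y)| <= K * `|t *: y|.
  apply: Hr; rewrite /= -ball_normE /= sub0r normrN normrZ gtr0_norm //.
  rewrite /t mulrAC ltr_pdivrMr ?mulr_gt0 //.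
  by rewrite ltr_pM2l //; have := normr_ge0 y; lra.
by clearbody t; rewrite fZ !normrZ (gtr0_norm t0) mulrCA ler_pM2l.
Qed.

Lemma AdZ a (t : R) x : Ad a (t *: x) = t *: Ad a x.
Proof. by rewrite -!mul_AdM scalemxAl. Qed.

(* In coordinates c = a h a^-1 satisfies c v = v h, where v stands for a; both
   sides are compared with c + v and v + h. *)
Lemma Ad_loc_le r C (L : local_radius G r C) v y : `|v| <= r ->
  `|Ad (q v) y - y| <= 4 * C * `|v| * `|y|.
Proof.
have r0 := lr_gt0 L; have C0 := lr_C L; have Cr := lr_Cr L.
move=> vr; set a := q v.
have z : `|0 : V| <= r by rewrite normr0 ltW.
have dc := conj_coord_differentiable a.
have B c w : `|c| <= r -> `|w| <= r -> (q c * q v = q v * q w)%g ->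
    `|c - w| <= 4 * C * `|v| * `|w|.
  move=> cr wr E.
  have h1 := lr_l L cr z vr; have h2 := lr_r L vr wr z.
  rewrite lie_loc0 mul1g mulg1 (lr_K L vr) !subr0 in h1 h2.
  rewrite E in h1; move: (lg _) h1 h2 => p h1 h2.
  have h3 : `|c - w| <= C * `|c| * `|v| + C * `|v| * `|w|.
    have -> : c - w = (p - v - w) - (p - v - c) by apply/rowP => i; rewrite !mxE; ring.
    by apply: le_trans (ler_normB _ _) _; rewrite addrC lerD.
  have h4 : `|c| <= `|c - w| + `|w| by rewrite -{1}(subrK w c) ler_normD.
  have v0 := normr_ge0 v; have w0 := normr_ge0 w; have c0 := normr_ge0 c.
  have Cv : C * `|v| <= 1 / 2 by apply: le_trans Cr; rewrite ler_wpM2l.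
  have Cv0 : 0 <= C * `|v| by rewrite mulr_ge0.
  have h5 : C * `|c| * `|v| = C * `|v| * `|c| by rewrite mulrAC.
  have h6 : C * `|v| * `|c| <= 1 / 2 * `|c| by rewrite ler_wpM2r.
  have h7 : C * `|v| * `|w| <= 1 / 2 * `|w| by rewrite ler_wpM2r.
  have h8 : `|c| <= 3 * `|w| by lra.
  have h9 : C * `|v| * `|c| <= C * `|v| * (3 * `|w|) by rewrite ler_wpM2l.
  have -> : 4 * C * `|v| * `|w| = C * `|v| * (3 * `|w|) + C * `|v| * `|w| by ring.
  lra.
apply/ler_addgt0Pr => eps0 eps00.
pose eps := eps0 / (`|y| + 1).
have y1 : 0 < `|y| + 1 by rewrite ltr_wpDl.
have epsp : 0 < eps by rewrite divr_gt0.
have H : \forall h \near (0 : V), `|Ad a h - h| <= (4 * C * `|v| + eps) * `|h|.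
  have h1 := is_diff_eps (differentiableP dc) epsp.
  have sh : h + e @[h --> (0 : V)] --> e := @cvg_shift0 R _ e.
  have h2 : \forall h \near (0 : V),
     chart_dom phi (a * chart_inv phi (h + e) * a^-1)%g := sh _ (near_conj_dom a).
  have cc : conj_coord a (h + e) @[h --> (0 : V)] --> e.
    have := cvg_comp _ _ sh (differentiable_continuous dc).
    by rewrite conj_coord1.
  have h3 : \forall h \near (0 : V), `|conj_coord a (h + e) - e| <= r.
    by move/cvgrPdist_le : cc => /(_ _ r0); apply: filterS => h; rewrite distrC.
  have h4 : \forall h \near (0 : V), `|h| <= r.
    by apply/nbhs_ballP; exists r => //= h; rewrite -ball_normE /= sub0r normrN => /ltW.
  apply: filterS2 (filterI h1 h2) (filterI h3 h4) => h [g1 g2] [g3 g4].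
  rewrite conj_coord1 in g1.
  set c := conj_coord a (h + e) - e in g1 g3.
  have qh : chart_inv phi (h + e) = q h by rewrite /lie_loc addrC.
  have qc : q c = (a * q h * a^-1)%g.
    by rewrite /c /conj_coord qh lie_coordK // -qh.
  have g5 : `|c - h| <= 4 * C * `|v| * `|h|.
    by apply: B => //; rewrite qc mulgVK.
  have -> : Ad a h - h = (c - h) - (c - Ad a h) by apply/rowP => i; rewrite !mxE; ring.
  by apply: le_trans (ler_normB _ _) _; rewrite mulrDl lerD.
have Hom (t : R) w : Ad a (t *: w) - t *: w = t *: (Ad a w - w).
  by rewrite AdZ scalerBr.
have := near0_homogeneous_le Hom H y => /le_trans; apply.
rewrite mulrDl lerD2l /eps mulrAC ler_pdivrMr //.
by rewrite ler_wpM2l ?(ltW eps00) // lerDl.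
Qed.

Lemma AdM_coord_continuous1 i j : {for (1%g : G), continuous (fun a => AdM a i j)}.
Proof.
have [r [C L]] := exists_local_radius G.
have r0 := lr_gt0 L; have C0 := lr_C L.
have lc := lie_coord_continuous (@one_chart_dom _ _ G).
have {}lc : lg a @[a --> (1%g : G)] --> (0 : V) by rewrite -(lie_coord1 G).
suff : AdM a i j @[a --> (1%g : G)] --> AdM (1%g : G) i j by [].
apply/cvgrPdist_le => eps eps0.
pose d : V := delta_mx 0 i.
have coordE a : AdM a i j = (Ad a d) 0 j by rewrite -mul_AdM -rowE [RHS]mxE.
have K0 : 0 <= 4 * C * `|d| by rewrite !mulr_ge0.
pose r1 := Num.min r (eps / (4 * C * `|d| + 1)).
have K1 : 0 < 4 * C * `|d| + 1 by rewrite ltr_wpDl.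
have r10 : 0 < r1 by rewrite lt_min r0 divr_gt0.
move/cvgrPdist_le : lc => /(_ _ r10) H.
apply: filterS2 H (nbhs_chart_dom G) => a; rewrite sub0r normrN => la da.
have lr : `|lg a| <= r by apply: le_trans la _; rewrite ge_min lexx.
have Hle := Ad_loc_le L d lr; rewrite (lie_coordK da) in Hle.
have k1 : AdM a i j - AdM (1%g : G) i j = Ad a d 0 j - d 0 j.
  exact: (congr2 (fun p q : R => p - q) (coordE a)
    (etrans (coordE 1%g) (congr1 (fun u : V => u 0 j) (Ad_1 G d)))).
rewrite distrC k1.
have subE (u w : V) : u 0 j - w 0 j = (u - w) 0 j by rewrite !mxE.
rewrite subE.
apply: le_trans (le_coord_norm _ _) _; apply: le_trans Hle _.
apply: (@le_trans _ _ (`|lg a| * (4 * C * `|d| + 1))).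
  have := normr_ge0 (lg a).
  have -> : 4 * C * `|lg a| * `|d| = `|lg a| * (4 * C * `|d|) by ring.
  by rewrite mulrDr mulr1 lerDl.
rewrite -ler_pdivlMr //; apply: le_trans la _.
by rewrite ge_min lexx orbT.
Qed.

(** By multiplicativity, continuity at [a] reduces to continuity at 1 in the variable [a^-1 * b]. *)
Lemma AdM_coord_continuous i j : continuous (fun a : G => AdM a i j).
Proof.
move=> a.
have E b : AdM b i j = \sum_k AdM (a^-1 * b)%g i k * AdM a k j.
  by rewrite -[b in LHS](mulVKg a) AdM_M mxE.
suff : (\sum_k AdM (a^-1 * b)%g i k * AdM a k j) @[b --> a] --> AdM a i j.
  by under eq_fun do rewrite -E.
rewrite [X in _ --> X]E; apply: cvg_sum_seq => k; apply: cvgMl.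
have h := @lie_mull_continuous _ _ G a^-1%g a.
rewrite /continuous_at mulVg in h *.
exact: (cvg_comp _ _ h (@AdM_coord_continuous1 i k)).
Qed.

Lemma mul_dom_l w : chart_img phi w -> mul_dom G (w, e) /\ mul_dom G (e, w).
Proof.
move=> iw; have [dw _] := chart_invK iw.
have inv1 : chart_inv phi e = 1%g by apply: chart_mapK; exact: one_chart_dom.
by split; split => //=; rewrite ?inv1 ?mulg1 ?mul1g //; exact: chart_img_one.
Qed.

Lemma diff_chart_mul_conj w y : chart_img phi w ->
  'd (@chart_mul R n G) (e, w) (Ad (chart_inv phi w) y, 0) =
  'd (@chart_mul R n G) (w, e) (0, y).
Proof.
move=> iw; have [dw wK] := chart_invK iw.
have [m1 m2] := mul_dom_l iw.
have [dm _] := @chart_mul_smooth _ _ G 1.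
set b := chart_inv phi w in dw wK *.
have D1 : is_diff e (fun v => chart_mul G (conj_coord b v, w))
    (fun h => 'd (@chart_mul R n G) (e, w) (Ad b h, 0)).
  have p : is_diff e (fun v => (conj_coord b v, w)) (fun h => ('d (conj_coord b) e h, 0)).
    exact: (is_diff_pair (differentiableP (conj_coord_differentiable b)) (is_diff_cst w e)).
  have m : is_diff (conj_coord b e, w) (@chart_mul R n G) ('d (@chart_mul R n G) (e, w)).
    by rewrite conj_coord1; apply: differentiableP; exact: dm.
  exact: (is_diff_comp p m).
have D2 : is_diff e (fun v => chart_mul G (w, v))
    (fun h => 'd (@chart_mul R n G) (w, e) (0, h)).
  have p : is_diff e (fun v => (w, v)) (fun h => (0, h)).
    exact: (is_diff_pair (is_diff_cst w e) (is_diff_id e)).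
  have m : is_diff (w, e) (@chart_mul R n G) ('d (@chart_mul R n G) (w, e)).
    by apply: differentiableP; exact: dm.
  exact: (is_diff_comp p m).
have N : \forall v \near e, chart_mul G (conj_coord b v, w) = chart_mul G (w, v).
  have := near_conj_dom b; apply: filterS => v dv.
  by rewrite /chart_mul /= /conj_coord chart_mapK // -/b mulgVK.
have D1' := near_eq_is_diff N D2.
exact: etrans (esym (congr1 (fun f : V -> V => f y) (@diff_val _ _ _ _ _ _ _ D1)))
  (congr1 (fun f : V -> V => f y) (@diff_val _ _ _ _ _ _ _ D1')).
Qed.

(** Infinitesimal form of [lr_l]: the bound on finite differences passes to the differential, by
    homogeneity, up to an arbitrary [eps]. *)
Lemma diff_chart_mul_l r C (L : local_radius G r C) v u : `|v| < r ->
  `|'d (@chart_mul R n G) (e, e + v) (u, 0) - u| <= C * `|v| * `|u|.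
Proof.
have r0 := lr_gt0 L; have C0 := lr_C L.
move=> vr.
have z : `|0 : V| <= r by rewrite normr0 ltW.
have [dm _] := @chart_mul_smooth _ _ G 1.
have [_ m2] := mul_dom_l (lr_img L (ltW vr)).
have D : is_diff (0 : V) (fun h => chart_mul G (e + h, e + v))
    (fun h => 'd (@chart_mul R n G) (e, e + v) (h, 0)).
  have p1 : is_diff (0 : V) (fun h : V => e + h) (fun h => h).
    have := is_diffD (is_diff_cst e (0 : V)) (is_diff_id (0 : V)).
    by rewrite add0r.
  have p := is_diff_pair p1 (is_diff_cst (e + v) (0 : V)).
  have m : is_diff (e + 0, e + v) (@chart_mul R n G) ('d (@chart_mul R n G) (e, e + v)).
    by rewrite addr0; apply: differentiableP; exact: dm.
  exact: (is_diff_comp p m).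
apply/ler_addgt0Pr => eps0 eps00.
pose eps := eps0 / (`|u| + 1).
have y1 : 0 < `|u| + 1 by rewrite ltr_wpDl.
have epsp : 0 < eps by rewrite divr_gt0.
have H : \forall h \near (0 : V),
  `|'d (@chart_mul R n G) (e, e + v) (h, 0) - h| <= (C * `|v| + eps) * `|h|.
  have h1 := is_diff_eps D epsp.
  have h4 : \forall h \near (0 : V), `|h| <= r.
    by apply/nbhs_ballP; exists r => //= h; rewrite -ball_normE /= sub0r normrN => /ltW.
  apply: filterS2 h1 h4 => h g1 hr.
  have g2 := lr_l L hr z (ltW vr).
  have E w : chart_mul G (e + w, e + v) = lg (q w * q v)%g + e by rewrite /lie_coord subrK.
  rewrite addr0 !E opprD addrACA subrr addr0 in g1.
  rewrite !subr0 in g2; move: (lg _ - lg _) g1 g2 => p g1 g2.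
  have -> : 'd (@chart_mul R n G) (e, e + v) (h, 0) - h =
    (p - h) - (p - 'd (@chart_mul R n G) (e, e + v) (h, 0)).
    by apply/rowP => i; rewrite !mxE; ring.
  apply: le_trans (ler_normB _ _) _; rewrite mulrDl lerD //.
  by rewrite mulrAC.
have Hom (t : R) (w : V) : 'd (@chart_mul R n G) (e, e + v) (t *: w, 0) - t *: w =
    t *: ('d (@chart_mul R n G) (e, e + v) (w, 0) - w).
  rewrite scalerBr -linearZ; congr ('d _ _ _ - _).
  by congr pair; rewrite /= scaler0.
have := near0_homogeneous_le Hom H u => /le_trans; apply.
rewrite mulrDl lerD2l /eps mulrAC ler_pdivrMr //.
by rewrite ler_wpM2l ?(ltW eps00) // lerDl.
Qed.

(* Differentiating (a h a^-1) a = a h at h = 1 gives, with w = phi a,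
   d mul_(e, w) (Ad a y, 0) = d mul_(w, e) (0, y) =: Q w.  As Ad a y - y and
   d mul_(e, w) - id are both O(w - e), Ad a y equals
   Q w - d mul_(e, w) (y, 0) + y up to a quadratic error. *)
Lemma Ad_chart_differentiable y :
  differentiable (fun v => Ad (chart_inv phi v) y) e.
Proof.
have [r [C L]] := exists_local_radius G.
have r0 := lr_gt0 L; have C0 := lr_C L.
have [_ H2] := @chart_mul_smooth _ _ G 2.
have inv1 : chart_inv phi e = 1%g by apply: chart_mapK; exact: one_chart_dom.
have [me _] := mul_dom_l (@chart_img_one _ _ G).
pose Q w := 'd (@chart_mul R n G) (w, e) (0, y).
pose P w := 'd (@chart_mul R n G) (e, w) (y, 0).
have dQ : differentiable Q e.
  have [dm _] := H2 (0, y).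
  have dp : differentiable (fun w : V => (w, e)) e by exact: differentiable_pair.
  exact: (differentiable_comp dp (dm _ me)).
have dP : differentiable P e.
  have [dm _] := H2 (y, 0).
  have dp : differentiable (fun w : V => (e, w)) e by exact: differentiable_pair.
  exact: (differentiable_comp dp (dm _ me)).
have dg := is_diffD (is_diffB (differentiableP dQ) (differentiableP dP)) (is_diff_cst y e).
have PQ : P e = Q e.
  have := diff_chart_mul_conj y (@chart_img_one _ _ G).
  by rewrite inv1 Ad_1.
apply: (@ex_diff _ _ _ _ _ _ _ (@is_diff_perturb _ _ _ _ _ _ _ (C * (4 * C * `|y|)) dg _ _)).
  change (Ad (chart_inv phi e) y = Q e - P e + y).
  by rewrite PQ subrr add0r inv1 Ad_1.
have nr : \forall w \near e, `|w - e| < r.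
  by apply/nbhs_ballP; exists r => //= w; rewrite -ball_normE /= distrC.
apply: filterS nr => w wr.
change (`|Ad (chart_inv phi w) y - (Q w - P w + y)| <= C * (4 * C * `|y|) * `|w - e| ^+ 2).
move: wr; set v := w - e => wr.
have Ew : w = e + v by rewrite addrC subrK.
have iw : chart_img phi w by rewrite Ew; apply: (lr_img L); exact: ltW.
have H1 := diff_chart_mul_conj y iw.
have Ei : chart_inv phi w = q v by rewrite /lie_loc -Ew.
rewrite Ei in H1 *.
have zb := Ad_loc_le L y (ltW wr).
have zb2 := diff_chart_mul_l L (Ad (q v) y - y) wr.
rewrite -Ew in zb2.
have E : 'd (@chart_mul R n G) (e, w) (Ad (q v) y, 0) =
    'd (@chart_mul R n G) (e, w) (y, 0) + 'd (@chart_mul R n G) (e, w) (Ad (q v) y - y, 0).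
  rewrite -linearD; congr ('d _ _ _); congr pair; rewrite /= ?addr0 //.
  by rewrite addrC subrK.
have {}E : Q w = P w + 'd (@chart_mul R n G) (e, w) (Ad (q v) y - y, 0).
  exact: etrans (esym H1) E.
move: zb zb2 E; move: ('d (@chart_mul R n G) (e, w) (Ad (q v) y - y, 0)) => D.
move: (Q w) (P w) (Ad (q v) y) => Qw Pw A zb zb2 ->.
have -> : A - (Pw + D - Pw + y) = - (D - (A - y)).
  by apply/rowP => i; rewrite !mxE; ring.
rewrite normrN; apply: le_trans zb2 _.
have -> : C * (4 * C * `|y|) * `|v| ^+ 2 = C * `|v| * (4 * C * `|v| * `|y|) by ring.
by rewrite ler_wpM2l // mulr_ge0.
Qed.

Lemma mul_ad_mx (g : lieAlgebra R n) x y : y *m ad_mx g x = g x y.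
Proof.
pose m := GRing.isLinear.Build _ _ _ _ _ (bracket_linear_r g x).
pose f : {linear V -> V} := HB.pack (bracket g x) m.
exact: (mul_rV_lin1 f).
Qed.

Lemma is_derive_Ad0 (g : lieAlgebra R n) x y (gam : R -> G) :
  has_lie_algebra G g -> one_parameter_subgroup x gam ->
  is_derive (0 : R) 1 (fun s => Ad (gam s) y) (g x y).
Proof.
move=> Gg H.
have D := one_parameter_comp H (differentiableP (Ad_chart_differentiable y)).
rewrite -Gg; apply: near_eq_is_derive D.
have := near_gam_dom H; apply: filterS => s ds.
by rewrite chart_mapK.
Qed.

(** This is [e^(s ad x)], obtained from the group instead of an exponential series; only its group
    law and its derivative at 0 are used later. *)
Definition AdE (x : V) (s : R) : 'M[R]_n := AdM (lie_exp G (s *: x)).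

Lemma AdED x s u : AdE x (s + u) = AdE x s *m AdE x u.
Proof.
have [_ D _] := lie_exp_one_parameter G x.
by rewrite /AdE addrC D AdM_M.
Qed.

Lemma AdE0 x : AdE x 0 = 1%:M.
Proof. by rewrite /AdE (one_parameter0 (lie_exp_one_parameter G x)) AdM_1. Qed.

Lemma is_derive_AdE0 (g : lieAlgebra R n) x i j : has_lie_algebra G g ->
  is_derive (0 : R) 1 (fun s => AdE x s i j) (ad_mx g x i j).
Proof.
move=> Gg; have H := is_derive_Ad0 (delta_mx 0 i) Gg (lie_exp_one_parameter G x).
have E s : AdE x s i j = (Ad (lie_exp G (s *: x)) (delta_mx 0 i)) 0 j.
  by rewrite -mul_AdM -rowE [RHS]mxE.
rewrite (funext E).
apply: DeriveDef.
  by have /derivable_mxP := @ex_derive _ _ _ _ _ _ _ H; apply.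
have /(congr1 (fun f : V => f 0 j)) := @derive_val _ _ _ _ _ _ _ H.
rewrite derive_mx // mxE => ->.
by rewrite -mul_ad_mx -rowE [LHS]mxE.
Qed.

End AdjointDerivative.

(** * One-parameter groups of matrices *)

Section PositiveDefinite.
Context {R : realType}.

Definition pos_def n (S : 'M[R]_n) : Prop :=
  S^T = S /\ forall v : 'rV[R]_n, v != 0 -> 0 < (v *m S *m v^T) 0 0.

(** Cholesky factorisation by induction: the corner entry [a] is positive, and the Schur complement
    [S'] is again positive definite. *)
Lemma pos_def_factor n (S : 'M[R]_n) : pos_def S ->
  exists2 Q : 'M[R]_n, Q \in unitmx & S = Q *m Q^T.
Proof.
elim: n S => [|n IH] S [ST Sp].
  by exists 1%:M; [exact: unitmx1|rewrite flatmx0 [RHS]flatmx0].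
move: S ST Sp; rewrite -[n.+1]/(1 + n)%N => S ST Sp.
pose a := ulsubmx S 0 0; pose b := ursubmx S; pose D := drsubmx S.
have ae : ulsubmx S = a%:M by rewrite [LHS]mx11_scalar.
have be : dlsubmx S = b^T by rewrite /b trmx_ursub ST.
have DT : D^T = D by rewrite /D trmx_drsub ST.
have Se : S = block_mx a%:M b b^T D by rewrite -ae -be submxK.
have form (s : R) (w : 'rV[R]_n) :
    (row_mx s%:M w *m S *m (row_mx s%:M w)^T) 0 0 =
    s * a * s + 2 * s * (b *m w^T) 0 0 + (w *m D *m w^T) 0 0.
  rewrite Se mul_row_block tr_row_mx mul_row_col !mulmxDl -!scalar_mxM.
  rewrite tr_scalar_mx !mul_scalar_mx -!scalemxAl !mul_mx_scalar.
  have -> : (w *m b^T) = (b *m w^T)^T by rewrite trmx_mul trmxK.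
  by rewrite !mxE /= mulr1n; ring.
have a0 : 0 < a.
  have := Sp (row_mx 1%:M 0); rewrite form.
  have -> : (b *m (0 : 'rV[R]_n)^T) 0 0 = 0 by rewrite linear0 mulmx0 mxE.
  have -> : ((0 : 'rV[R]_n) *m D *m (0 : 'rV[R]_n)^T) 0 0 = 0.
    by rewrite linear0 mulmx0 mxE.
  rewrite mulr0 !addr0 mul1r mulr1.
  apply; apply/eqP => /(congr1 lsubmx); rewrite row_mxKl linear0 => /matrixP/(_ 0 0).
  by rewrite !mxE /= => /eqP; rewrite oner_eq0.
pose S' := D - a^-1 *: (b^T *m b).
have [|Q' Q'u S'E] := IH S'.
  split; first by rewrite /S' linearB /= linearZ /= trmx_mul trmxK DT.
  move=> w w0.
  (* This first coordinate minimises the form for a given [w], and the minimum is the value of the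
     Schur complement at [w]. *)
  have := Sp (row_mx (- a^-1 * (b *m w^T) 0 0)%:M w); rewrite form => H.
  have -> : (w *m S' *m w^T) 0 0 =
    (- a^-1 * (b *m w^T) 0 0) * a * (- a^-1 * (b *m w^T) 0 0) +
    2 * (- a^-1 * (b *m w^T) 0 0) * (b *m w^T) 0 0 + (w *m D *m w^T) 0 0.
    rewrite /S' mulmxBr mulmxBl -scalemxAr -scalemxAl mulmxA.
    have -> : w *m b^T *m b *m w^T = (b *m w^T)^T *m (b *m w^T).
      by rewrite trmx_mul trmxK !mulmxA.
    have E (u : 'M[R]_1) : (u^T *m u) 0 0 = u 0 0 ^+ 2.
      by rewrite mxE big_ord1 mxE expr2.
    rewrite [LHS]mxE [X in _ + X]mxE [X in _ - X]mxE E; field.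
    exact: lt0r_neq0.
  apply: H; apply: contra w0 => /eqP/(congr1 rsubmx).
  by rewrite row_mxKr linear0 => ->.
pose al := Num.sqrt a.
have al0 : 0 < al by rewrite sqrtr_gt0.
have al2 : al * al = a by rewrite -expr2 sqr_sqrtr // ltW.
exists (block_mx al%:M 0 (al^-1 *: b^T) Q').
  rewrite unitmxE (det_lblock al%:M (al^-1 *: b^T) Q') det_scalar expr1 unitrM.
  by rewrite unitfE lt0r_neq0 //= -unitmxE.
rewrite {1}Se tr_block_mx mulmx_block.
rewrite !trmx0 !mulmx0 !mul0mx !addr0 tr_scalar_mx -scalar_mxM al2.
rewrite linearZ /= trmxK mul_scalar_mx scalerA divff ?lt0r_neq0 // scale1r.
rewrite mul_mx_scalar scalerA divff ?lt0r_neq0 // scale1r.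
rewrite -scalemxAl -scalemxAr scalerA -S'E /S' -invfM al2 addrC subrK.
by [].
Qed.

Lemma pos_def_unit n (S : 'M[R]_n) : pos_def S -> S \in unitmx.
Proof.
by move=> /pos_def_factor[Q Qu ->]; rewrite unitmx_mul unitmx_tr Qu.
Qed.

(** With [S = Q Q^T] the trace is the sum of the squares of the entries of [Q^-1 U Q]. *)
Lemma pos_def_trace_ge0 n (S U : 'M[R]_n) : pos_def S ->
  0 <= \tr (U *m S *m U^T *m invmx S).
Proof.
move=> /pos_def_factor[Q Qu ->].
have QTu : Q^T \in unitmx by rewrite unitmx_tr.
pose Z := invmx Q *m U *m Q.
have -> : \tr (U *m (Q *m Q^T) *m U^T *m invmx (Q *m Q^T)) = \tr (Z *m Z^T).
  have -> : invmx (Q *m Q^T) = invmx Q^T *m invmx Q.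
    have QQ : Q *m Q^T *m (invmx Q^T *m invmx Q) = 1%:M.
      by rewrite -mulmxA (mulmxA Q^T) mulmxV // mul1mx mulmxV.
    by rewrite -[LHS]mulmx1 -QQ mulKmx // unitmx_mul Qu.
  rewrite /Z !trmx_mul trmx_inv mulmxA mxtrace_mulC !mulmxA.
  by rewrite -!mulmxA mxtrace_mulC !mulmxA.
rewrite /mxtrace sumr_ge0 // => i _; rewrite mxE sumr_ge0 // => j _.
by rewrite [Z^T j i]mxE -expr2 sqr_ge0.
Qed.

End PositiveDefinite.

(** * Entrywise derivatives, one-parameter groups and the trace inequality *)

Section MatrixDerivative.
Context {R : realType}.

Definition mx_deriv m n (M : R -> 'M[R]_(m, n)) (s : R) (M' : 'M[R]_(m, n)) : Prop :=
  forall i j, is_derive s 1 (fun u => M u i j) (M' i j).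

Lemma mx_deriv_cst m n (W : 'M[R]_(m, n)) s : mx_deriv (fun=> W) s 0.
Proof. by move=> i j; rewrite mxE; exact: is_derive_cst. Qed.

Lemma mx_derivM m n p (M : R -> 'M[R]_(m, n)) (N : R -> 'M[R]_(n, p)) s M' N' :
  mx_deriv M s M' -> mx_deriv N s N' ->
  mx_deriv (fun u => M u *m N u) s (M' *m N s + M s *m N').
Proof.
move=> dM dN i j.
have -> : (fun u => (M u *m N u) i j) =
    \sum_(k < n) ((fun u => M u i k) * (fun u => N u k j)).
  by apply/funext => u; rewrite fct_sumE mxE.
have -> : (M' *m N s + M s *m N') i j =
    \sum_(k < n) (M s i k *: N' k j + N s k j *: M' i k).
  rewrite !mxE -big_split /=; apply: eq_bigr => k _.
  by rewrite addrC; congr (_ + _); rewrite /GRing.scale /= mulrC.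
by apply: is_derive_sum => k; apply: is_deriveM.
Qed.

Lemma mx_derivT m n (M : R -> 'M[R]_(m, n)) s M' :
  mx_deriv M s M' -> mx_deriv (fun u => (M u)^T) s M'^T.
Proof. by move=> dM i j; rewrite mxE; under eq_fun do rewrite mxE; exact: dM. Qed.

Lemma is_derive_compN (f : R -> R) (s d : R) :
  is_derive (- s) 1 f d -> is_derive s 1 (fun u => f (- u)) (- d).
Proof.
move=> df.
have dN : is_derive s 1 (-%R : R -> R) (- 1) by exact: is_deriveNid.
have := @is_derive1_comp R f (-%R : R -> R) s d (- 1) df dN.
by rewrite mulrN1.
Qed.

Lemma mx_derivN m n (M : R -> 'M[R]_(m, n)) s M' :
  mx_deriv M (- s) M' -> mx_deriv (fun u => M (- u)) s (- M').
Proof. by move=> dM i j; rewrite mxE; exact: (is_derive_compN (dM i j)). Qed.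

Lemma mx_deriv_trace n (M : R -> 'M[R]_n) s M' : mx_deriv M s M' ->
  is_derive s 1 (fun u => \tr (M u)) (\tr M').
Proof.
move=> dM; rewrite /mxtrace.
have -> : (fun u => \sum_i M u i i) = \sum_(i < n) (fun u => M u i i).
  by apply/funext => u; rewrite fct_sumE.
by apply: is_derive_sum => i; exact: dM.
Qed.

Lemma mx_deriv0_cst m n (M : R -> 'M[R]_(m, n)) s u :
  (forall v, mx_deriv M v 0) -> M s = M u.
Proof.
move=> dM; apply/matrixP => i j.
apply: (@is_derive_0_is_cst R (fun v => M v i j)) => v.
by have := dM v i j; rewrite mxE.
Qed.

Record mx_group n (A : R -> 'M[R]_n) (X : 'M[R]_n) : Prop := MxGroup {
  mx_groupD : forall s u, A (s + u) = A s *m A u;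
  mx_group0 : A 0 = 1%:M;
  mx_group_deriv0 : mx_deriv A 0 X }.

Lemma is_derive_shift0 (f : R -> R) (s d : R) :
  is_derive (0 : R) 1 f d -> is_derive s 1 (fun u => f (u - s)) d.
Proof.
move=> df.
have dN : is_derive s 1 (fun u : R => u - s) 1.
  by have := is_deriveB (is_derive_id s 1) (is_derive_cst s s 1); rewrite subr0.
have df' : is_derive (s - s) 1 f d by rewrite subrr.
have := @is_derive1_comp R f (fun u : R => u - s) s d 1 df' dN.
by rewrite mulr1.
Qed.

Section Group.
Variables (n : nat) (A : R -> 'M[R]_n) (X : 'M[R]_n).
Hypothesis AX : mx_group A X.

Lemma mx_groupC s u : A s *m A u = A u *m A s.
Proof. by rewrite -!(mx_groupD AX) addrC. Qed.

Lemma mx_groupV s : A s *m A (- s) = 1%:M.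
Proof. by rewrite -(mx_groupD AX) subrr (mx_group0 AX). Qed.

Lemma mx_groupVl s : A (- s) *m A s = 1%:M.
Proof. by rewrite mx_groupC mx_groupV. Qed.

Lemma mx_group_deriv s : mx_deriv A s (A s *m X).
Proof.
have E : A = (fun u => A s *m A (u - s)).
  by apply/funext => u; rewrite -(mx_groupD AX) addrC subrK.
have d0 : mx_deriv (fun u => A (u - s)) s X.
  by move=> i j; exact: (is_derive_shift0 s (mx_group_deriv0 AX i j)).
have := mx_derivM (mx_deriv_cst (A s) s) d0.
by rewrite mul0mx add0r -E.
Qed.

Lemma mx_group_derivl s : mx_deriv A s (X *m A s).
Proof.
have E : A = (fun u => A (u - s) *m A s).
  by apply/funext => u; rewrite -(mx_groupD AX) subrK.
have d0 : mx_deriv (fun u => A (u - s)) s X.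
  by move=> i j; exact: (is_derive_shift0 s (mx_group_deriv0 AX i j)).
have := mx_derivM d0 (mx_deriv_cst (A s) s).
by rewrite mulmx0 addr0 -E.
Qed.

Lemma mx_group_comm s : A s *m X = X *m A s.
Proof.
apply/matrixP => i j.
by rewrite -(@derive_val _ _ _ _ _ _ _ (mx_group_deriv s i j))
  (@derive_val _ _ _ _ _ _ _ (mx_group_derivl s i j)).
Qed.

Lemma mx_group_tr : mx_group (fun s => (A s)^T) X^T.
Proof.
split; last exact: mx_derivT (mx_group_deriv0 AX).
  by move=> s u; rewrite addrC (mx_groupD AX) trmx_mul.
by rewrite (mx_group0 AX) trmx1.
Qed.

Lemma mx_groupN : mx_group (fun s => A (- s)) (- X).
Proof.
split; last by apply: mx_derivN; rewrite oppr0; exact: mx_group_deriv0 AX.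
  by move=> s u; rewrite opprD (mx_groupD AX).
by rewrite oppr0 (mx_group0 AX).
Qed.

End Group.

(** The product [A (- s) W B s] has zero derivative. Every passage from ad to Ad below goes through
    this: commutation with the Cartan projections, self-adjointness on p, isometry on k, commutation
    inside the torus. *)
Lemma mx_group_intertwine m n (A : R -> 'M[R]_m) (B : R -> 'M[R]_n) X Y
    (W : 'M[R]_(m, n)) s :
  mx_group A X -> mx_group B Y -> X *m W = W *m Y -> A s *m W = W *m B s.
Proof.
move=> AX BY XW.
have H : A (- s) *m W *m B s = A (- 0) *m W *m B 0.
  apply: (@mx_deriv0_cst _ _ (fun s => A (- s) *m W *m B s)) => v.
  have d1 := mx_derivM (mx_derivM (mx_group_deriv (mx_groupN AX) v) (mx_deriv_cst W v))
    (mx_group_derivl BY v).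
  have -> : 0 = (A (- v) *m (- X) *m W + A (- v) *m 0) *m B v +
     A (- v) *m W *m (Y *m B v).
    rewrite mulmx0 addr0 mulmxN mulNmx mulNmx -!mulmxA (mulmxA X) XW !mulmxA.
    by rewrite addNr.
  exact: d1.
rewrite oppr0 (mx_group0 AX) (mx_group0 BY) mul1mx mulmx1 in H.
by rewrite -{1}H !mulmxA (mx_groupV AX) mul1mx.
Qed.

(** Two integrations of [f2 >= 2 * c] from 0 give [f s >= f 0 + c * s^2] for [s >= 0]. The value at
    [s = 2] is the one that occurs in the energy of a conjugate. *)
Lemma le_second_derivative (f f1 f2 : R -> R) (c : R) :
  (forall s : R, is_derive s 1 f (f1 s)) -> (forall s : R, is_derive s 1 f1 (f2 s)) ->
  f1 0 = 0 -> (forall s, 2 * c <= f2 s) -> f 0 + 4 * c <= f 2.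
Proof.
move=> d1 d2 f10 f2c.
have cont (h h' : R -> R) : (forall s : R, is_derive s 1 h (h' s)) -> forall a b : R,
    {within `[a, b], continuous h}.
  move=> dh a b; apply: derivable_within_continuous => x _.
  exact: (@ex_derive _ _ _ _ _ _ _ (dh x)).
have h1 s : 0 <= s -> 2 * c * s <= f1 s.
  move=> s0; have [x _] := MVT_segment s0 (fun x _ => d2 x) (cont _ _ d2 0 s).
  by rewrite f10 !subr0 => ->; rewrite ler_wpM2r.
pose g s := f s - c * s ^+ 2.
have dg (s : R) : is_derive s 1 g (f1 s - 2 * c * s).
  have dX : is_derive s 1 (fun u : R => c * u ^+ 2) (c * (2 * s)).
    have := @is_deriveZ _ _ _ _ c s 1 _ (@is_deriveX _ _ _ 2 s 1 1 (is_derive_id s 1)).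
    by rewrite /GRing.scale /= mulr1 expr1 mulr_natl.
  have := is_deriveB (d1 s) dX.
  by have -> : 2 * c * s = c * (2 * s) by ring.
have [x x0 E] := MVT_segment (ler0n R 2) (fun x _ => dg x) (cont _ _ dg 0 2).
have x00 : 0 <= x by move: x0; rewrite in_itv /= => /andP[].
have := h1 x x00; have : 0 <= (f1 x - 2 * c * x) * (2 - 0).
  by rewrite mulr_ge0 ?subr0 // subr_ge0 h1.
by rewrite -E /g => H _; lra.
Qed.

(* F s = tr (A s B (-s)) has F'' s = tr (A s V B (-s) V) with V = X - Y.  With
   h = s / 2 and U = A h V B (-h) - A (-h) V B h, the trace of U times its
   S-adjoint is F'' s + F'' (-s) - 2 tr (V V), hence the latter is nonnegative. *)
Lemma trace_group_ge n (A B : R -> 'M[R]_n) (X Y S : 'M[R]_n) :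
  mx_group A X -> mx_group B Y -> pos_def S ->
  X *m S = S *m X^T -> Y *m S = S *m Y^T ->
  4 * \tr ((X - Y) *m (X - Y)) <= \tr (A 2 *m B (- 2)) + \tr (A (- 2) *m B 2).
Proof.
move=> AX BY Sp XS YS.
have Su := pos_def_unit Sp.
set V := X - Y.
have AS s : A s *m S = S *m (A s)^T := mx_group_intertwine s AX (mx_group_tr AX) XS.
have BS s : B s *m S = S *m (B s)^T := mx_group_intertwine s BY (mx_group_tr BY) YS.
have VS : V *m S = S *m V^T.
  by rewrite /V mulmxBl XS YS -mulmxBr -linearB.
pose k s := \tr (A s *m V *m B (- s) *m V).
pose F s := \tr (A s *m B (- s)).
pose F1 s := \tr (A s *m V *m B (- s)).
have dF (s : R) : is_derive s 1 F (F1 s).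
  have := mx_deriv_trace (mx_derivM (mx_group_deriv AX s) (mx_group_derivl (mx_groupN BY) s)).
  rewrite mulNmx mulmxN mulmxA -mulmxBl -mulmxBr; exact.
have dF1 (s : R) : is_derive s 1 F1 (k s).
  have := mx_deriv_trace (mx_derivM (mx_derivM (mx_group_deriv AX s) (mx_deriv_cst V s))
     (mx_group_derivl (mx_groupN BY) s)).
  rewrite mulmx0 addr0 mulNmx mulmxN linearB /=.
  have -> : \tr (A s *m X *m V *m B (- s)) = \tr (A s *m V *m B (- s) *m X).
    by rewrite (mx_group_comm AX) -!mulmxA mxtrace_mulC !mulmxA.
  have -> : Y *m B (- s) = B (- s) *m Y by rewrite (mx_group_comm BY).
  by rewrite -linearB /= mulmxA -mulmxBr; exact.
clearbody V.
have kk s : 2 * \tr (V *m V) <= k s + k (- s).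
  pose h := s / 2.
  have sh : s = h + h by rewrite /h -splitr.
  pose U := A h *m V *m B (- h) - A (- h) *m V *m B h.
  pose U' := B (- h) *m V *m A h - B h *m V *m A (- h).
  have SU : S *m U^T = U' *m S.
    have E a b : S *m (A a *m V *m B b)^T = B b *m V *m A a *m S.
      rewrite !trmx_mul !mulmxA -BS -!mulmxA (mulmxA S) -VS -(mulmxA V S).
      by rewrite -AS !mulmxA.
    by rewrite /U /U' linearB mulmxBr !E -mulmxBl.
  have := pos_def_trace_ge0 U Sp.
  rewrite -(mulmxA U) SU !mulmxA mulmxK //.
  have -> : U *m U' = A h *m V *m B (- s) *m V *m A h - A h *m V *m V *m A (- h)
     - A (- h) *m V *m V *m A h + A (- h) *m V *m B s *m V *m A (- h).
    have b1 : B (- s) = B (- h) *m B (- h) by rewrite sh opprD (mx_groupD BY).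
    have b2 : B s = B h *m B h by rewrite {1}sh (mx_groupD BY).
    rewrite b1 b2 /U /U' mulmxBr !mulmxBl opprB.
    rewrite !mulmxA -(mulmxA _ (B (- h)) (B h)) -(mulmxA _ (B h) (B (- h))).
    rewrite (mx_groupV BY) (mx_groupVl BY) !mulmx1 addrA.
    by rewrite [LHS]addrAC; congr (_ + _); exact: addrAC.
  rewrite mxtraceD !raddfB /=.
  have T a (W : 'M[R]_n) : \tr (A a *m W *m A a) = \tr (A (a + a) *m W).
    by rewrite mxtrace_mulC mulmxA -(mx_groupD AX).
  have T2 a (W : 'M[R]_n) : \tr (A a *m W *m A (- a)) = \tr W.
    by rewrite mxtrace_mulC mulmxA (mx_groupVl AX) mul1mx.
  have T3 a (W : 'M[R]_n) : \tr (A (- a) *m W *m A a) = \tr W.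
    by rewrite mxtrace_mulC mulmxA (mx_groupV AX) mul1mx.
  have a1 : \tr (A h *m V *m B (- s) *m V *m A h) = k s.
    by rewrite -!mulmxA (mulmxA V) (mulmxA (V *m _)) mulmxA T -sh /k !mulmxA.
  have a2 : \tr (A (- h) *m V *m B s *m V *m A (- h)) = k (- s).
    by rewrite -!mulmxA (mulmxA V) (mulmxA (V *m _)) mulmxA T -opprD -sh /k opprK !mulmxA.
  have a3 : \tr (A h *m V *m V *m A (- h)) = \tr (V *m V) by rewrite -(mulmxA (A h)) T2.
  have a4 : \tr (A (- h) *m V *m V *m A h) = \tr (V *m V) by rewrite -(mulmxA (A (- h))) T3.
  rewrite a1 a2 a3 a4 => ?; lra.
(* Symmetrising in [s] cancels the first derivative at 0, and the second derivative becomes the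
   quantity bounded by [kk]. *)
have := @le_second_derivative (fun s => F s + F (- s)) (fun s => F1 s - F1 (- s))
  (fun s => k s + k (- s)) (\tr (V *m V)).
have i1 (s : R) : is_derive s 1 (fun s => F s + F (- s)) (F1 s - F1 (- s)).
  exact: is_deriveD (dF s) (is_derive_compN (dF (- s))).
have i2 (s : R) : is_derive s 1 (fun s => F1 s - F1 (- s)) (k s + k (- s)).
  have := is_deriveB (dF1 s) (is_derive_compN (dF1 (- s))).
  by rewrite opprK.
move=> /(_ i1 i2); rewrite oppr0 subrr => /(_ erefl kk).
rewrite /F oppr0 (mx_group0 AX) (mx_group0 BY) mulmx1 mxtrace1 opprK.
apply: le_trans; rewrite lerDr addr_ge0 //.
Qed.

End MatrixDerivative.

(** * The Killing form and the Cartan decomposition *)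

Section CartanAlgebra.
Context {R : realType} {n : nat} (g : lieAlgebra R n).
Local Notation V := 'rV[R]_n.
Local Notation ad := (ad_mx g).
Implicit Types (x y w : V).

Lemma bracketDl x y w : g (x + y) w = g x w + g y w.
Proof. by have := bracket_linear_l g w 1 x y; rewrite !scale1r. Qed.

Lemma bracketZl (a : R) x w : g (a *: x) w = a *: g x w.
Proof.
have g0 : g 0 w = 0.
  by have := bracketDl 0 0 w; rewrite addr0 => /(congr1 (fun u => u - g 0 w)); rewrite addrK subrr.
by have := bracket_linear_l g w a x 0; rewrite !addr0 g0 addr0.
Qed.

Lemma bracket_anti x y : g x y = - g y x.
Proof.
have := bracket_alt g (x + y); rewrite bracketDl.
rewrite -!mul_ad_mx !mulmxDl !mul_ad_mx !bracket_alt add0r addr0 => /eqP.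
by rewrite addr_eq0 => /eqP.
Qed.

Lemma bracketDr x y w : g x (y + w) = g x y + g x w.
Proof. by rewrite -!mul_ad_mx mulmxDl. Qed.

Lemma bracketZr (a : R) x y : g x (a *: y) = a *: g x y.
Proof. by rewrite -!mul_ad_mx scalemxAl. Qed.

Lemma bracketNr x y : g x (- y) = - g x y.
Proof. by rewrite -scaleN1r bracketZr scaleN1r. Qed.

Lemma bracket0r x : g x 0 = 0.
Proof. by rewrite -mul_ad_mx mul0mx. Qed.

Lemma bracket0l x : g 0 x = 0.
Proof. by rewrite bracket_anti bracket0r oppr0. Qed.

Lemma bracket_jacobi2 x y w : g x (g y w) = g (g x y) w + g y (g x w).
Proof.
have := bracket_jacobi g x y w.
rewrite (bracket_anti w x) (bracket_anti w (g x y)) bracketNr.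
rewrite -addrA => /eqP; rewrite addr_eq0 => /eqP ->.
by rewrite opprD !opprK addrC.
Qed.

Lemma ad_mxD x y : ad (x + y) = ad x + ad y.
Proof. by apply: row_mx_ext => w; rewrite mulmxDr !mul_ad_mx bracketDl. Qed.

Lemma ad_mxZ (a : R) x : ad (a *: x) = a *: ad x.
Proof. by apply: row_mx_ext => w; rewrite -scalemxAr !mul_ad_mx bracketZl. Qed.

Lemma ad_mxN x : ad (- x) = - ad x.
Proof. by rewrite -scaleN1r ad_mxZ scaleN1r. Qed.

Lemma ad_mxB x y : ad (x - y) = ad x - ad y.
Proof. by rewrite ad_mxD ad_mxN. Qed.

Lemma ad_mx0 : ad 0 = 0.
Proof. by rewrite -(scale0r (0 : V)) ad_mxZ scale0r. Qed.

Lemma ad_mx_bracket x y : ad (g x y) = ad y *m ad x - ad x *m ad y.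
Proof.
apply: row_mx_ext => w; rewrite mulmxBr !mulmxA !mul_ad_mx.
by rewrite (bracket_jacobi2 x) addrK.
Qed.

Lemma ad_mx_sum (I : finType) (f : I -> V) : ad (\sum_i f i) = \sum_i ad (f i).
Proof. by elim/big_rec2: _ => [|i u v _ <-]; rewrite ?ad_mx0 ?ad_mxD. Qed.

Definition killing_mx : 'M[R]_n :=
  \matrix_(i, j) killing g (delta_mx 0 i) (delta_mx 0 j).

Lemma killingE x y : (x *m killing_mx *m y^T) 0 0 = killing g x y.
Proof.
rewrite /killing [in RHS](row_sum_delta x) [in RHS](row_sum_delta y) !ad_mx_sum.
rewrite mulmx_suml raddf_sum /= -mulmxA mxE; apply: eq_bigr => i _.
rewrite mulmx_sumr raddf_sum /= [(killing_mx *m _) _ _]mxE mulr_sumr.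
apply: eq_bigr => j _; rewrite !ad_mxZ -scalemxAl -scalemxAr !linearZ /=.
by rewrite [killing_mx i j]mxE [y^T j 0]mxE [y 0 j * _]mulrC.
Qed.

Lemma killingC x y : killing g x y = killing g y x.
Proof. by rewrite /killing mxtrace_mulC. Qed.

Lemma killing_mx_sym : killing_mx^T = killing_mx.
Proof. by apply/matrixP => i j; rewrite !mxE killingC. Qed.

Lemma killing_inv x y w : killing g (g x y) w = - killing g y (g x w).
Proof.
have trB (A B : 'M[R]_n) : \tr (A - B) = \tr A - \tr B by rewrite raddfB.
rewrite /killing !ad_mx_bracket mulmxBl mulmxBr !trB opprB.
congr (_ - _); first by rewrite mulmxA.
by rewrite -mulmxA mxtrace_mulC mulmxA.
Qed.

Lemma bilin_mx_ext (A B : 'M[R]_n) :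
  (forall x y, (x *m A *m y^T) 0 0 = (x *m B *m y^T) 0 0) -> A = B.
Proof.
move=> H; apply/matrixP => i j.
have := H (delta_mx 0 i) (delta_mx 0 j).
by rewrite -!rowE !trmx_delta -!colE !mxE.
Qed.

Lemma killing_mx_inv x : ad x *m killing_mx = - (killing_mx *m (ad x)^T).
Proof.
apply: bilin_mx_ext => y w.
rewrite mulmxN mulNmx mulmxA mul_ad_mx killingE killing_inv.
by rewrite mulmxA -mulmxA -trmx_mul mul_ad_mx [RHS]mxE killingE.
Qed.

Section Decomposition.
Variables (k p : {vspace V}).
Hypothesis cartan : cartan_decomposition g k p.

Let kp0 : (k :&: p = 0)%VS. Proof. by case: cartan => [[]]. Qed.
Let pk0 : (p :&: k = 0)%VS. Proof. by rewrite capvC. Qed.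
Let kpT w : w \in (k + p)%VS. Proof. by case: cartan => [[-> _] *]; rewrite memvf. Qed.
Let kk x y : x \in k -> y \in k -> g x y \in k. Proof. by case: cartan => _ + *; apply. Qed.
Let kpp x y : x \in k -> y \in p -> g x y \in p. Proof. by case: cartan => _ _ + *; apply. Qed.
Let ppk x y : x \in p -> y \in p -> g x y \in k. Proof. by case: cartan => _ _ _ + *; apply. Qed.
Let pkp x y : x \in p -> y \in k -> g x y \in p.
Proof. by move=> xp yk; rewrite bracket_anti memvN; apply: kpp. Qed.
Let killing_k x : x \in k -> x != 0 -> killing g x x < 0.
Proof. by case: cartan => _ _ _ _ [+ _] *; apply. Qed.
Let killing_p x : x \in p -> x != 0 -> 0 < killing g x x.
Proof. by case: cartan => _ _ _ _ [_ +] *; apply. Qed.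

Definition proj_k : 'M[R]_n := lin1_mx (daddv_pi k p).
Definition proj_p : 'M[R]_n := lin1_mx (daddv_pi p k).

Lemma mul_proj_k w : w *m proj_k \in k.
Proof. by rewrite mul_rV_lin1 memv_pi. Qed.

Lemma mul_proj_p w : w *m proj_p \in p.
Proof. by rewrite mul_rV_lin1 memv_pi. Qed.

Lemma proj_kD : proj_k + proj_p = 1%:M.
Proof.
apply: row_mx_ext => w; rewrite mulmxDr !mul_rV_lin1 mulmx1.
by rewrite /= daddv_pi_add.
Qed.

Lemma proj_k_id w : w \in k -> w *m proj_k = w.
Proof. by move=> wk; rewrite mul_rV_lin1 /= daddv_pi_id. Qed.

Lemma proj_p_id w : w \in p -> w *m proj_p = w.
Proof. by move=> wk; rewrite mul_rV_lin1 /= daddv_pi_id. Qed.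

Lemma proj_p_k w : w \in k -> w *m proj_p = 0.
Proof.
move=> wk; have := congr1 (mulmx w) proj_kD.
rewrite mulmxDr mulmx1 (proj_k_id wk) => /(congr1 (fun u => u - w)).
by rewrite addrAC subrr add0r.
Qed.

Lemma proj_k_p w : w \in p -> w *m proj_k = 0.
Proof.
move=> wk; have := congr1 (mulmx w) proj_kD.
rewrite mulmxDr mulmx1 (proj_p_id wk) => /(congr1 (fun u => u - w)).
by rewrite addrK subrr.
Qed.

Lemma proj_decomp w : w = w *m proj_k + w *m proj_p.
Proof. by rewrite -mulmxDr proj_kD mulmx1. Qed.

Lemma mem_p_proj w : w *m proj_k = 0 -> w \in p.
Proof. by move=> H; rewrite (proj_decomp w) H add0r mul_proj_p. Qed.

Lemma ad_k_proj_k x : x \in k -> ad x *m proj_k = proj_k *m ad x.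
Proof.
move=> xk; apply: row_mx_ext => w; rewrite !mulmxA !mul_ad_mx.
rewrite {1}(proj_decomp w) bracketDr mulmxDl.
by rewrite (proj_k_id (kk xk (mul_proj_k w))) (proj_k_p (kpp xk (mul_proj_p w))) addr0.
Qed.

Lemma ad_k_proj_p x : x \in k -> ad x *m proj_p = proj_p *m ad x.
Proof.
move=> xk; apply: row_mx_ext => w; rewrite !mulmxA !mul_ad_mx.
rewrite {1}(proj_decomp w) bracketDr mulmxDl.
rewrite proj_p_k ?kk ?mul_proj_k // proj_p_id ?add0r //.
by apply: kpp => //; exact: mul_proj_p.
Qed.

Lemma ad_p_proj_k x : x \in p -> ad x *m proj_k = proj_p *m ad x.
Proof.
move=> xk; apply: row_mx_ext => w; rewrite !mulmxA !mul_ad_mx.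
rewrite {1}(proj_decomp w) bracketDr mulmxDl.
rewrite proj_k_p ?pkp ?mul_proj_k // proj_k_id ?add0r //.
by apply: ppk => //; exact: mul_proj_p.
Qed.

Lemma ad_p_proj_p x : x \in p -> ad x *m proj_p = proj_k *m ad x.
Proof.
move=> xk; apply: row_mx_ext => w; rewrite !mulmxA !mul_ad_mx.
rewrite {1}(proj_decomp w) bracketDr mulmxDl.
rewrite proj_p_id ?pkp ?mul_proj_k // proj_p_k ?addr0 //.
by apply: ppk => //; exact: mul_proj_p.
Qed.

(* Gram matrix of - kappa (theta x, y), with theta the Cartan involution. *)
Definition cartan_mx : 'M[R]_n :=
  proj_p *m killing_mx *m proj_p^T - proj_k *m killing_mx *m proj_k^T.

Lemma cartan_mxE x y : (x *m cartan_mx *m y^T) 0 0 =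
  killing g (x *m proj_p) (y *m proj_p) - killing g (x *m proj_k) (y *m proj_k).
Proof.
rewrite /cartan_mx mulmxBr mulmxBl -!killingE !trmx_mul !mulmxA.
by rewrite [LHS]mxE [X in _ + X]mxE.
Qed.

Lemma killing_ge0_p x : x \in p -> 0 <= killing g x x.
Proof.
move=> xp; have [->|x0] := eqVneq x 0; last exact: ltW (killing_p _ _).
by rewrite /killing ad_mx0 mul0mx linear0.
Qed.

Lemma killing_le0_k x : x \in k -> killing g x x <= 0.
Proof.
move=> xk; have [->|x0] := eqVneq x 0; last exact: ltW (killing_k _ _).
by rewrite /killing ad_mx0 mul0mx linear0.
Qed.

Lemma cartan_mx_pos_def : pos_def cartan_mx.
Proof.
split.
  by rewrite /cartan_mx linearB /= !trmx_mul !trmxK killing_mx_sym !mulmxA.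
move=> v v0; rewrite cartan_mxE.
have hp := killing_ge0_p (mul_proj_p v); have hk := killing_le0_k (mul_proj_k v).
have [vp|vp] := eqVneq (v *m proj_p) 0; last first.
  by have := killing_p (mul_proj_p v) vp; lra.
have vk : v *m proj_k != 0.
  by apply: contra v0 => /eqP vk; rewrite (proj_decomp v) vk vp addr0.
by have := killing_k (mul_proj_k v) vk; lra.
Qed.

Lemma ad_k_cartan x : x \in k -> ad x *m cartan_mx = - (cartan_mx *m (ad x)^T).
Proof.
move=> xk; rewrite /cartan_mx mulmxBr mulmxBl !mulmxA.
rewrite ad_k_proj_p // ad_k_proj_k // -!(mulmxA _ (ad x)) killing_mx_inv.
rewrite !mulmxN !mulNmx !mulmxA -!(mulmxA _ (ad x)^T) -!trmx_mul.
rewrite -ad_k_proj_p // -ad_k_proj_k // !trmx_mul !mulmxA.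
by rewrite opprB opprK addrC.
Qed.

(** For [x] in p, ad x exchanges k and p, hence the two terms of [cartan_mx]; their opposite signs
    compensate the skewness of ad x for the Killing form. *)
Lemma ad_p_cartan x : x \in p -> ad x *m cartan_mx = cartan_mx *m (ad x)^T.
Proof.
move=> xk; rewrite /cartan_mx mulmxBr mulmxBl !mulmxA.
rewrite ad_p_proj_p // ad_p_proj_k // -!(mulmxA _ (ad x)) killing_mx_inv.
rewrite !mulmxN !mulNmx !mulmxA -!(mulmxA _ (ad x)^T) -!trmx_mul.
rewrite -ad_p_proj_k // -ad_p_proj_p // !trmx_mul !mulmxA.
by rewrite opprK addrC.
Qed.

(** * The action of the centre of k on p *)

Section Center.
Variable z : V.
Hypothesis gsimple : simple_lie g.
Hypothesis zc : in_center g k z.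

Let zk : z \in k. Proof. by case: zc. Qed.
Let zk0 x : x \in k -> g z x = 0. Proof. by case: zc => _ + *; apply. Qed.

(* The kernel and the image of ad z on p are orthogonal for kappa, which is
   positive definite on p. *)
Lemma adz_p_decomp w : w \in p ->
  exists a b, [/\ a \in p, g z a = 0, b \in p & w = a + g z b].
Proof.
move=> wp.
pose m := GRing.isLinear.Build _ _ _ _ _ (bracket_linear_r g z).
pose fL : {linear V -> V} := HB.pack (bracket g z) m.
pose f : 'End(V) := linfun fL.
have fE u : f u = g z u by rewrite lfunE.
have ker u : (u \in lker f) = (g z u == 0) by rewrite memv_ker fE.
have cap0 : ((p :&: lker f) :&: (f @: p) = 0)%VS.
  apply/eqP; rewrite -subv0; apply/subvP => u; rewrite !memv_cap => /andP[/andP[up]].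
  rewrite ker => /eqP zu /memv_imgP[b bp ub]; rewrite memv0.
  apply/negPn/negP => u0; have := killing_p up u0.
  by rewrite {2}ub fE killingC killing_inv zu killingC /killing ad_mx0 mul0mx linear0 oppr0 ltxx.
have sub : ((p :&: lker f) + (f @: p) <= p)%VS.
  rewrite subv_add capvSl /=; apply/subvP => u /memv_imgP[b bp ->].
  by rewrite fE; apply: kpp.
have E : ((p :&: lker f) + (f @: p) = p)%VS.
  apply/eqP; rewrite eqEdim sub /=.
  by rewrite dimv_disjoint_sum // limg_ker_dim.
move: wp; rewrite -{1}E => /memv_addP[a]; rewrite memv_cap => /andP[ap].
rewrite ker => /eqP za [_ /memv_imgP[b bp ->] ->].
by exists a, b; rewrite fE.
Qed.

(** The bracket of [a] and [b] lies in k, so [z] kills it, and the Jacobi identity leaves only this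
    term. *)
Lemma adz_comm a b : a \in p -> g z a = 0 -> b \in p -> g a (g z b) = 0.
Proof.
move=> ap za bp; have := bracket_jacobi2 z a b.
by rewrite za bracket0l add0r zk0 ?ppk.
Qed.

(* The centralizer of [z, p] is an ideal containing ker (ad z) on p, and it is not
   all of g since ad z <> 0. *)
Lemma adz_p_inj (adz0 : ad z != 0) a : a \in p -> g z a = 0 -> a = 0.
Proof.
move=> ap za.
(* Writing the centralizer of [[z, p]] as the kernel of a linear map makes it a subspace [J] to
   which simplicity applies. *)
have lin : linear (fun y : V => proj_p *m ad z *m ad y).
  by move=> s u v; rewrite ad_mxD ad_mxZ mulmxDr -scalemxAr.
pose m := GRing.isLinear.Build _ _ _ _ _ lin.
pose fL : {linear V -> 'M[R]_n} := HB.pack (fun y : V => proj_p *m ad z *m ad y) m.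
pose J := lker (linfun fL).
have JP y : reflect (forall b, b \in p -> g y (g z b) = 0) (y \in J).
  rewrite memv_ker lfunE /=; apply: (iffP eqP) => [H b bp|H].
    by have := congr1 (mulmx b) H; rewrite mulmx0 !mulmxA proj_p_id // !mul_ad_mx.
  apply: row_mx_ext => w; rewrite mulmx0 !mulmxA !mul_ad_mx H //.
  exact: mul_proj_p.
have ideal : lie_ideal g J.
  move=> x y /JP Hy; apply/JP => b bp.
  have red w : g y (g w (g z b)) = 0 -> g (g w y) (g z b) = 0.
    by move=> H; have := bracket_jacobi2 w y (g z b); rewrite Hy // bracket0r H addr0.
  rewrite (proj_decomp x) bracketDl bracketDl.
  (* The element [x] is now a sum of three: one in k, one in p killed by ad z, and one in [[z, p]];
     each is handled by its own commutation rule. *)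
  have [c [d [cp zcc dp ->]]] := adz_p_decomp (mul_proj_p x).
  rewrite bracketDl bracketDl !red ?addr0 //.
  - have := bracket_jacobi2 y (g z d) (g z b).
    by rewrite Hy // bracket0l Hy // bracket0r addr0.
  - by rewrite adz_comm // bracket0r.
  have h := mul_proj_k x; move: (x *m proj_k) h => w wk.
  have <- : g z (g w b) = g w (g z b).
    by rewrite bracket_jacobi2 (zk0 wk) bracket0l add0r.
  by apply: Hy; apply: kpp.
have aJ : a \in J by apply/JP => b bp; exact: adz_comm.
have [_ /(_ J ideal)[J0|JT]] := gsimple.
  by move: aJ; rewrite J0 memv0 => /eqP.
exfalso; move/eqP: adz0; apply; apply: row_mx_ext => w.
rewrite mulmx0 mul_ad_mx (proj_decomp w) bracketDr zk0 ?mul_proj_k // add0r.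
have bp := mul_proj_p w; move: (w *m proj_p) bp => b bp.
apply/eqP/negPn/negP => u0; have := killing_p (kpp zk bp) u0.
(* If [J] is everything then [[z, b]] is central, hence isotropic for the Killing form, which
   contradicts positivity on p. *)
have C y : g y (g z b) = 0 by apply/JP => //; rewrite JT memvf.
have -> : killing g (g z b) (g z b) = 0; last by rewrite ltxx.
have a0 : ad (g z b) = 0.
  by apply: row_mx_ext => y; rewrite mulmx0 mul_ad_mx bracket_anti C oppr0.
by rewrite /killing a0 mul0mx linear0.
Qed.

End Center.
End Decomposition.
End CartanAlgebra.

(** * Fixed points of the torus on p *)

Section Complexification.
Context {R : realType} {n : nat}.
Local Notation C := R[i].
Local Notation V := 'rV[R]_n.

Definition mxC m p (M : 'M[R]_(m, p)) : 'M[C]_(m, p) := map_mx (real_complex R) M.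

Lemma mulii : 'i%C * 'i%C = -1 :> C.
Proof. by rewrite -expr2 sqr_i. Qed.

Lemma toCE (x : V) : toC x = mxC x. Proof. by []. Qed.

Lemma complex_rowE (w : 'rV[C]_n) : w = mxC (ReC w) + 'i%C *: mxC (ImC w).
Proof. by apply/rowP => j; rewrite !mxE; exact: complexE. Qed.

Lemma ReC_mxC (x y : V) : ReC (mxC x + 'i%C *: mxC y) = x.
Proof. by apply/rowP => j; rewrite !mxE /= !mul0r mulr0 subrr addr0. Qed.

Lemma ImC_mxC (x y : V) : ImC (mxC x + 'i%C *: mxC y) = y.
Proof. by apply/rowP => j; rewrite !mxE /= !mul0r mul1r !add0r. Qed.

Lemma mul_complex_mxC (w : 'rV[C]_n) (M : 'M[R]_n) :
  w *m mxC M = mxC (ReC w *m M) + 'i%C *: mxC (ImC w *m M).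
Proof.
by rewrite {1}(complex_rowE w) mulmxDl -scalemxAl /mxC !map_mxM.
Qed.

Lemma ReC_mul (w : 'rV[C]_n) (M : 'M[R]_n) : ReC (w *m mxC M) = ReC w *m M.
Proof. by rewrite mul_complex_mxC ReC_mxC. Qed.

Lemma ImC_mul (w : 'rV[C]_n) (M : 'M[R]_n) : ImC (w *m mxC M) = ImC w *m M.
Proof. by rewrite mul_complex_mxC ImC_mxC. Qed.

Lemma complex_row0 (w : 'rV[C]_n) : ReC w = 0 -> ImC w = 0 -> w = 0.
Proof.
by move=> r0 i0; rewrite (complex_rowE w) r0 i0 /mxC !map_mx0 scaler0 addr0.
Qed.

Definition conjC_row (w : 'rV[C]_n) : 'rV[C]_n := map_mx (@conjc R) w.

Lemma conjC_rowM w (M : 'M[R]_n) : conjC_row (w *m mxC M) = conjC_row w *m mxC M.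
Proof.
rewrite /conjC_row map_mxM; congr (_ *m _).
by apply/matrixP => i j; apply/eqP; rewrite !mxE eq_complex /= oppr0 !eqxx.
Qed.

Lemma conjC_rowZ (a : C) w : conjC_row (a *: w) = conjc a *: conjC_row w.
Proof. by rewrite /conjC_row map_mxZ. Qed.

Lemma conjC_row_neq0 w : w != 0 -> conjC_row w != 0.
Proof. by rewrite /conjC_row map_mx_eq0. Qed.

Variable g : lieAlgebra R n.

Definition adC (u : 'rV[C]_n) : 'M[C]_n :=
  mxC (ad_mx g (ReC u)) + 'i%C *: mxC (ad_mx g (ImC u)).

Lemma bracketCE u v : bracketC g u v = v *m adC u.
Proof.
rewrite /adC mulmxDr -scalemxAr !mul_complex_mxC !mul_ad_mx.
rewrite /bracketC !toCE scalerDr scalerA mulii scaleN1r.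
rewrite /mxC !map_mxD map_mxN scalerDr.
have key (A B D E : 'rV[C]_n) : A - D + (B + E) = A + B + (E - D).
  by rewrite addrACA [- D + E]addrC.
exact: key.
Qed.

Lemma ReCD (u v : 'rV[C]_n) : ReC (u + v) = ReC u + ReC v.
Proof. by apply/rowP => j; rewrite !mxE; case: (u 0 j) (v 0 j) => [? ?] [? ?]. Qed.

Lemma ImCD (u v : 'rV[C]_n) : ImC (u + v) = ImC u + ImC v.
Proof. by apply/rowP => j; rewrite !mxE; case: (u 0 j) (v 0 j) => [? ?] [? ?]. Qed.

Lemma ReCZ (a : C) (u : 'rV[C]_n) : ReC (a *: u) = complex.Re a *: ReC u - complex.Im a *: ImC u.
Proof. by apply/rowP => j; rewrite !mxE; case: a (u 0 j) => [? ?] [? ?]. Qed.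

Lemma ImCZ (a : C) (u : 'rV[C]_n) : ImC (a *: u) = complex.Re a *: ImC u + complex.Im a *: ReC u.
Proof. by apply/rowP => j; rewrite !mxE; case: a (u 0 j) => [? ?] [? ?]. Qed.

Lemma adC_linear (a : C) u v : adC (a *: u + v) = a *: adC u + adC v.
Proof.
rewrite /adC ReCD ImCD ReCZ ImCZ !ad_mxD ad_mxN !ad_mxZ.
apply/matrixP => i j; rewrite !mxE.
case: a => a b; apply/eqP; rewrite eq_complex /=.
by apply/andP; split; apply/eqP; ring.
Qed.

End Complexification.

Section FixedPoints.
Context {R : realType} {n : nat} (g : lieAlgebra R n).
Local Notation C := R[i].
Local Notation V := 'rV[R]_n.
Local Notation ad := (ad_mx g).
Variables (k p t : {vspace V}) (z : V).
Hypothesis gsimple : simple_lie g.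
Hypothesis cartan : cartan_decomposition g k p.
Hypothesis t_max : maximal_abelian_in g k t.
Hypothesis zc : in_center g k z.
Hypothesis z_spec : spec_ad g z = [set 0; 'i%C; - 'i%C].

Let tk x : x \in t -> x \in k.
Proof. by case: t_max => /subvP + _ _; apply. Qed.
Let tt x y : x \in t -> y \in t -> g x y = 0.
Proof. by case: t_max => _ + _ *; apply. Qed.

(** Adding the line of [z] to t keeps it abelian and inside k, so maximality absorbs it. *)
Lemma center_mem_torus : z \in t.
Proof.
have [zk zk0] := zc; have [_ _ tM] := t_max.
suff E : (t + <[z]>)%VS = t.
  rewrite -E; apply/memv_addP; exists 0; first exact: mem0v.
  by exists z; [exact: memv_line|rewrite add0r].
apply: tM.
- by rewrite subv_add -memvE zk andbT; case: t_max.
- move=> x y /memv_addP[x1 x1t [_ /vlineP[a ->] ->]] /memv_addP[y1 y1t [_ /vlineP[b ->] ->]].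
  rewrite bracketDl !bracketDr tt // !bracketZl !bracketZr bracket_alt.
  by rewrite (bracket_anti _ x1) !zk0 ?tk // oppr0 !scaler0 !addr0.
- exact: addvSl.
Qed.

Lemma ad_torus_comm x y : x \in t -> y \in t -> ad x *m ad y = ad y *m ad x.
Proof.
move=> xt yt; have := ad_mx_bracket g x y; rewrite tt // ad_mx0 => /esym/eqP.
by rewrite subr_eq0 => /eqP ->.
Qed.

Lemma adz_neq0 : ad z != 0.
Proof.
apply/eqP => z0; have : spec_ad g z 'i%C by rewrite z_spec /=; left; right.
rewrite /spec_ad /= z0 map_mx0 => /eigenvalueP[v]; rewrite mulmx0 => /esym/eqP.
rewrite scaler_eq0 => /orP[/eqP|->//].
by move=> /(congr1 (@complex.Im R)) /= /eqP; rewrite oner_eq0.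
Qed.

(** The fixed space of [M] in the complexified p is non-zero and stable under the commuting
    operators ad y for [y] in t, so over the complex numbers they have a common eigenvector in
    it. *)
Lemma torus_common_eigenvector (M : 'M[R]_n) (u : V) :
  (forall y, y \in t -> M *m ad y = ad y *m M) ->
  u \in p -> u != 0 -> u *m M = u ->
  exists w : 'rV[C]_n, [/\ w != 0, w *m mxC M = w, w *m mxC (proj_p k p) = w &
    forall y, y \in t -> exists l : C, w *m mxC (ad y) = l *: w].
Proof.
move=> Mt up u0 uM.
pose P := mxC (proj_p k p).
pose V0 := (kermx (mxC M - 1%:M) :&: P)%MS.
have PP : P *m P = P.
  rewrite /P /mxC -map_mxM; congr (map_mx _ _).
  by apply: row_mx_ext => x; rewrite mulmxA (proj_p_id cartan) // mul_proj_p.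
have uV : (mxC u <= V0)%MS.
  rewrite sub_capmx; apply/andP; split.
    by apply/sub_kermxP; rewrite mulmxBr mulmx1 /mxC -map_mxM uM subrr.
  rewrite -[u](proj_p_id cartan up) /mxC map_mxM; exact: submxMl.
have V0n : V0 != 0.
  apply: contra u0 => /eqP V00; move: uV; rewrite V00 submx0 /mxC map_mx_eq0.
  by [].
have V0M : V0 *m (mxC M - 1%:M) = 0 by apply/sub_kermxP; exact: capmxSl.
have [D V0P] := submxP (capmxSr (kermx (mxC M - 1%:M)) P).
have stab y : y \in t -> stablemx V0 (mxC (ad y)).
  move=> yt; rewrite sub_capmx; apply/andP; split.
    apply/sub_kermxP; rewrite -mulmxA.
    have -> : mxC (ad y) *m (mxC M - 1%:M) = (mxC M - 1%:M) *m mxC (ad y).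
      by rewrite mulmxBr mulmxBl mulmx1 mul1mx /mxC -!map_mxM Mt.
    by rewrite mulmxA V0M mul0mx.
  rewrite -/V0 in V0P *; rewrite V0P -mulmxA.
  have -> : P *m mxC (ad y) = mxC (ad y) *m P.
    by rewrite /P /mxC -!map_mxM (ad_k_proj_p cartan (tk yt)).
  by rewrite mulmxA submxMl.
(* A basis of t suffices: the eigenvalue for a general [y] is the same linear combination of the
   basis eigenvalues. *)
pose As := [seq restrictmx V0 (mxC (ad y)) | y <- vbasis t].
have tb y : y \in vbasis t -> y \in t := @vbasis_mem _ _ _ _.
have [||v v0 /allP vA] := @common_eigenvector _ _ As.
- by rewrite lt0n mxrank_eq0.
- move=> _ _ /mapP[y yt ->] /mapP[y' yt' ->].
  have inV b : b \in vbasis t -> mxC (ad b) \in [pred f | stablemx (row_base V0) f].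
    by move=> bt; rewrite inE stablemx_row_base stab // tb.
  have cm : mxC (ad y) *m mxC (ad y') = mxC (ad y') *m mxC (ad y).
    by rewrite /mxC -!map_mxM ad_torus_comm ?tb.
  have e1 := conjmxM (inV _ yt) (inV _ yt').
  have e2 := conjmxM (inV _ yt') (inV _ yt).
  exact: etrans (esym e1) (etrans (congr1 (conjmx (row_base V0)) cm) e2).
pose w := v *m row_base V0.
have w0 : w != 0 by rewrite mulmx_free_eq0 ?row_base_free.
have wV : (w <= V0)%MS by rewrite mulmx_sub // eq_row_base.
exists w; split => //.
- have : w *m (mxC M - 1%:M) = 0.
    by apply/sub_kermxP; apply: submx_trans wV (capmxSl _ _).
  by rewrite mulmxBr mulmx1 => /eqP; rewrite subr_eq0 => /eqP.
- have /submxP[E ->] : (w <= P)%MS by apply: submx_trans wV (capmxSr _ _).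
  by rewrite -mulmxA PP.
move=> y yt.
have eb (i : 'I_(\dim t)) : exists l : C, w *m mxC (ad (vbasis t)`_i) = l *: w.
  have yi : (vbasis t)`_i \in vbasis t by rewrite mem_nth // size_tuple.
  have := vA (restrictmx V0 (mxC (ad (vbasis t)`_i))) (map_f _ yi).
  by rewrite stablemx_restrict ?stab ?tb // => /sub_rVP[l El]; exists l.
have [l El] := choice eb.
exists (\sum_i real_complex R (coord (vbasis t) i y) * l i).
rewrite {1}(coord_vbasis yt) ad_mx_sum /mxC raddf_sum /= mulmx_sumr scaler_suml.
apply: eq_bigr => i _.
by rewrite ad_mxZ map_mxZ -scalemxAr El scalerA.
Qed.

(** Of the three possible eigenvalues of ad z, 0 is excluded by injectivity on p, and [i] is turned
    into [-i] by complex conjugation, which respects the real matrices [M] and ad y. The eigenvalue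
    [-i] is the one for which [i alpha(z) = 1]. *)
Lemma torus_root_vector (M : 'M[R]_n) (u : V) :
  (forall y, y \in t -> M *m ad y = ad y *m M) ->
  u \in p -> u != 0 -> u *m M = u ->
  exists w : 'rV[C]_n, [/\ w != 0, w *m mxC M = w, w *m mxC (ad z) = - 'i%C *: w &
    forall y, y \in t -> exists l : C, w *m mxC (ad y) = l *: w].
Proof.
move=> Mt up u0 uM.
have [w [w0 wM wp wt]] := torus_common_eigenvector Mt up u0 uM.
have [l El] := wt z center_mem_torus.
have : spec_ad g z l by apply/eigenvalueP; exists w.
rewrite z_spec /= => -[[l0|li]|li].
- exfalso; move/eqP: w0; apply; rewrite l0 scale0r in El.
  have inj a : a \in p -> a *m ad z = 0 -> a = 0.
    move=> ap; rewrite mul_ad_mx; exact: (adz_p_inj cartan gsimple zc adz_neq0).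
  apply: complex_row0.
    apply: inj; last by rewrite -ReC_mul El; apply/rowP => j; rewrite !mxE.
    rewrite -wp ReC_mul; exact: mul_proj_p.
  apply: inj; last by rewrite -ImC_mul El; apply/rowP => j; rewrite !mxE.
  rewrite -wp ImC_mul; exact: mul_proj_p.
- exists (conjC_row w); split.
  + exact: conjC_row_neq0.
  + by rewrite -conjC_rowM wM.
  + rewrite -conjC_rowM El conjC_rowZ li; congr (_ *: _).
    by apply/eqP; rewrite eq_complex /= oppr0 !eqxx.
  + move=> y yt; have [m Em] := wt y yt; exists (conjc m).
    by rewrite -conjC_rowM Em conjC_rowZ.
by exists w; split => //; rewrite El li.
Qed.

(** On the span of [a] and [b] the group [A] acts as a rotation. The curve [c] turns the opposite
    way, so [c s *m A s] is constant. *)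
Lemma rotation_orbit (A : R -> 'M[R]_n) (X : 'M[R]_n) (a b : V) (th : R) :
  mx_group A X -> a *m X = - (th *: b) -> b *m X = th *: a ->
  (cos th *: a + sin th *: b) *m A 1 = a.
Proof.
move=> AX aX bX.
pose c (s : R) := cos (th * s) *: a + sin (th * s) *: b.
have dlin (s : R) : is_derive s 1 (fun u : R => th * u) th.
  have := @is_deriveZ _ _ _ _ th s 1 _ (is_derive_id s 1).
  by rewrite /GRing.scale /= mulr1.
have dc s : mx_deriv c s (th *: (- (sin (th * s) *: a) + cos (th * s) *: b)).
  move=> i j; rewrite ord1.
  have -> : (fun u => c u 0 j) =
     (fun u : R => a 0 j *: cos (th * u)) + (fun u : R => b 0 j *: sin (th * u)).
    by apply/funext => u; rewrite /c !mxE mulrC [X in _ + X = _]mulrC.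
  have d1 := is_derive1_comp (is_derive_cos (th * s)) (dlin s).
  have d2 := is_derive1_comp (is_derive_sin (th * s)) (dlin s).
  have D := is_deriveD (is_deriveZ (a 0 j) d1) (is_deriveZ (b 0 j) d2).
  have -> : (th *: (- (sin (th * s) *: a) + cos (th * s) *: b)) 0 j =
    a 0 j *: (- sin (th * s) * th) + b 0 j *: (cos (th * s) * th).
    by rewrite !mxE /GRing.scale /=; ring.
  exact: D.
have := @mx_deriv0_cst R _ _ (fun s => c s *m A s) 1 0.
rewrite /c !mulr1 !mulr0 cos0 sin0 scale1r scale0r addr0 (mx_group0 AX) mulmx1.
apply => s; have := mx_derivM (dc s) (mx_group_derivl AX s).
suff -> : th *: (- (sin (th * s) *: a) + cos (th * s) *: b) *m A s +
  c s *m (X *m A s) = 0 by [].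
rewrite mulmxA -mulmxDl [c s *m X]mulmxDl -!scalemxAl aX bX.
have -> : th *: (- (sin (th * s) *: a) + cos (th * s) *: b) +
  (cos (th * s) *: - (th *: b) + sin (th * s) *: (th *: a)) = 0.
  by apply/rowP => i; rewrite !mxE; ring.
by rewrite mul0mx.
Qed.

Lemma no_rotation_fixed (A : R -> 'M[R]_n) (X : 'M[R]_n) (a b : V) (th : R) :
  mx_group A X -> 0 < th < 2 * pi -> a *m X = - (th *: b) -> b *m X = th *: a ->
  a *m A 1 = a -> b *m A 1 = b -> a = 0 /\ b = 0.
Proof.
move=> AX /andP[th0 th2] aX bX a1 b1.
have e1 := rotation_orbit AX aX bX.
have e2 : (cos th *: b + sin th *: - a) *m A 1 = b.
  by apply: (rotation_orbit AX); rewrite ?mulNmx ?aX ?bX ?scalerN ?opprK.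
rewrite mulmxDl -!scalemxAl a1 b1 in e1.
rewrite mulmxDl -!scalemxAl mulNmx a1 b1 in e2.
(* In the half-angle formula, [th / 2] lies strictly between 0 and pi, where the sine is
   positive. *)
have c1 : cos th < 1.
  have sp : 0 < sin (th / 2) by apply: sin_gt0_pi; rewrite ?divr_gt0 // ltr_pdivrMr // mulrC.
  have -> : cos th = 1 - 2 * sin (th / 2) ^+ 2.
    rewrite {1}(splitr th) cosD -!expr2 cos2sin2; ring.
  by have := exprn_gt0 2 sp; lra.
(* Cramer's rule for the rotation minus the identity: its determinant is [(1 - cos th)^2 + sin th^2
   = 2 - 2 * cos th]. *)
have E (u v : V) : cos th *: u + sin th *: v = u -> cos th *: v - sin th *: u = v -> u = 0.
  move=> h1 h2.
  have : (2 - 2 * cos th) *: u = 0.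
    have -> : (2 - 2 * cos th) *: u = (1 - cos th) *: (u - (cos th *: u + sin th *: v))
       + sin th *: (v - (cos th *: v - sin th *: u)) +
       (1 - (cos th ^+ 2 + sin th ^+ 2)) *: u.
      by apply/rowP => i; rewrite !mxE; ring.
    by rewrite h1 h2 !subrr cos2Dsin2 subrr !scaler0 scale0r !addr0.
  by move/eqP; rewrite scaler_eq0 => /orP[/eqP h|/eqP //]; exfalso; lra.
split; first by apply: (E a b) => //; rewrite -[RHS]e2 scalerN.
apply: (E b (- a)); first exact: e2.
by rewrite scalerN -opprD e1.
Qed.

(** A fixed vector would yield a fixed root vector [w] whose root takes the value [-i] at [z]. That
    root is positive and non-compact, so [i alpha(x)] is an angle strictly between 0 and 2 pi. The
    group rotates the real and imaginary parts of [w] through this angle and cannot fix them. *)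
Lemma torus_exp_no_fixed (A : R -> 'M[R]_n) (x u : V) :
  mx_group A (ad x) -> t_se g p t z x -> u \in p -> u *m A 1 = u -> u = 0.
Proof.
move=> AX [xt xse] up uA; apply/eqP/negPn/negP => u0.
have At y : y \in t -> A 1 *m ad y = ad y *m A 1.
  by move=> yt; apply: (mx_group_intertwine _ AX AX); exact: ad_torus_comm.
have [w [w0 wA wz wt]] := torus_root_vector At up u0 uA.
have [j wj] : exists j, w 0 j != 0.
  apply/existsP; apply: contraNT w0; rewrite negb_exists => /forallP H.
  by apply/eqP/rowP => j; rewrite mxE; apply/eqP; have := H j; rewrite negbK.
(* Roots are encoded as linear forms on the whole complexified algebra. Reading off one non-zero
   coordinate of [w] gives such a form; it is the eigenvalue whenever [w] is an eigenvector, in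
   particular on the complexified t. *)
pose al (v : 'rV[C]_n) : C^o := (bracketC g v w) 0 j / w 0 j.
have al_lin : linear al.
  move=> a v v'; rewrite /al !bracketCE adC_linear mulmxDr -scalemxAr.
  by rewrite [(_ + _ : 'rV_n) 0 j]mxE [(a *: _ : 'rV_n) 0 j]mxE mulrDl -mulrA.
pose m := GRing.isLinear.Build _ _ _ _ _ al_lin.
pose alpha : {linear 'rV[C]_n -> C^o} := HB.pack al m.
have eig v (l : C) : bracketC g v w = l *: w -> alpha v = l.
  by move=> E; rewrite /alpha /= /al E mxE mulfK.
have real y (l : C) : w *m mxC (ad y) = l *: w -> bracketC g (toC y) w = l *: w.
  move=> E; rewrite bracketCE /adC toCE -[mxC y]addr0 -(scaler0 _ 'i%C) -(map_mx0 (real_complex R)).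
  by rewrite -/(mxC 0) ReC_mxC ImC_mxC ad_mx0 /mxC map_mx0 scaler0 addr0.
have az : alpha (toC z) = - 'i%C by apply: eig; apply: real.
have toCz : complexified t (toC z).
  rewrite /complexified /= toCE -[mxC z]addr0 -(scaler0 _ 'i%C) -(map_mx0 (real_complex R)).
  by rewrite -/(mxC 0) ReC_mxC ImC_mxC mem0v center_mem_torus.
have pos : positive_noncompact_root g p t z alpha.
  split; last by rewrite az mulrN mulii opprK.
  split; first split.
  - exists (toC z) => //; rewrite az oppr_eq0; apply/eqP.
    by move=> /(congr1 (@complex.Im R)) /= /eqP; rewrite oner_eq0.
  - exists w => // v [v1 v2].
    have [l1 E1] := wt _ v1; have [l2 E2] := wt _ v2.
    have E : bracketC g v w = (l1 + 'i%C * l2) *: w.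
      by rewrite bracketCE /adC mulmxDr -scalemxAr E1 E2 scalerA scalerDl.
    by rewrite E (eig _ _ E).
  (* The root space lies in the complexified p because [v = i [z, v]] there and ad z maps everything
     into p. *)
  move=> v /(_ _ toCz); rewrite az => E.
  have E' : v *m mxC (ad z) = - 'i%C *: v.
    rewrite -E bracketCE /adC toCE -[mxC z]addr0 -(scaler0 _ 'i%C) -(map_mx0 (real_complex R)).
    by rewrite -/(mxC 0) ReC_mxC ImC_mxC ad_mx0 /mxC map_mx0 scaler0 addr0.
  have zp y : g z y \in p.
    rewrite (proj_decomp cartan y) bracketDr; have [_ zk0] := zc.
    rewrite zk0 ?mul_proj_k // add0r.
    case: cartan => _ _ H _ _; apply: H; last exact: mul_proj_p.
    by case: zc.
  have re := ReC_mul v (ad z); have im := ImC_mul v (ad z).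
  rewrite E' ReCZ /= oppr0 scale0r sub0r scaleN1r opprK mul_ad_mx in re.
  rewrite E' ImCZ /= oppr0 scale0r add0r scaleN1r mul_ad_mx in im.
  split; last by rewrite re.
  by rewrite -memvN im.
have := xse _ pos; have [l El] := wt x xt; rewrite (eig _ _ (real _ _ El)).
case: l El => l1 l2 El; rewrite !ltcE /= !mul0r !mul1r add0r sub0r.
(* The order on complex numbers compares real parts and forces equal imaginary parts: the eigenvalue
   [l1 + i l2] is purely imaginary and the angle is [- l2]. *)
move=> /andP[/andP[/eqP l10 th0] /andP[_ th2]].
have re := ReC_mul w (ad x); have im := ImC_mul w (ad x).
rewrite El ReCZ /= l10 scale0r sub0r in re.
rewrite El ImCZ /= l10 scale0r add0r in im.
have [|||||] := @no_rotation_fixed A (ad x) (ReC w) (- ImC w) (- l2) AX.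
- by rewrite th0 th2.
- by rewrite -re scaleNr scalerN opprK.
- by rewrite mulNmx -im scaleNr.
- by rewrite -ReC_mul wA.
- by rewrite mulNmx -ImC_mul wA.
move=> r0 /eqP; rewrite oppr_eq0 => /eqP i0.
by move/eqP: w0; apply; exact: complex_row0.
Qed.

End FixedPoints.

(** * Closedness of the set of conjugates *)

Section MatrixContinuity.
Context {R : realType} {T : Type} {F : set_system T} {FF : Filter F}.

Lemma cvg_mx m n (M : T -> 'M[R]_(m, n)) (L : 'M[R]_(m, n)) :
  (forall i j, M x i j @[x --> F] --> L i j) -> M x @[x --> F] --> L.
Proof.
move=> H; apply/cvgrPdist_le => eps eps0.
have Hij (ij : 'I_m * 'I_n) : \forall x \near F, `|L ij.1 ij.2 - M x ij.1 ij.2| <= eps.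
  by have /cvgrPdist_le/(_ _ eps0) := H ij.1 ij.2.
have HF := @filter_forall _ _ (fun ij x => `|L ij.1 ij.2 - M x ij.1 ij.2| <= eps) F FF Hij.
apply: (@filterS _ F FF _ _ _ HF) => x Hx.
rewrite [X in X <= _]/Num.Def.normr /= mx_normrE; apply/bigmax_leP; split; first exact: ltW.
by move=> ij _; rewrite !mxE; exact: Hx.
Qed.

Lemma cvg_mx_coord m n (M : T -> 'M[R]_(m, n)) (L : 'M[R]_(m, n)) i j :
  M x @[x --> F] --> L -> M x i j @[x --> F] --> L i j.
Proof. by move=> H; exact: (cvg_comp _ _ H (@coord_continuous _ _ _ i j L)). Qed.

Lemma cvg_mulmx m n p (M : T -> 'M[R]_(m, n)) (N : T -> 'M[R]_(n, p))
    (L : 'M[R]_(m, n)) (L' : 'M[R]_(n, p)) :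
  M x @[x --> F] --> L -> N x @[x --> F] --> L' ->
  M x *m N x @[x --> F] --> L *m L'.
Proof.
move=> ML NL; apply: cvg_mx => i j.
rewrite mxE; under eq_cvg do rewrite mxE.
by apply: cvg_sum_seq => k; apply: cvgM; apply: cvg_mx_coord.
Qed.

Lemma cvg_trmx m n (M : T -> 'M[R]_(m, n)) (L : 'M[R]_(m, n)) :
  M x @[x --> F] --> L -> (M x)^T @[x --> F] --> L^T.
Proof.
move=> ML; apply: cvg_mx => i j; rewrite mxE; under eq_cvg do rewrite mxE.
exact: cvg_mx_coord.
Qed.

Lemma cvg_trace n (M : T -> 'M[R]_n) (L : 'M[R]_n) :
  M x @[x --> F] --> L -> \tr (M x) @[x --> F] --> \tr L.
Proof. by move=> ML; rewrite /mxtrace; apply: cvg_sum_seq => i; exact: cvg_mx_coord. Qed.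

End MatrixContinuity.

Lemma mulmx_inv_uniq (R : comUnitRingType) n (A B M : 'M[R]_n) :
  B *m A = 1%:M -> A *m M = 1%:M -> M = B.
Proof. by move=> BA AM; rewrite -[LHS]mul1mx -BA -mulmxA AM mulmx1. Qed.

(** Here [P] and [N] stand for [e^X] and [e^(-X)], self-adjoint for [S], and [M'] for the adjoint of
    [M]. Cyclicity of the trace collects the self-adjoint factors into squares. *)
Lemma mxtrace_conj_isometry (R : comUnitRingType) n (S P N M M' : 'M[R]_n) :
  S \in unitmx -> S *m P^T = P *m S -> S *m N^T = N *m S -> S *m M^T = M' *m S ->
  \tr (N *m (M *m P) *m S *m (N *m (M *m P))^T *m invmx S) =
  \tr (N *m N *m (M *m (P *m P) *m M')).
Proof.
move=> Su HP HN HM.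
have E : S *m (N *m (M *m P))^T = P *m M' *m N *m S.
  by rewrite !trmx_mul !mulmxA HP -(mulmxA P) HM mulmxA -(mulmxA _ S) HN !mulmxA.
rewrite -(mulmxA _ S) E -(mulmxA _ _ (invmx S)) -(mulmxA _ S) mulmxV // mulmx1.
by rewrite (mulmxA _ _ N) mxtrace_mulC !mulmxA.
Qed.

Lemma le_add1_of_sqr_le (R : realFieldType) (r s : R) : 0 <= r -> s ^+ 2 <= r -> s <= 1 + r.
Proof. by move=> r0; rewrite expr2 => sr; have [] := leP s 1; nra. Qed.

(** * The energy of conjugates, displacement in p, and closedness *)

Section AdjointAction.
Context {R : realType} {n : nat} (g : lieAlgebra R n) (G : lieGroupType R n).
Hypothesis G_lie : has_lie_algebra G g.
Local Notation V := 'rV[R]_n.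
Local Notation ad := (ad_mx g).
Implicit Types (a b c : G) (x y : V).

Lemma AdM_continuous : continuous (fun a : G => AdM a).
Proof.
move=> a; suff : AdM b @[b --> a] --> AdM a by [].
by apply: cvg_mx => i j; exact: AdM_coord_continuous.
Qed.

Lemma AdE_group x : mx_group (AdE G x) (ad x).
Proof.
split; [exact: AdED|exact: AdE0|].
by move=> i j; exact: is_derive_AdE0.
Qed.

Lemma AdE1 x : AdE G x 1 = AdM (lie_exp G x).
Proof. by rewrite /AdE scale1r. Qed.

Lemma AdM_inv_uniq a (M : 'M[R]_n) : AdM a *m M = 1%:M -> M = AdM a^-1%g.
Proof. exact: mulmx_inv_uniq (AdM_Vl a). Qed.

Lemma AdEN1 x : AdE G x (- 1) = AdM (lie_exp G x)^-1%g.
Proof.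
apply: AdM_inv_uniq; rewrite -AdE1; exact: (mx_groupV (AdE_group x)).
Qed.

Lemma AdE_Ad a x s : AdE G (Ad a x) s = AdM a^-1%g *m AdE G x s *m AdM a.
Proof. by rewrite /AdE -AdZ lie_exp_Ad !AdM_M mulmxA. Qed.

Variables (k p t : {vspace V}) (z : V).
Hypothesis cartan : cartan_decomposition g k p.
Hypothesis gsimple : simple_lie g.
Hypothesis t_max : maximal_abelian_in g k t.
Hypothesis zc : in_center g k z.
Hypothesis z_spec : spec_ad g z = [set 0; 'i%C; - 'i%C].
Local Notation S := (cartan_mx g k p).
Local Notation Pk := (proj_k k p).
Local Notation Pp := (proj_p k p).

Lemma AdM_proj_V a : AdM a *m Pk = Pk *m AdM a -> AdM a^-1%g *m Pk = Pk *m AdM a^-1%g.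
Proof.
have := AdM_V a; have := AdM_Vl a; move: (AdM a) (AdM a^-1%g) => A B BA AB H.
by rewrite -[LHS]mulmx1 -AB mulmxA -(mulmxA B) -H mulmxA BA mul1mx.
Qed.

(** Commuting with the projection is stable under the group operations, so it is enough to check
    exponentials of k. *)
Lemma integral_subgroup_proj a : integral_subgroup k a -> AdM a *m Pk = Pk *m AdM a.
Proof.
move=> H; apply: (H [set a : G | AdM a *m Pk = Pk *m AdM a]); split.
- move=> _ [x xk <-]; rewrite /= -AdE1.
  apply: (mx_group_intertwine _ (AdE_group x) (AdE_group x)).
  exact: (ad_k_proj_k cartan).
- by rewrite /= AdM_1 mul1mx mulmx1.
- move=> a' b' /=; rewrite (AdM_M a' b'); move: (AdM a') (AdM b') => A B HA HB.
  by rewrite -mulmxA HA mulmxA HB mulmxA.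
- by move=> a' /= Ha; exact: AdM_proj_V.
Qed.

Lemma Ad_mem_p a x : AdM a *m Pk = Pk *m AdM a -> x \in p -> Ad a x \in p.
Proof.
move=> H xp; apply: (mem_p_proj cartan).
by rewrite -mul_AdM -mulmxA H mulmxA (proj_k_p cartan) // mul0mx.
Qed.

Lemma Ad_mem_k a x : AdM a *m Pk = Pk *m AdM a -> x \in k -> Ad a x \in k.
Proof.
move=> H xk; rewrite -mul_AdM -[x](proj_k_id cartan xk) -mulmxA -H mulmxA.
exact: mul_proj_k.
Qed.

Lemma lie_exp_k_isometry y c : y \in k -> c = lie_exp G y ->
  AdM c *m S = S *m (AdM c^-1%g)^T /\ AdM c^-1%g *m S = S *m (AdM c)^T.
Proof.
move=> yk ->; rewrite -AdEN1 -AdE1.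
have H s : AdE G y s *m S = S *m (AdE G y (- s))^T.
  apply: (mx_group_intertwine s (AdE_group y) (mx_group_tr (mx_groupN (AdE_group y)))).
  by rewrite (ad_k_cartan cartan) // [(- _)^T]linearN /= mulmxN.
by split; rewrite H ?opprK.
Qed.

Lemma K_se_elim c : K_se G g k p t z c ->
  [/\ exists2 y, y \in k & c = lie_exp G y,
      AdM c *m Pk = Pk *m AdM c &
      forall u, u \in p -> Ad c u = u -> u = 0].
Proof.
move=> [_ [k0 Kk0 [x xse <-]] <-].
have Hk0 := integral_subgroup_proj Kk0.
have xk : x \in k by case: xse => xt _; case: t_max => /subvP + _ _; apply.
have yk := Ad_mem_k Hk0 xk.
split; first by exists (Ad k0 x).
  rewrite -AdE1; apply: (mx_group_intertwine _ (AdE_group _) (AdE_group _)).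
  exact: (ad_k_proj_k cartan).
move=> u up; rewrite lie_exp_Ad !Ad_M => E.
have u'p := Ad_mem_p (AdM_proj_V Hk0) up.
have E' : Ad k0^-1%g u *m AdE G x 1 = Ad k0^-1%g u.
  rewrite AdE1 mul_AdM; have := congr1 (Ad k0^-1%g) E.
  by rewrite -Ad_M mulVg Ad_1.
have u0 := torus_exp_no_fixed gsimple cartan t_max zc z_spec (AdE_group x) xse u'p E'.
by rewrite -(Ad_1 G u) -(mulgV k0) Ad_M u0 -mul_AdM mul0mx.
Qed.

(* tr (Ad a (Ad a)^* ), the adjoint being taken for the form S. *)
Definition Ad_energy (a : G) : R := \tr (AdM a *m S *m (AdM a)^T *m invmx S).

Lemma Ad_energy_continuous : continuous Ad_energy.
Proof.
move=> a; apply: cvg_trace; apply: cvg_mulmx; last exact: cvg_cst.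
apply: cvg_mulmx; last by apply: cvg_trmx; exact: AdM_continuous.
by apply: cvg_mulmx; [exact: AdM_continuous|exact: cvg_cst].
Qed.

(** The matrix [Mc'] is only asked to be the adjoint of [Mc], so that the formula serves both [c]
    and its inverse. *)
Lemma Ad_energy_conj x c (Mc Mc' : 'M[R]_n) : x \in p -> AdM c = Mc ->
  S *m Mc^T = Mc' *m S ->
  Ad_energy (lie_exp G x * c * (lie_exp G x)^-1)%g =
  \tr (AdE G x (- 2) *m (Mc *m AdE G x 2 *m Mc')).
Proof.
move=> xp Ec HS; have Su := pos_def_unit (cartan_mx_pos_def cartan).
rewrite /Ad_energy !AdM_M Ec -AdEN1 -AdE1.
set A := AdE G x.
have AS s : S *m (A s)^T = A s *m S.
  apply: esym; apply: (mx_group_intertwine s (AdE_group x) (mx_group_tr (AdE_group x))).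
  exact: (ad_p_cartan cartan).
have A2 : A 2 = A 1 *m A 1 by rewrite -(mx_groupD (AdE_group x)).
have A2' : A (- 2) = A (- 1) *m A (- 1).
  by rewrite -(mx_groupD (AdE_group x)) -opprD.
by rewrite A2 A2'; exact: mxtrace_conj_isometry.
Qed.

(* Since Ad c is an isometry, for X = ad x and Y = ad (Ad c^-1 x) this is
   4 tr ((X - Y)^2) <= tr (e^2X e^-2Y) + tr (e^-2X e^2Y). *)
Lemma killing_displacement_le x c (w := x - Ad c^-1%g x) : x \in p ->
  (exists2 y, y \in k & c = lie_exp G y) -> AdM c *m Pk = Pk *m AdM c ->
  4 * killing g w w <=
  Ad_energy (lie_exp G x * c * (lie_exp G x)^-1)%g +
  Ad_energy (lie_exp G x * c * (lie_exp G x)^-1)^-1%g.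
Proof.
move=> xp [y yk cE] Hc.
have [I1 I2] := lie_exp_k_isometry yk cE.
have Hc' := AdM_proj_V Hc.
have yp := Ad_mem_p Hc' xp.
have -> : ((lie_exp G x * c * (lie_exp G x)^-1)^-1 =
  lie_exp G x * c^-1 * (lie_exp G x)^-1)%g by rewrite !invgM invgK mulgA.
rewrite (Ad_energy_conj xp erefl (esym I2)) (Ad_energy_conj xp erefl (esym I1)).
have BE s : AdE G (Ad c^-1%g x) s = AdM c *m AdE G x s *m AdM c^-1%g.
  exact: etrans (AdE_Ad _ _ _)
    (congr1 (fun b => AdM b *m AdE G x s *m AdM c^-1%g) (invgK c)).
have := trace_group_ge (AdE_group x) (AdE_group (Ad c^-1%g x)) (cartan_mx_pos_def cartan)
  (ad_p_cartan cartan xp) (ad_p_cartan cartan yp).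
rewrite -ad_mxB !BE /killing => H; apply: le_trans H _.
move: (AdE G x 2) (AdE G x (-2)) (AdM c) (AdM c^-1%g) => A2 A2' A A'.
rewrite addrC lerD2l (mulmxA A2) mxtrace_mulC -!mulmxA.
by rewrite [leRHS]mxtrace_mulC -!mulmxA.
Qed.

(** The displacement vanishes only when Ad c fixes [x], and the Killing form is positive on p. *)
Lemma killing_displacement_gt0 x c : x \in p -> x != 0 -> K_se G g k p t z c ->
  0 < killing g (x - Ad c^-1%g x) (x - Ad c^-1%g x).
Proof.
move=> xp x0 /K_se_elim[_ Hc fx].
have yp := Ad_mem_p (AdM_proj_V Hc) xp.
case: cartan => _ _ _ _ [_ kp]; apply: kp; first by rewrite memvB.
apply: contra x0 => /eqP E; apply/eqP; apply: fx => //.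
have /eqP := E; rewrite subr_eq0 => /eqP E'.
by rewrite {1}E' -Ad_M mulgV Ad_1.
Qed.

Definition displacement (cx : G * V) : R :=
  killing g (cx.2 - Ad cx.1^-1%g cx.2) (cx.2 - Ad cx.1^-1%g cx.2).

Lemma displacement_continuous : continuous displacement.
Proof.
move=> [c x].
have c1 : cx.1 @[cx --> (c, x)] --> c by exact: cvg_fst.
have c2 : cx.2 @[cx --> (c, x)] --> x by exact: cvg_snd.
have c3 : AdM (cx.1)^-1%g @[cx --> (c, x)] --> AdM c^-1%g.
  have h1 := cvg_comp _ _ c1 (@lie_inv_continuous _ _ G c).
  exact: (cvg_comp _ _ h1 (@AdM_continuous _)).
have c4 : cx.2 - cx.2 *m AdM (cx.1)^-1%g @[cx --> (c, x)] --> x - x *m AdM c^-1%g.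
  by apply: cvgB => //; exact: cvg_mulmx.
rewrite (_ : displacement = fun cx : G * V =>
   ((cx.2 - cx.2 *m AdM (cx.1)^-1%g) *m killing_mx g *m
    (cx.2 - cx.2 *m AdM (cx.1)^-1%g)^T) 0 0); last first.
  by apply/funext => cx; rewrite killingE mul_AdM.
apply: cvg_mx_coord; apply: cvg_mulmx; last exact: cvg_trmx.
by apply: cvg_mulmx => //; exact: cvg_cst.
Qed.

Lemma displacementZ c (s : R) x : displacement (c, s *: x) = s ^+ 2 * displacement (c, x).
Proof.
rewrite /displacement /= AdZ -scalerBr /killing ad_mxZ -scalemxAl -scalemxAr !linearZ /=.
by rewrite mulrA expr2.
Qed.

Lemma closed_mem_p : closed [set x : V | x \in p].
Proof.
have -> : [set x : V | x \in p] = (fun x => `|x *m Pk|) @^-1` [set s | s <= 0].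
  apply/seteqP; split => x /=.
    by move=> xp; rewrite (proj_k_p cartan) // normr0.
  by rewrite normr_le0 => /eqP/(mem_p_proj cartan).
apply: (continuous_closedP _).1; last exact: closed_le.
move=> x; have h : y *m Pk @[y --> x] --> x *m Pk.
  by apply: (@cvg_mulmx _ _ (nbhs x)); [exact: cvg_id|exact: cvg_cst].
exact: (cvg_norm h).
Qed.

Lemma compact_ball_p (M : R) : compact [set x : V | x \in p /\ `|x| <= M].
Proof.
apply: bounded_closed_compact.
  exists M; split; first exact: num_real.
  by move=> r Mr x [_ xM]; apply: le_trans xM (ltW Mr).
rewrite (_ : [set _ | _] = [set x | x \in p] `&` (fun x => `|x|) @^-1` [set s | s <= M]) //.
apply: closedI; first exact: closed_mem_p.
apply: (continuous_closedP _).1; last exact: closed_le.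
exact: norm_continuous.
Qed.

Lemma compact_sphere_p : compact [set x : V | x \in p /\ `|x| = 1].
Proof.
rewrite (_ : [set _ | _] = [set x | x \in p /\ `|x| <= 1] `&` (fun x => `|x|) @^-1` [set s | s = 1]).
  apply: compact_closedI; first exact: compact_ball_p.
  apply: (continuous_closedP _).1; last exact: closed_eq.
  exact: norm_continuous.
by apply/seteqP; split => x /=; [move=> [xp ->]|move=> [[]]].
Qed.

(** The displacement is homogeneous of degree 2 in [x], so its minimum on the product of [C] with
    the unit sphere of p controls all of p. *)
Lemma displacement_ge (C : set G) : compact C -> C `<=` K_se G g k p t z ->
  exists2 m : R, 0 < m & forall c x, C c -> x \in p -> m * `|x| ^+ 2 <= displacement (c, x).
Proof.
move=> Cc Cs; pose Q := C `*` [set x : V | x \in p /\ `|x| = 1].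
have Qc : compact Q by apply: compact_setX => //; exact: compact_sphere_p.
have red (m : R) : (forall c x, Q (c, x) -> m <= displacement (c, x)) ->
    forall c x, C c -> x \in p -> m * `|x| ^+ 2 <= displacement (c, x).
  move=> H c x cC xp; have [->|x0] := eqVneq x 0.
    by rewrite normr0 expr0n mulr0 -(scale0r (0 : V)) displacementZ expr0n mul0r.
  have nx : 0 < `|x| by rewrite normr_gt0.
  have -> : x = `|x| *: (`|x|^-1 *: x) by rewrite scalerA divff ?scale1r // gt_eqF.
  rewrite displacementZ normrZ normr_id normrZ normfV normr_id mulVf ?gt_eqF // mulr1 mulrC.
  rewrite ler_wpM2l ?exprn_ge0 //; apply: H; split => //=; split; first exact: memvZ.
  by rewrite normrZ normfV normr_id mulVf // gt_eqF.
(* The product is empty when [C] is empty or p is zero; then the bound on it is vacuous and any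
   positive [m] serves. *)
have [Q0|Q0] := pselect (Q !=set0); last first.
  by exists 1 => //; apply: red => c x Qcx; exfalso; apply: Q0; exists (c, x).
have [[c0 x0] Q00 mn] := compact_EVT_min Q0 Qc
  (continuous_subspaceT (A := Q) displacement_continuous).
exists (displacement (c0, x0)); last first.
  by apply: red => c x Qcx; apply: mn; rewrite inE.
move: Q00; rewrite inE => -[/= c0C [x0p x01]].
apply: killing_displacement_gt0 => //; last exact: Cs.
apply/eqP => /= x00; move: x01; rewrite x00 normr0 => /eqP; by rewrite eq_sym oner_eq0.
Qed.

Lemma lie_exp_conj_compact (C : set G) (M : R) : compact C ->
  compact [set (lie_exp G x.1 * x.2 * (lie_exp G x.1)^-1)%g |
    x in [set x : V | x \in p /\ `|x| <= M] `*` C].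
Proof.
move=> Cc; apply: continuous_compact; last by apply: compact_setX => //; exact: compact_ball_p.
apply: continuous_subspaceT => -[x c].
have c1 : lie_exp G xc.1 @[xc --> (x, c)] --> lie_exp G x.
  exact: (cvg_comp fst (lie_exp G) cvg_fst (@lie_exp_continuous _ _ G x)).
have c2 : xc.2 @[xc --> (x, c)] --> c by exact: cvg_snd.
have c3 := cvg_comp _ _ c1 (@lie_inv_continuous _ _ G _).
have mulc (f h : V * G -> G) a b : f xc @[xc --> (x, c)] --> a -> h xc @[xc --> (x, c)] --> b ->
    (f xc * h xc)%g @[xc --> (x, c)] --> (a * b)%g.
  move=> fa hb.
  have fh : (f xc, h xc) @[xc --> (x, c)] --> (a, b) by apply: cvg_pair.
  exact: (cvg_comp _ _ fh (@lie_mul_continuous _ _ G _)).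
exact: mulc _ _ (mulc _ _ _ _ c1 c2) c3.
Qed.

Lemma exp_conjugates_closed (C : set G) : compact C -> C `<=` K_se G g k p t z ->
  closed (exp_conjugates p C).
Proof.
move=> Cc Cs b0 clb.
have [m m0 Hm] := displacement_ge Cc Cs.
pose E b := Ad_energy b + Ad_energy b^-1%g.
have Ec : E b @[b --> b0] --> E b0.
  apply: cvgD; first exact: Ad_energy_continuous.
  exact: (cvg_comp _ _ (@lie_inv_continuous _ _ G b0) (@Ad_energy_continuous _)).
pose B := `|E b0| + 1.
have nB : \forall b \near b0, E b <= B.
  have /cvgrPdist_le/(_ 1 ltr01) := Ec; apply: filterS => b Hb.
  move: Hb; rewrite /B; move: (E b0) (E b) => e e'; have := ler_norm e.
  by have := ler_norm (- (e - e')); rewrite normrN; lra.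
(* Conjugates of energy at most [B] satisfy [4 * m * |x|^2 <= B]; the form [1 + B / (4 * m)] bounds
   [|x|] without a square root. *)
pose M := 1 + B / (4 * m).
pose EM := [set (lie_exp G x.1 * x.2 * (lie_exp G x.1)^-1)%g |
    x in [set x : V | x \in p /\ `|x| <= M] `*` C].
have EMcl : closed EM.
  by apply: compact_closed; [exact: lie_hausdorff|exact: lie_exp_conj_compact].
have : EM b0.
  (* Inside the neighbourhood where the energy is at most [B], every conjugate already belongs to
     the compact set [EM], so [b0] is adherent to [EM]. *)
  apply: EMcl => N nN.
  have [b [[_ [x xp <-] [c cC bE]] [bB bN]]] := clb _ (filterI nB nN).
  exists b; split => //; exists (x, c) => //=; split => //=; split => //.
  have [cexp Hc _] := K_se_elim (Cs _ cC).
  have h1 := killing_displacement_le xp cexp Hc.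
  rewrite bE in h1; have h2 := Hm _ _ cC xp; rewrite /displacement /= in h2.
  have h3 : `|x| ^+ 2 <= B / (4 * m).
    rewrite ler_pdivlMr ?mulr_gt0 //; apply: le_trans bB; apply: le_trans h1.
    by rewrite mulrC -mulrA ler_wpM2l.
  have B0 : 0 <= B / (4 * m) by apply: le_trans h3; rewrite exprn_ge0.
  exact: le_add1_of_sqr_le.
move=> [[x c] /= [[xp _] cC] <-].
by exists (lie_exp G x); [exists x|exists c].
Qed.

(** Conjugating an exponential moves its argument along an Ad(G)-orbit, and [g_se] is a union of
    such orbits. *)
Lemma exp_conjugates_G_se (C : set G) : C `<=` K_se G g k p t z ->
  exp_conjugates p C `<=` G_se G g p t z.
Proof.
move=> Cs _ [a _ [c cC <-]].
have [_ [k0 _ [x xse <-]] <-] := Cs _ cC.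
rewrite -lie_exp_Ad -Ad_M.
by exists (Ad (a * k0)%g x) => //; exists (a * k0)%g => //; exists x.
Qed.

End AdjointAction.

Theorem theorem4p7 (R : realType) (n : nat)
    (g : lieAlgebra R n) (g_hermitian : hermitian_lie g)
    (G : lieGroupType R n) (G_connected : connected [set: G])
    (G_lie : has_lie_algebra G g)
    (k p t : {vspace 'rV[R]_n}) (z : 'rV[R]_n)
    (k_max : maximal_compactly_embedded g k)
    (kp_cartan : cartan_decomposition g k p)
    (t_max : maximal_abelian_in g k t)
    (z_center : in_center g k z)
    (z_spec : spec_ad g z = [set 0; 'i%C; - 'i%C])
    (C : set G) (C_compact : compact C) (C_sub : C `<=` K_se G g k p t z) :
  exp_conjugates p C `<=` G_se G g p t z /\ closed (exp_conjugates p C).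
Proof.
have [gs _] := g_hermitian.
split; first exact: (exp_conjugates_G_se C_sub).
exact: (exp_conjugates_closed G_lie kp_cartan gs t_max z_center z_spec).
Qed.
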